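(* Let $N\ge 1$, let $a_0=(a_{0,1},\dots,a_{0,N})$ with all $a_{0,i}>0$, and let $z_0\in\mathbb{R}^N$ have pairwise distinct coordinates (with moreover $z_0\in(-\tfrac14,\tfrac14)^N$ if $X=\mathbb{T}$). Suppose that $\varphi\in \mathrm{KER}^{(2N+1)}$ and that $\eta_W$ is $(2N-1)$-non-degenerate. Then there exist positive constants $t_1,t_W,C,c_R,M$, depending only on $\varphi$, $a_0$ and $z_0$, such that for all $0<t<\min(t_1,t_W)$ there is a function $g_t^*$ of class $C^{2N}$ defined on the ball $B(0,c_R t^{2N-1})=\{(\lambda,w)\in\mathbb{R}\times\mathcal{H}:\ |\lambda|<c_Rt^{2N-1},\ \|w\|_{\mathcal H}<c_Rt^{2N-1}\}$ with values in $\mathbb{R}^N\times\mathbb{R}^N$, such that for all $(\lambda,w)\in B(0,c_R t^{2N-1})$ with $\lambda>0$ and $\|w/\lambda\|_{\mathcal H}\le C$: (1) the problem $\mathcal{P}_\lambda(y_t+w)$ admits a unique solution; (2) that solution has exactly $N$ spikes and is of the form $m_{a,tz}=\sum_{i=1}^N a_i\delta_{tz_i}$ with $(a,z)=g_t^*(\lambda,w)$ (so the $a_i$ are nonzero and the points $tz_i\in X$ are pairwise distinct); (3) $$|(a,z)-(a_0,z_0)|_\infty\le M\left(\frac{|\lambda|}{t^{2N-1}}+\frac{\|w\|_{\mathcal H}}{t^{2N-1}}\right).$$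
   Context: $X$ is $\mathbb{R}$ or the torus $\mathbb{T}=\mathbb{R}/\mathbb{Z}$; $\mathcal{H}$ is a real separable Hilbert space. When $X=\mathbb{T}$, a real number is identified with its class in $\mathbb{T}$ where needed. $\mathcal{M}(X)$ is the space of bounded (signed real) Radon measures on $X$, with total variation norm $|m|(X)$; $\delta_x$ is the Dirac mass at $x$. For $k\in\mathbb{N}$, $\mathrm{KER}^{(k)}$ is the set of $\varphi\in C^k(X,\mathcal{H})$ such that, when $X=\mathbb{R}$, additionally: for all $p\in\mathcal{H}$, $\langle\varphi(x),p\rangle\to0$ as $|x|\to\infty$, and $\sup_{x\in X}\|\varphi^{(i)}(x)\|_{\mathcal H}<\infty$ for $0\le i\le k$. Given $\varphi$, $\Phi:\mathcal{M}(X)\to\mathcal{H}$ is $\Phi m=\int_X\varphi(x)\,dm(x)$, with adjoint $(\Phi^*p)(x)=\langle\varphi(x),p\rangle$. Put $m_{a,tz}=\sum_{i=1}^N a_i\delta_{tz_i}$ and $y_t=\Phi m_{a_0,tz_0}$. For $\lambda>0$ and $w\in\mathcal H$, the BLASSO problem $\mathcal{P}_\lambda(y_t+w)$ is $$\min_{m\in\mathcal{M}(X)}\ \tfrac12\|\Phi m-(y_t+w)\|_{\mathcal H}^2+\lambda|m|(X).$$ Write $\varphi_k=\varphi^{(k)}(0)\in\mathcal{H}$ and $\mathcal{F}_k:\mathbb{R}^{k+1}\to\mathcal{H}$, $\mathcal F_k c=\sum_{j=0}^k c_j\varphi_j$. Hypothesis $\mathcal{I}_k$: $\varphi\in\mathrm{KER}^{(k)}$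 and $(\varphi_0,\dots,\varphi_k)$ are linearly independent. If $\mathcal{I}_{2N-1}$ holds, let $p_W=\mathcal{F}_{2N-1}(\mathcal{F}_{2N-1}^*\mathcal{F}_{2N-1})^{-1}(1,0,\dots,0)^T$, which is the minimal-norm $p\in\mathcal{H}$ with $(\Phi^*p)(0)=1$ and $(\Phi^*p)^{(j)}(0)=0$ for $1\le j\le 2N-1$, and let $\eta_W=\Phi^*p_W$. One says $\eta_W$ is $(2N-1)$-non-degenerate if $\mathcal{I}_{2N-1}$ holds, $\varphi\in\mathrm{KER}^{(2N)}$, $\eta_W^{(2N)}(0)\ne0$ and $|\eta_W(x)|<1$ for all $x\in X\setminus\{0\}$. $|\cdot|_\infty$ is the $\ell^\infty$ norm. *)

(* Defs.v *)
From HB Require Import structures.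
From mathcomp Require Import all_boot all_order all_algebra sesquilinear.
From mathcomp Require Import generic_quotient.
From mathcomp Require Import all_classical all_reals all_analysis.

Set Implicit Arguments.
Unset Strict Implicit.
Unset Printing Implicit Defensive.

Import Order.TTheory GRing.Theory Num.Theory.
Import numFieldTopology.Exports numFieldNormedType.Exports.

Local Open Scope classical_set_scope.
Local Open Scope ring_scope.

(* The normed space of bounded linear maps, with the operator norm. *)
Section BoundedOperators.
Context (R : realType) (V W : normedModType R).

Definition is_clin : {pred V -> W} :=
  fun f => `[< (linear f : Prop) /\ continuous f >].

Record clin := Clin { clin_fun :> V -> W ; clin_subproof : clin_fun \in is_clin }.

HB.instance Definition _ := [isSub for clin_fun].
HB.instance Definition _ := [Choice of clin by <:].

Lemma is_clin_closed : submod_closed is_clin.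
Proof.
split.
  apply/asboolP; split; last exact: cst_continuous.
  by move=> k x y; rewrite /= scaler0 addr0.
move=> a f g /asboolP[lf cf] /asboolP[lg cg]; apply/asboolP; split.
  move=> k x y.
  rewrite -[(a *: f + g) (k *: x + y)]/(a *: f (k *: x + y) + g (k *: x + y)).
  rewrite -[(a *: f + g) x]/(a *: f x + g x) -[(a *: f + g) y]/(a *: f y + g y).
  rewrite lf lg !scalerDr !scalerA mulrC -!addrA; congr (_ + _).
  by rewrite addrCA.
move=> x; apply: cvgD; last exact: cg.
by apply: cvgZl_tmp; exact: cf.
Qed.

HB.instance Definition _ := GRing.isSubmodClosed.Build R (V -> W) is_clin
  is_clin_closed.
HB.instance Definition _ := [SubChoice_isSubLmodule of clin by <:].

Definition opnorm (f : clin) : R :=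
  sup [set `|f x| | x in [set x : V | `|x| <= 1]].

Lemma clin_linear (f : clin) : linear f.
Proof. by case: f => f /= /asboolP[]. Qed.

HB.instance Definition _ (f : clin) :=
  GRing.isLinear.Build R V W *:%R f (@clin_linear f).

Lemma clin_continuous (f : clin) : continuous f.
Proof. by case: f => f /= /asboolP[]. Qed.

Lemma clin_bounded (f : clin) :
  has_sup [set `|f x| | x in [set x : V | `|x| <= 1]].
Proof.
split; first by exists `|f 0|, 0 => //=; rewrite normr0.
have := continuous_linear_bounded 0 (@clin_continuous f 0).
move/linear_boundedP/pinfty_ex_gt0 => [M M0 fM].
exists M => _ [x /= x1 <-]; rewrite (le_trans (fM x))//.
by rewrite -[leRHS]mulr1 ler_pM2l.
Qed.

Lemma opnorm_ge0 (f : clin) : 0 <= opnorm f.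
Proof.
apply: (le_trans (normr_ge0 (f 0))); apply: sup_upper_bound.
  exact: clin_bounded.
by exists 0 => //=; rewrite normr0.
Qed.

Lemma le_opnorm (f : clin) x : `|f x| <= opnorm f * `|x|.
Proof.
have [->|x0] := eqVneq x 0; first by rewrite linear0 !normr0 mulr0.
have nx0 : 0 < `|x| by rewrite normr_gt0.
rewrite -ler_pdivrMr// mulrC -[X in X * _]gtr0_norm ?invr_gt0//.
rewrite -normrZ -linearZ; apply: sup_upper_bound; first exact: clin_bounded.
by exists (`|x|^-1 *: x) => //=; rewrite normrZ gtr0_norm ?invr_gt0// mulVf ?gt_eqF.
Qed.

Lemma opnorm_le (f : clin) (M : R) :
  (forall x, `|x| <= 1 -> `|f x| <= M) -> opnorm f <= M.
Proof.
move=> fM; apply: ge_sup; first by case: (clin_bounded f).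
by move=> _ [x /= x1 <-]; exact: fM.
Qed.

Lemma opnormD (f g : clin) : opnorm (f + g) <= opnorm f + opnorm g.
Proof.
apply: opnorm_le => x x1; rewrite (le_trans (ler_normD _ _))//.
by apply: lerD; apply: sup_upper_bound; [exact: clin_bounded|exists x
  |exact: clin_bounded|exists x].
Qed.

Lemma opnormZ (k : R) (f : clin) : opnorm (k *: f) = `|k| * opnorm f.
Proof.
have le (l : R) (g : clin) : opnorm (l *: g) <= `|l| * opnorm g.
  apply: opnorm_le => x x1.
  rewrite -[(l *: g) x]/(l *: g x) normrZ ler_wpM2l//.
  by apply: sup_upper_bound; [exact: clin_bounded|exists x].
apply/eqP; rewrite eq_le le/=.
have [->|k0] := eqVneq k 0; first by rewrite normr0 mul0r opnorm_ge0.
rewrite -ler_pdivlMl ?normr_gt0// -normfV.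
by apply: le_trans (le _ _); rewrite scalerA mulVf// scale1r.
Qed.

Lemma opnorm0_eq0 (f : clin) : opnorm f = 0 -> f = 0.
Proof.
move=> f0; apply/val_inj/funext => x /=; apply/normr0_eq0/eqP.
by rewrite eq_le normr_ge0 andbT (le_trans (le_opnorm _ _))// f0 mul0r.
Qed.

HB.instance Definition _ :=
  Lmodule_isNormed.Build R clin opnormD opnormZ opnorm0_eq0.

(* The differential of [f] at [x] as a bounded operator; it is [0] when the
   library's ['d f x] is not one, which cannot happen if [f] is differentiable
   at [x]. *)
Definition fdiff (f : V -> W) (x : V) : clin := insubd (0 : clin) ('d f x : V -> W).

Lemma fdiffE (f : V -> W) (x : V) : differentiable f x ->
  fdiff f x = 'd f x :> (V -> W).
Proof.
move=> df; rewrite -[LHS]/(val (fdiff f x)) insubdK//.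
by apply/asboolP; split; [exact: linearP|exact: diff_continuous].
Qed.

End BoundedOperators.

(* Class C^k in the sense of Frechet on an open set [U] of a normed space. *)
Fixpoint class_C_on (R : realType) (V : normedModType R) (k : nat)
    (W : normedModType R) (U : set V) (f : V -> W) : Prop :=
  if k is k'.+1 then
    (forall x, U x -> differentiable f x) /\ class_C_on k' U (fdiff f)
  else forall x, U x -> {for x, continuous f}.

(* The torus R/Z with the quotient topology. *)
Section Torus.
Context (R : realType).
Local Open Scope quotient_scope.

Definition same_class (x y : R) : bool := (x - y) \is a Num.int.

Lemma same_class_refl : reflexive same_class.
Proof. by move=> x; rewrite /same_class subrr rpred0. Qed.

Lemma same_class_sym : symmetric same_class.
Proof. by move=> x y; rewrite /same_class -rpredN opprB. Qed.

Lemma same_class_trans : transitive same_class.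
Proof.
by move=> y x z xy yz; rewrite /same_class -(subrKA y x (- z)) rpredD.
Qed.

Canonical same_class_equiv :=
  EquivRel same_class same_class_refl same_class_sym same_class_trans.

Definition torus := quotient_topology {eq_quot same_class_equiv}.

HB.instance Definition _ := PointedTopological.on torus.

Definition to_torus (x : R) : torus := \pi x.

End Torus.

Inductive domain := Line | Torus.

Definition carrier (R : realType) (X : domain) : ptopologicalType :=
  match X with Line => R | Torus => torus R end.

(* The class of a real number in X (the number itself when X is the line). *)
Definition cls (R : realType) (X : domain) : R -> carrier R X :=
  match X with Line => id | Torus => @to_torus R end.

Notation borel R X := (g_sigma_algebraType (@open (carrier R X))).


Section SignedMeasures.
Context d (T : measurableType d) (R : realType).
Implicit Type m : {charge set T -> \bar R}.

Lemma hahn_exists m :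
  exists PN : set T * set T, hahn_decomposition m PN.1 PN.2.
Proof. by have [P [N PN]] := Hahn_decomposition m; exists (P, N). Qed.

(* A chosen Hahn decomposition; the notions below do not depend on the choice
   (Hahn_decomposition_uniq). *)
Definition hahnP m := svalP (cid (hahn_exists m)).

Definition variation m : set T -> \bar R := charge_variation (hahnP m).

Definition tv_norm m : R := fine (variation m setT).

Definition charge_int m (f : T -> R) : R :=
  \int[jordan_pos (hahnP m)]_x f x - \int[jordan_neg (hahnP m)]_x f x.

(* The values of a charge outside the sigma-algebra are irrelevant. *)
Definition same_charge m m' := forall A, measurable A -> m A = m' A.

Definition charge_add m m' : {charge set T -> \bar R} := cadd m m'.

Definition dirac_sum n (a : 'I_n -> R) (x : 'I_n -> T) :
    {charge set T -> \bar R} :=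
  \big[charge_add/(czero : {charge set T -> \bar R})]_(i < n)
    (cscale (a i) (charge_of_finite_measure (dirac (x i)))
     : {charge set T -> \bar R}).

Lemma dirac_sumE n (a : 'I_n -> R) (x : 'I_n -> T) A :
  dirac_sum a x A = (\sum_(i < n) (a i)%:E * \d_(x i) A)%E.
Proof.
rewrite /dirac_sum; apply: (big_morph (fun m : {charge set T -> \bar R} => m A)).
  by [].
by [].
Qed.

End SignedMeasures.

(* Radon property of a finite signed measure: inner regularity of its total
   variation with respect to compact sets. *)
Definition radon (R : realType) (X : domain)
    (m : {charge set (borel R X) -> \bar R}) : Prop :=
  forall A : set (borel R X), measurable A -> forall e : R, 0 < e ->
  exists K : set (borel R X), [/\ compact (K : set (carrier R X)),
    measurable K, K `<=` A & (variation m (A `\` K) < e%:E)%E].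

Definition class_C (R : realType) (V : normedModType R) (k : nat)
    (f : R -> V) : Prop :=
  (forall i x, (i < k)%N -> derivable (derive1n i f) x 1) /\
  (forall i, (i <= k)%N -> continuous (derive1n i f)).

Section Blasso.
Context (R : realType) (H : completeNormedModType R) (dot : {dot H for idfun}).
Context (X : domain) (phi : carrier R X -> H).

(* [phi] in the coordinate of R: on the torus, this is the 1-periodic function
   on R whose derivatives are by definition those of [phi]. *)
Definition phiR : R -> H := phi \o cls X.

Definition KER (k : nat) : Prop :=
  class_C k phiR /\
  (X = Line ->
   [/\ forall p, dot (phiR x) p @[x --> +oo] --> (0 : R),
       forall p, dot (phiR x) p @[x --> -oo] --> (0 : R) &
       forall i, (i <= k)%N -> exists B : R, forall x, `|derive1n i phiR x| <= B]).

(* The H-valued integral of [phi] against [m]: the vector [h] such that [dot h p]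
   is the integral of [dot (phi x) p] for all [p]. For [phi] in [KER] it exists
   (Riesz representation, [phi] being continuous and bounded) and is unique. *)
Definition Phi (m : {charge set (borel R X) -> \bar R}) : H :=
  xget 0 [set h | forall p, dot h p = charge_int m (fun x => dot (phi x) p)].

Definition Phi_adj (p : H) (x : carrier R X) : R := dot (phi x) p.

Definition spikes (n : nat) (a z : 'rV[R]_n) :
    {charge set (borel R X) -> \bar R} :=
  dirac_sum (fun i => a 0 i) (fun i => cls X (z 0 i) : borel R X).

Definition blasso (lam : R) (y : H) m : R :=
  2^-1 * `|Phi m - y| ^+ 2 + lam * tv_norm m.

Definition blasso_solution (lam : R) (y : H) m : Prop :=
  radon m /\ forall m', radon m' -> blasso lam y m <= blasso lam y m'.

Definition phi_ (k : nat) : H := derive1n k phiR 0.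

Definition calF (k : nat) (c : 'cV[R]_k.+1) : H :=
  \sum_(j < k.+1) c j 0 *: phi_ j.

Definition calF_adj (k : nat) (p : H) : 'cV[R]_k.+1 := \col_j dot (phi_ j) p.

(* The matrix of [calF_adj k \o calF]. *)
Definition gram (k : nat) : 'M[R]_k.+1 := \matrix_(i, j) dot (phi_ i) (phi_ j).

Lemma gramE k (c : 'cV[R]_k.+1) : gram k *m c = calF_adj k (calF c).
Proof.
apply/matrixP => i j; rewrite ord1 !mxE /calF linear_sumr/=.
by apply: eq_bigr => l _; rewrite linearZr/= !mxE mulrC.
Qed.

Definition hypI (k : nat) : Prop :=
  KER k /\ forall c : 'cV[R]_k.+1, calF c = 0 -> c = 0.

(* [delta_mx 0 0] is the column vector (1, 0, ..., 0). *)
Definition pW (N : nat) : H :=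
  calF (invmx (gram (2 * N).-1) *m delta_mx 0 0).

Definition etaW (N : nat) : carrier R X -> R := Phi_adj (pW N).

Definition etaW_nondegenerate (N : nat) : Prop :=
  [/\ hypI (2 * N).-1, KER (2 * N),
      derive1n (2 * N) (etaW N \o cls X) 0 != 0 &
      forall x, x != cls X 0 -> `|etaW N x| < 1].

End Blasso.

(* Main.v *)
(** If [p = (y_t + w - Phi m) / lambda] satisfies [<phi(t z_i), p> = 1] at the
    spikes of [m], which have positive amplitudes, and [|<phi(x), p>| < 1] at all
    other [x], then [m] solves the problem, and it is the only solution as soon
    as the vectors [phi(t z_i)] are independent. Since the derivative of
    [<phi, p>] must vanish at the spikes, this gives [n = 2N] equations in
    [(a, z)] which degenerate when [t] tends to [0].

    Expand [phi] at [0] to order [n]. The coefficients of the expansion form a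
    confluent Vandermonde matrix at [z]; multiplying the equations by its inverse
    and taking as unknowns the increments of the moments [sum_i a_i z_i^k],
    divided by [k! t^(n-1-k)], one gets a perturbation of size [t] of a linear
    system governed by the Gram matrix of [phi_0, ..., phi_(n-1)], with
    parameters [lambda / t^(n-1)] and [w / t^(n-1)]. A contraction on a ball
    independent of [t] solves it with a linear bound in the parameters, and the
    same contraction gives the estimate [|u - g(v)| <= K |F(u, v)|] near the graph
    of the solution [g], hence its smoothness. Finally [p] is at distance
    [O(t + |w| / lambda)] of [p_W]; if [N] double contacts with the value [1]
    merge at [0] where [eta_W] has a nonzero derivative of order [2N], Rolle's
    theorem shows that [<phi, p>] stays below [1] near [0], and elsewhere this
    follows from [|eta_W| < 1]. *)

Require Import Defs.
From HB Require Import structures.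
From mathcomp Require Import all_boot all_order all_algebra sesquilinear.
From mathcomp Require Import generic_quotient.
From mathcomp Require Import all_classical all_reals all_analysis.
From mathcomp Require Import separable measurable_realfun ring lra.

Set Implicit Arguments.
Unset Strict Implicit.
Unset Printing Implicit Defensive.

Import Order.TTheory GRing.Theory Num.Theory.
Import numFieldTopology.Exports numFieldNormedType.Exports.

Local Open Scope classical_set_scope.
Local Open Scope ring_scope.

(** * Maps of class C^k between normed spaces *)

(** The moments determine (a, z) only locally, and inverting them beforehand would require another
    implicit function. Amplitudes, positions and moment increments are therefore kept as independent
    unknowns, 4N in all, linked by two relations: a matrix of divided differences recovers (a, z)
    from the moments, without linearisation error, and the Gram matrix recovers the moments from the
    parameters. The first relation does not become weak with t; a factor kap in the unit of the
    moments makes it contracting, and only then is t taken small, which controls the second. The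
    branch g is obtained pointwise, by selecting a fixed point for each parameter. Its regularity
    rests on |u - g(v)| <= K |F(u, v)|: along the kernel of the Jacobian in u this would contradict
    the first order expansion of F, so the Jacobian is invertible, and at the candidate linear
    approximation of g it yields the differential. The same estimate, applied along the amplitudes
    only, yields the independence of the phi(t z_i) on which uniqueness rests. As F contains phi',
    one derivative is lost: C^(2N+1) kernels give C^(2N) branches. *)

Section Differentials.
Context (R : realType).
Implicit Types V W : normedModType R.

Lemma near0_shift V (x : V) (P : set V) :
  nbhs x P -> \forall h \near nbhs (0 : V), P (h + x).
Proof.
move=> /nbhs_ballP[e /= e0 eP]; apply/nbhs_ballP; exists e => //= h.
rewrite -ball_normE/= sub0r normrN => he; apply: eP.
by rewrite -ball_normE/= [h + x]addrC opprD addrA subrr sub0r normrN.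
Qed.

Lemma clinP V W (f : V -> W) : linear f -> continuous f ->
  exists L : clin V W, L = f :> (V -> W).
Proof. by move=> lf cf; exists (Clin (asboolT (conj lf cf))). Qed.

Lemma bounded_linear_clin V W (f : V -> W) (M : R) :
  linear f -> (forall x, `|f x| <= M * `|x|) ->
  exists L : clin V W, L = f :> (V -> W).
Proof.
move=> lf Mf; apply: clinP => //.
pose fM := GRing.isLinear.Build _ _ _ _ _ lf.
pose fL : {linear V -> W} := HB.pack f fM.
have : continuous fL; last by [].
apply: bounded_linear_continuous; apply/linear_boundedP.
near=> r => x; rewrite (le_trans (Mf x))// ler_wpM2r//.
Unshelve. all: by end_near. Qed.

(** Uniqueness of the differential makes this estimate characterise both differentiability and the
    value of [fdiff]. As [fdiff] is total with default value 0, the two are stated together; the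
    rules for sums, bilinear maps and implicit functions are proved by checking the estimate. *)
Lemma fdiffP V W (f : V -> W) x (L : clin V W) :
  differentiable f x /\ fdiff f x = L <->
  forall e : R, 0 < e ->
    \forall h \near nbhs (0 : V), `|f (h + x) - (f x + L h)| <= e * `|h|.
Proof.
split=> [[df <-] e e0|fL].
  have /diff_locally/eqaddoE := df; rewrite -fdiffE// => dfe.
  have {}dfe : f \o shift x = (cst (f x) + fdiff f x : V -> W) +o_ 0 id.
    by rewrite [LHS]dfe.
  by move/eqaddoP : dfe => /(_ _ e0).
have cL : continuous L by exact: clin_continuous.
have dL : f \o shift x = (cst (f x) + (L : V -> W)) +o_ 0 id by apply/eqaddoP.
have dfL : 'd f x = L :> (V -> W) by apply: diff_unique.
have df : differentiable f x.
  by apply/diff_locallyP; rewrite dfL.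
by split=> //; apply/val_inj; rewrite /= -dfL; exact: fdiffE.
Qed.

Lemma fdiff_near V W (f : V -> W) x (e : R) : differentiable f x -> 0 < e ->
  \forall h \near nbhs (0 : V), `|f (h + x) - (f x + fdiff f x h)| <= e * `|h|.
Proof. by move=> df; move: e; apply/fdiffP. Qed.

End Differentials.

Lemma telescope6 (Z : zmodType) (p q r s t u : Z) :
  p + (- s + (- u - t)) = p + (- q - r) + (q + (- s - t)) + (r - u).
Proof.
by rewrite [RHS]addrAC !addrA subrK [p - q - u]addrAC subrK [p - s - u]addrAC.
Qed.

Lemma split3 (R : realFieldType) (x : R) : x = x / 3 + x / 3 + x / 3.
Proof. lra. Qed.

Section ClassC.
Context (R : realType).
Implicit Types V W : normedModType R.

Lemma fdiff_eq V W (U : set V) (f g : V -> W) x : open U ->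
  (forall y, U y -> f y = g y) -> U x -> differentiable f x ->
  differentiable g x /\ fdiff g x = fdiff f x.
Proof.
move=> oU fg Ux df; apply/fdiffP => e e0.
have fe := fdiff_near df e0.
have nU : \forall h \near (0 : V), U (h + x).
  exact: near0_shift (open_nbhs_nbhs (conj oU Ux)).
near=> h; rewrite -!fg//; first by near: h.
by near: h; exact: nU.
Unshelve. all: by end_near. Qed.

Lemma class_C_on_eq V W k (U : set V) (f g : V -> W) : open U ->
  (forall y, U y -> f y = g y) -> class_C_on k U f -> class_C_on k U g.
Proof.
move=> oU; elim: k W f g => [|k ih] W f g fg /=.
  move=> cf x Ux; have := cf x Ux; rewrite /prop_for /continuous_at (fg x Ux).
  apply: cvg_trans; apply: near_eq_cvg.
  near=> y; apply/fg; near: y; exact: open_nbhs_nbhs.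
move=> [df Cf]; split=> [x Ux|];
  first by have [] := fdiff_eq oU fg Ux (df x Ux).
apply: ih Cf => x Ux.
by have [_ ->] := fdiff_eq oU fg Ux (df x Ux).
Unshelve. all: by end_near. Qed.

Lemma class_C_onS V W k (U : set V) (f : V -> W) :
  class_C_on k.+1 U f -> class_C_on k U f.
Proof.
elim: k W f => [|k ih] W f /= [df Cf].
  by move=> x Ux; apply: differentiable_continuous; exact: df.
by split=> //; exact: ih.
Qed.

Lemma class_C_on_le V W k l (U : set V) (f : V -> W) : (l <= k)%N ->
  class_C_on k U f -> class_C_on l U f.
Proof.
move=> /subnK <-; elim: (k - l)%N => // m ih; rewrite addSn => /class_C_onS.
exact: ih.
Qed.

Lemma class_C_on_cst V W k (U : set V) (c : W) :
  class_C_on k U (fun _ : V => c).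
Proof.
elim: k W c => [|k ih] W c /=; first by move=> x _; exact: cst_continuous.
have d0 x : differentiable (fun _ : V => c) x /\ fdiff (fun _ : V => c) x = 0.
  by apply/fdiffP => e e0; near=> h; rewrite addr0 subrr normr0 mulr_ge0// ltW.
split=> [x _|]; first by have [] := d0 x.
rewrite (_ : fdiff _ = fun=> 0)//; last by apply/funext => x; have [] := d0 x.
Unshelve. all: by end_near. Qed.

Lemma class_C_onD V W k (U : set V) (f g : V -> W) : open U ->
  class_C_on k U f -> class_C_on k U g -> class_C_on k U (fun x => f x + g x).
Proof.
move=> oU; elim: k W f g => [|k ih] W f g /=.
  by move=> cf cg x Ux; apply: continuousD; [exact: cf|exact: cg].
move=> [df Cf] [dg Cg].
have dD x : U x -> differentiable (fun x => f x + g x) x /\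
    fdiff (fun x => f x + g x) x = fdiff f x + fdiff g x.
  move=> Ux; apply/fdiffP => e e0.
  have e2 : 0 < e / 2 by rewrite divr_gt0.
  have fe := fdiff_near (df x Ux) e2.
  have ge := fdiff_near (dg x Ux) e2.
  apply: filterS2 fe ge => h fh gh.
  have -> : f (h + x) + g (h + x) -
      (f x + g x + (fdiff f x + fdiff g x : clin V W) h) =
      (f (h + x) - (f x + fdiff f x h)) + (g (h + x) - (g x + fdiff g x h)).
    rewrite -[(fdiff f x + fdiff g x) h]/(fdiff f x h + fdiff g x h).
    by rewrite [_ + _ + (_ + _)]addrACA opprD addrACA.
  rewrite [leRHS](_ : _ = e / 2 * `|h| + e / 2 * `|h|); last first.
    by rewrite -mulrDl -splitr.
  exact: le_trans (ler_normD _ _) (lerD fh gh).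
split=> [x Ux|]; first by have [] := dD x Ux.
apply: (class_C_on_eq oU _ (ih _ _ _ Cf Cg)) => x Ux.
by have [_ ->] := dD x Ux.
Qed.

Lemma class_C_on_sum V W k (U : set V) (I : finType) (f : I -> V -> W) :
  open U -> (forall i, class_C_on k U (f i)) ->
  class_C_on k U (fun x => \sum_i f i x).
Proof.
move=> oU Cf; elim: (index_enum I) => [|i s ih].
  rewrite (_ : (fun _ => _) = fun=> 0); first exact: class_C_on_cst.
  by apply/funext => x; rewrite big_nil.
rewrite (_ : (fun _ => _) = fun x => f i x + \sum_(j <- s) f j x).
  exact: class_C_onD.
by apply/funext => x; rewrite big_cons.
Qed.

Definition bounded_bilinear V W (X : normedModType R) (b : V -> W -> X) :=
  [/\ forall y, linear (b^~ y), forall x, linear (b x) &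
      exists M : R, forall x y, `|b x y| <= M * `|x| * `|y|].

Section Bilinear.
Context V W (X : normedModType R) (b : V -> W -> X).
Hypothesis bb : bounded_bilinear b.

Lemma bbilinDl x y z : b (x + y) z = b x z + b y z.
Proof. by case: bb => lb _ _; have := lb z 1 x y; rewrite !scale1r. Qed.

Lemma bbilinDr x y z : b x (y + z) = b x y + b x z.
Proof. by case: bb => _ lb _; have := lb x 1 y z; rewrite !scale1r. Qed.

Lemma bbilin0l y : b 0 y = 0.
Proof. by apply: (@addrI _ (b 0 y)); rewrite -bbilinDl !addr0. Qed.

Lemma bbilin0r x : b x 0 = 0.
Proof. by apply: (@addrI _ (b x 0)); rewrite -bbilinDr !addr0. Qed.

Lemma bbilinZl a x y : b (a *: x) y = a *: b x y.
Proof.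
by case: bb => lb _ _; have := lb y a x 0; rewrite bbilin0l !addr0.
Qed.

Lemma bbilinZr a x y : b x (a *: y) = a *: b x y.
Proof.
by case: bb => _ lb _; have := lb x a y 0; rewrite bbilin0r !addr0.
Qed.

Lemma bbilinNl x y : b (- x) y = - b x y.
Proof. by rewrite -scaleN1r bbilinZl scaleN1r. Qed.

Lemma bbilinNr x y : b x (- y) = - b x y.
Proof. by rewrite -scaleN1r bbilinZr scaleN1r. Qed.

Lemma bbilin_bound : exists2 M : R, 0 < M &
  forall x y, `|b x y| <= M * `|x| * `|y|.
Proof.
case: bb => _ _ [M bM]; exists (`|M| + 1); first exact: ltr_wpDl.
move=> x y; rewrite (le_trans (bM x y))// ler_wpM2r// ler_wpM2r//.
by rewrite (le_trans (ler_norm _))// lerDl.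
Qed.

Lemma bbilin_continuous (U : topologicalType) (f : U -> V) (g : U -> W) x :
  {for x, continuous f} -> {for x, continuous g} ->
  {for x, continuous (fun y => b (f y) (g y))}.
Proof.
move=> cf cg; have [M M0 bM] := bbilin_bound.
apply/cvgrPdist_lt => e e0.
pose K := `|f x| + `|g x| + 1.
have K0 : 0 < K by rewrite ltr_wpDl// addr_ge0.
pose d := Num.min 1 (e / (2 * M * K)).
have d0 : 0 < d by rewrite lt_min ltr01 divr_gt0// !mulr_gt0.
have /cvgrPdist_lt/(_ _ d0) fd := cf.
have /cvgrPdist_lt/(_ _ d0) gd := cg.
near=> y.
have fy : `|f x - f y| < d by near: y.
have gy : `|g x - g y| < d by near: y.
have -> : b (f x) (g x) - b (f y) (g y) =
    b (f x - f y) (g y) + b (f x) (g x - g y).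
  by rewrite bbilinDl bbilinDr bbilinNl bbilinNr [RHS]addrC addrA subrK.
rewrite (le_lt_trans (ler_normD _ _))//.
have dK : d * (M * K) <= e / 2.
  rewrite -ler_pdivlMr ?mulr_gt0// ge_min; apply/orP; right.
  by rewrite -mulrA [2 * _]mulrC invfM mulrA [_ / 2]mulrAC.
have gK : `|g y| <= K.
  have -> : g y = g x - (g x - g y) by rewrite subKr.
  rewrite (le_trans (ler_normB _ _))//.
  have : `|g x - g y| <= 1 by rewrite (le_trans (ltW gy))// ge_min lexx.
  by rewrite /K; move: (normr_ge0 (f x)); clear; lra.
have fK : `|f x| <= K.
  by rewrite /K; move: (normr_ge0 (g x)); clear; lra.
rewrite [e]splitr ltr_leD//.
  apply: (le_lt_trans (bM _ _)).
  have [->|gy0] := eqVneq (g y) 0; first by rewrite normr0 mulr0 divr_gt0.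
  apply: lt_le_trans dK; rewrite mulrAC [d * _]mulrC.
  apply: (@le_lt_trans _ _ (M * K * `|f x - f y|)).
    by rewrite ler_wpM2r// ler_pM2l.
  by rewrite ltr_pM2l ?mulr_gt0.
apply: (le_trans (bM _ _)); apply: le_trans dK.
rewrite [d * _]mulrC; apply: ler_pM => //; first by rewrite mulr_ge0// ltW.
  by rewrite ler_pM2l.
exact: ltW gy.
Unshelve. all: by end_near. Qed.

End Bilinear.

(** The default value 0 is taken when f is not a continuous linear map. It makes [bcompl] and
    [bcompr] total functions without proof arguments, which can be iterated in inductions on the
    class. *)
Definition mkclin V W (f : V -> W) : clin V W := insubd (0 : clin V W) f.

Lemma mkclinE V W (f : V -> W) (M : R) : linear f ->
  (forall x, `|f x| <= M * `|x|) -> mkclin f = f :> (V -> W).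
Proof.
move=> lf Mf; have [L <-] := bounded_linear_clin lf Mf.
by rewrite /mkclin -[LHS]/(val (insubd (0 : clin V W) (val L))) valKd.
Qed.

Lemma clinDE V W (L K : clin V W) x : (L + K) x = L x + K x.
Proof. by []. Qed.

Lemma clinZE V W (L : clin V W) a x : (a *: L) x = a *: L x.
Proof. by []. Qed.

Lemma clin_eq V W (L K : clin V W) : (forall x, L x = K x) -> L = K.
Proof. by move=> LK; apply/val_inj/funext. Qed.

Section BilinearClin.
Context V W (X Y : normedModType R).

Definition bcompl (b : W -> X -> Y) (L : clin V W) (y : X) : clin V Y :=
  mkclin (fun h => b (L h) y).

Definition bcompr (b : W -> X -> Y) (x : W) (L : clin V X) : clin V Y :=
  mkclin (fun h => b x (L h)).

Variable b : W -> X -> Y.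
Hypothesis bb : bounded_bilinear b.

Lemma bcomplE L y h : bcompl b L y h = b (L h) y.
Proof.
have [M M0 bM] := bbilin_bound bb.
rewrite /bcompl (@mkclinE _ _ _ (M * opnorm L * `|y|))//.
  by move=> a u v; rewrite linearP (bbilinDl bb) (bbilinZl bb).
move=> u; rewrite (le_trans (bM _ _))// [leRHS]mulrAC ler_wpM2r//.
by rewrite -mulrA ler_pM2l// le_opnorm.
Qed.

Lemma bcomprE x L h : bcompr b x L h = b x (L h).
Proof.
have [M M0 bM] := bbilin_bound bb.
rewrite /bcompr (@mkclinE _ _ _ (M * `|x| * opnorm L))//.
  by move=> a u v; rewrite linearP (bbilinDr bb) (bbilinZr bb).
move=> u; rewrite (le_trans (bM _ _))// -[leRHS]mulrA ler_wpM2l ?le_opnorm//.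
by rewrite mulr_ge0// ltW.
Qed.

Lemma bcompl_bilinear : bounded_bilinear (bcompl b).
Proof.
have [M M0 bM] := bbilin_bound bb; split.
- move=> y a L K; apply: clin_eq => h.
  by rewrite clinDE clinZE !bcomplE clinDE clinZE (bbilinDl bb) (bbilinZl bb).
- move=> L a x y; apply: clin_eq => h.
  by rewrite clinDE clinZE !bcomplE (bbilinDr bb) (bbilinZr bb).
- exists M => L y; apply: opnorm_le => h h1; rewrite bcomplE.
  rewrite (le_trans (bM _ _))// ler_wpM2r// ler_pM2l//.
  by rewrite (le_trans (le_opnorm _ _))// ler_piMr// opnorm_ge0.
Qed.

Lemma bcompr_bilinear : bounded_bilinear (bcompr b).
Proof.
have [M M0 bM] := bbilin_bound bb; split.
- move=> L a x y; apply: clin_eq => h.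
  by rewrite clinDE clinZE !bcomprE (bbilinDl bb) (bbilinZl bb).
- move=> y a L K; apply: clin_eq => h.
  by rewrite clinDE clinZE !bcomprE clinDE clinZE (bbilinDr bb) (bbilinZr bb).
- exists M => x L; apply: opnorm_le => h h1; rewrite bcomprE.
  rewrite (le_trans (bM _ _))// ler_wpM2l//; first by rewrite mulr_ge0// ltW.
  by rewrite (le_trans (le_opnorm _ _))// ler_piMr// opnorm_ge0.
Qed.

Lemma fdiff_bilinear (f : V -> W) (g : V -> X) x :
  differentiable f x -> differentiable g x ->
  differentiable (fun y => b (f y) (g y)) x /\
  fdiff (fun y => b (f y) (g y)) x =
    bcompl b (fdiff f x) (g x) + bcompr b (f x) (fdiff g x).
Proof.
move=> df dg; apply/fdiffP => e e0.
have [M M0 bM] := bbilin_bound bb.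
(* K bounds f x, g (h + x) and the norm of the differential of f at x; the minimum with 1 in d
   serves for g (h + x). Each of the three terms of the decomposition then costs e / 3. *)
pose K := `|f x| + `|g x| + opnorm (fdiff f x) + 1.
have K0 : 0 < K by rewrite ltr_wpDl// !addr_ge0// opnorm_ge0.
pose d := Num.min 1 (e / (3 * M * K)).
have d0 : 0 < d by rewrite lt_min ltr01 divr_gt0// !mulr_gt0.
have fd := fdiff_near df d0; have gd := fdiff_near dg d0.
have /cvgrPdist_lt/(_ _ d0)/near0_shift gc := differentiable_continuous dg.
apply: filterS3 fd gd gc => h fh gh gy; rewrite clinDE bcomplE bcomprE.
have -> : b (f (h + x)) (g (h + x)) -
    (b (f x) (g x) + (b (fdiff f x h) (g x) + b (f x) (fdiff g x h))) =
    b (f (h + x) - (f x + fdiff f x h)) (g (h + x)) +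
    b (f x) (g (h + x) - (g x + fdiff g x h)) +
    b (fdiff f x h) (g (h + x) - g x).
  rewrite !(bbilinDl bb, bbilinDr bb, bbilinNl bb, bbilinNr bb) !opprD.
  exact: telescope6.
have gK : `|g (h + x)| <= K.
  have -> : g (h + x) = g x - (g x - g (h + x)) by rewrite subKr.
  rewrite (le_trans (ler_normB _ _))//.
  have : `|g x - g (h + x)| <= 1 by rewrite (le_trans (ltW gy))// ge_min lexx.
  by rewrite /K; move: (normr_ge0 (f x)) (opnorm_ge0 (fdiff f x)); clear; lra.
have fK : `|f x| <= K.
  by rewrite /K; move: (normr_ge0 (g x)) (opnorm_ge0 (fdiff f x)); clear; lra.
have LK : `|fdiff f x h| <= K * `|h|.
  rewrite (le_trans (le_opnorm _ _))// ler_wpM2r// /K.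
  by move: (normr_ge0 (f x)) (normr_ge0 (g x)); clear; lra.
have dK : M * (d * K) <= e / 3.
  rewrite mulrCA -ler_pdivlMr ?mulr_gt0// ge_min; apply/orP; right.
  by rewrite -mulrA [3 * _]mulrC invfM mulrA [_ / 3]mulrAC.
have e3 : e = e / 3 + e / 3 + e / 3 by exact: split3.
rewrite e3 !mulrDl; apply: le_trans (ler_normD _ _) _; apply: lerD.
  apply: le_trans (ler_normD _ _) _; apply: lerD.
    apply: (le_trans (bM _ _)); apply: (@le_trans _ _ (M * (d * K) * `|h|)).
      by rewrite -!mulrA ler_pM2l// [K * _]mulrC mulrA ler_pM.
    by rewrite ler_wpM2r.
  apply: (le_trans (bM _ _)); apply: (@le_trans _ _ (M * (d * K) * `|h|)).
    by rewrite -!mulrA ler_pM2l// mulrCA ler_pM.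
  by rewrite ler_wpM2r.
apply: (le_trans (bM _ _)); apply: (@le_trans _ _ (M * (d * K) * `|h|)).
  rewrite -!mulrA ler_pM2l// mulrC ler_pM//.
  by rewrite distrC ltW.
by rewrite ler_wpM2r.
Qed.

End BilinearClin.

(** The product rule expresses the differential by [bcompl] and [bcompr], again bounded bilinear but
    with values in a space of operators. Hence the induction on k ranges over the spaces and over
    b. *)
Lemma class_C_on_bilinear V W (X Y : normedModType R) (b : W -> X -> Y) k
    (U : set V) (f : V -> W) (g : V -> X) :
  bounded_bilinear b -> open U -> class_C_on k U f -> class_C_on k U g ->
  class_C_on k U (fun x => b (f x) (g x)).
Proof.
move=> + oU; elim: k W X Y b f g => [|k ih] W X Y b f g bb Cf Cg.
  by move=> x Ux; apply: (bbilin_continuous bb); [exact: Cf|exact: Cg].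
have [df Cdf] := Cf; have [dg Cdg] := Cg.
have dfg x (Ux : U x) := fdiff_bilinear bb (df x Ux) (dg x Ux).
split=> [x Ux|]; first by have [] := dfg x Ux.
apply: (class_C_on_eq oU (f := fun x =>
    bcompl b (fdiff f x) (g x) + bcompr b (f x) (fdiff g x))).
  by move=> x Ux; have [_ ->] := dfg x Ux.
apply: class_C_onD => //; apply: ih => //.
- exact: bcompl_bilinear.
- exact: class_C_onS.
- exact: bcompr_bilinear.
- exact: class_C_onS.
Qed.

End ClassC.

Section ClassCMore.
Context (R : realType).
Implicit Types V W : normedModType R.

Lemma scale_bilinear W : bounded_bilinear (fun (a : R) (w : W) => a *: w).
Proof.
split=> [w a x y|a b x y|]; first by rewrite /= scalerDl scalerA.
  by rewrite scalerDr !scalerA mulrC.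
by exists 1 => x y; rewrite mul1r normrZ.
Qed.

Lemma mul_bilinear : bounded_bilinear (fun a b : R => a * b).
Proof. exact: scale_bilinear R^o. Qed.

Lemma apply_bilinear V W : bounded_bilinear (fun (L : clin V W) v => L v).
Proof.
split=> [v a L K|L a x y|]; first by [].
  by rewrite linearP.
by exists 1 => L v; rewrite mul1r le_opnorm.
Qed.

Lemma class_C_on_clin V W (X : normedModType R) k (U : set V) (f : V -> W)
    (L : clin W X) : open U -> class_C_on k U f ->
  class_C_on k U (fun x => L (f x)).
Proof.
move=> oU; apply: (class_C_on_bilinear (@apply_bilinear W X) oU).
exact: class_C_on_cst.
Qed.

Lemma class_C_on_scale V W k (U : set V) (f : V -> R) (g : V -> W) :
  open U -> class_C_on k U f -> class_C_on k U g ->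
  class_C_on k U (fun x => f x *: g x).
Proof. exact: class_C_on_bilinear (scale_bilinear W). Qed.

Lemma class_C_onM V k (U : set V) (f g : V -> R) :
  open U -> class_C_on k U f -> class_C_on k U g ->
  class_C_on k U (fun x => f x * g x).
Proof. exact: class_C_on_bilinear mul_bilinear. Qed.

Lemma class_C_on_prod V k (U : set V) (I : finType) (f : I -> V -> R) :
  open U -> (forall i, class_C_on k U (f i)) ->
  class_C_on k U (fun x => \prod_i f i x).
Proof.
move=> oU Cf; elim: (index_enum I) => [|i s ih].
  rewrite (_ : (fun _ => _) = fun=> 1); first exact: class_C_on_cst.
  by apply/funext => x; rewrite big_nil.
rewrite (_ : (fun _ => _) = fun x => f i x * \prod_(j <- s) f j x).
  exact: class_C_onM.
by apply/funext => x; rewrite big_cons.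
Qed.

Lemma eq_fdiff V W (f : V -> W) x (L : clin V W) : differentiable f x ->
  (forall h, 'd f x h = L h) -> fdiff f x = L.
Proof. by move=> df dfL; apply: clin_eq => h; rewrite fdiffE// dfL. Qed.

Lemma class_C_derive1 W k (f : R -> W) :
  class_C k.+1 f -> class_C k (f^`()%classic).
Proof.
case=> df cf; split=> [i x ik|i ik].
  by rewrite -derive1Sn; exact: df.
by rewrite -derive1Sn; exact: cf.
Qed.

Lemma class_CS W k (f : R -> W) : class_C k.+1 f -> class_C k f.
Proof.
case=> df cf; split=> [i x ik|i ik]; first by apply: df; exact: ltnW.
by apply: cf; exact: leqW.
Qed.

(** Passage from iterated derivatives in one variable to Frechet classes: the differential at x is h
    -> dz(h) f'(z x), bounded bilinear in dz and in f'(z x), and the induction hypothesis applies to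
    the curve f'. *)
Lemma class_C_on_curve V W k (U : set V) (f : R -> W) (z : V -> R) :
  open U -> class_C k f -> class_C_on k U z ->
  class_C_on k U (fun x => f (z x)).
Proof.
move=> oU; elim: k f z => [|k ih] f z Cf Cz.
  move=> x Ux; apply: continuous_comp; first exact: Cz.
  by have [_ /(_ 0 isT)] := Cf; apply.
have [df _] := Cf; have [dz Cdz] := Cz.
have dfx x : differentiable f x by apply/derivable1_diffP; exact: (df 0 x isT).
have dfz x : U x -> differentiable (fun x => f (z x)) x.
  by move=> Ux; apply: differentiable_comp => //; exact: dz.
split=> //.
apply: (class_C_on_eq oU (f := fun x =>
    bcompl (fun (a : R) (w : W) => a *: w) (fdiff z x) (f^`()%classic (z x)))).
  move=> x Ux; apply/esym/eq_fdiff; first exact: dfz.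
  move=> h; rewrite (bcomplE (scale_bilinear W)) fdiffE; last exact: dz.
  rewrite (@diff_comp _ _ _ _ z f)//; last exact: dz.
  by rewrite /= deriv1E//; exact: (df 0 _ isT).
apply: class_C_on_bilinear => //; first exact/bcompl_bilinear/scale_bilinear.
apply: ih; [exact: class_C_derive1|exact: class_C_onS].
Qed.

Lemma class_C_onV V k (U : set V) (f : V -> R) : open U ->
  (forall x, U x -> f x != 0) -> class_C_on k U f ->
  class_C_on k U (fun x => (f x)^-1).
Proof.
move=> oU f0; elim: k => [|k ih] Cf.
  by move=> x Ux; apply: continuousV; [exact: f0|exact: Cf].
have [df Cdf] := Cf.
split=> [x Ux|]; first by apply: differentiableV; [exact: df|exact: f0].
apply: (class_C_on_eq oU (f := fun x =>
    - (f x)^-1 * (f x)^-1 *: fdiff f x)).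
  move=> x Ux; apply/esym/eq_fdiff.
    by apply: differentiableV; [exact: df|exact: f0].
  move=> h; rewrite diffV; [|exact: df|exact: f0].
  rewrite clinZE fdiffE; last exact: df.
  by rewrite -exprVn expr2 mulNr.
have Ci : class_C_on k U (fun x => (f x)^-1) by apply: ih; exact: class_C_onS.
apply: class_C_on_scale => //; apply: class_C_onM => //.
rewrite (_ : (fun _ => _) = fun x => (-1) * (f x)^-1); last first.
  by apply/funext => x; rewrite mulN1r.
by apply: class_C_onM => //; exact: class_C_on_cst.
Qed.

Lemma class_C_on_det V k (U : set V) n (A : V -> 'M[R]_n) : open U ->
  (forall i j, class_C_on k U (fun x => A x i j)) ->
  class_C_on k U (fun x => \det (A x)).
Proof.
move=> oU CA; apply: class_C_on_sum => // s; apply: class_C_onM => //.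
  exact: class_C_on_cst.
by apply: class_C_on_prod.
Qed.

Lemma class_C_on_invmx V k (U : set V) n (A : V -> 'M[R]_n) i j : open U ->
  (forall x, U x -> A x \in unitmx) ->
  (forall i j, class_C_on k U (fun x => A x i j)) ->
  class_C_on k U (fun x => invmx (A x) i j).
Proof.
move=> oU uA CA.
apply: (class_C_on_eq oU (f := fun x => (\det (A x))^-1 *
   ((-1) ^+ (j + i) * \det (row' j (col' i (A x)))))).
  by move=> x Ux; rewrite /invmx uA// !mxE.
apply: class_C_onM => //.
  apply: class_C_onV => //; last exact: class_C_on_det.
  by move=> x Ux; rewrite -unitfE; exact: uA.
apply: class_C_onM => //; first exact: class_C_on_cst.
apply: class_C_on_det => // i' j'.
rewrite (_ : (fun _ => _) = fun x => A x (lift j i') (lift i j')) //.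
by apply/funext => x; rewrite !mxE.
Qed.

End ClassCMore.

(** * The implicit function theorem *)

Section MatrixNorm.
Context (R : realType).

Lemma mx_norm_coord m n (A : 'M[R]_(m, n)) i j : `|A i j| <= `|A|.
Proof.
rewrite [leRHS]/Num.norm/= mx_normrE.
exact: (le_bigmax _ (fun ij => `|A ij.1 ij.2|) (i, j)).
Qed.

Lemma mx_norm_le m n (A : 'M[R]_(m, n)) (c : R) : 0 <= c ->
  (forall i j, `|A i j| <= c) -> `|A| <= c.
Proof.
move=> c0 Ac; rewrite [leLHS]/Num.norm/= mx_normrE.
by apply: bigmax_le => // -[i j] _; exact: Ac.
Qed.

End MatrixNorm.

Section ImplicitFunction.
Context (R : realType) (V : normedModType R) (n : nat) (U : set V).
Variables (g : V -> 'rV[R]_n) (f : 'rV[R]_n -> V -> 'rV[R]_n).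
Variables (J : V -> 'M[R]_n) (D : 'I_n -> V -> clin V R).

Let Dv v h : 'rV[R]_n := \row_l D l v h.

(** The function g is given, with no assumption on its regularity. This estimate replaces both the
    invertibility of the Jacobian in the first variable and the continuity of g. *)
Hypothesis f_expanding : forall v, U v -> exists2 K : R, 0 < K &
  exists2 d : R, 0 < d & forall (k : 'rV[R]_n) (h : V), `|k| < d -> `|h| < d ->
    `|g v + k - g (v + h)| <= K * `|f (g v + k) (v + h)|.
Hypothesis f_diff : forall v, U v -> forall e : R, 0 < e ->
  exists2 d : R, 0 < d & forall (k : 'rV[R]_n) (h : V), `|k| < d -> `|h| < d ->
    `|f (g v + k) (v + h) - (k *m J v + Dv v h)| <= e * (`|k| + `|h|).

(** With h = 0 the expanding estimate reads |k| <= K |f (g v + k) v|. For a small k in the left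
    kernel of [J v], [f_diff] bounds the right-hand side by |k| / 2. *)
Lemma implicit_unitmx v : U v -> J v \in unitmx.
Proof.
move=> Uv; rewrite -row_free_unit -kermx_eq0; apply/eqP/row_matrixP => i.
rewrite row0; set xi := row i _.
have xiJ : xi *m J v = 0 by apply/sub_kermxP; exact: row_sub.
apply/eqP; apply: contraT => xi0.
have nxi : 0 < `|xi| by rewrite normr_gt0.
have [K K0 [d d0 Kd]] := f_expanding Uv.
have e0 : 0 < (2 * K)^-1 by rewrite invr_gt0 mulr_gt0.
have [d' d'0 Jd] := f_diff Uv e0.
pose s := Num.min d d' / (2 * `|xi|).
have s0 : 0 < s by rewrite divr_gt0 ?lt_min ?d0//= mulr_gt0.
have sxi : `|s *: xi| = Num.min d d' / 2.
  by rewrite normrZ gtr0_norm// /s invfM mulrA mulfVK// gt_eqF.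
have smin : `|s *: xi| < Num.min d d'.
  by rewrite sxi ltr_pdivrMr// ltr_pMr ?ltr1n// lt_min d0.
move: (smin); rewrite lt_min => /andP[sd sd'].
have := Kd (s *: xi) 0; rewrite normr0 addr0 => /(_ sd d0).
have := Jd (s *: xi) 0; rewrite normr0 !addr0 => /(_ sd' d'0).
rewrite -scalemxAl xiJ scaler0 add0r (_ : Dv v 0 = 0); last first.
  by apply/rowP => l; rewrite !mxE linear0.
rewrite subr0 addrAC subrr add0r => Jk Kk.
have := le_trans Kk (ler_wpM2l (ltW K0) Jk).
rewrite mulrA invfM mulrCA mulfV ?gt_eqF// mulr1 leNgt.

rewrite gtr_pMl ?invf_lt1//.
  by rewrite ltr1n.
by rewrite normr_gt0 scaler_eq0 gt_eqF.
Qed.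

Definition implicit_diff m v : clin V R :=
  - \sum_l (invmx (J v) l m *: D l v).

Arguments implicit_diff : simpl never.

Lemma clin_sumE (W : normedModType R) (I : finType) (F : I -> clin V W) h :
  (\sum_i F i) h = \sum_i F i h.
Proof. by elim/big_rec2: _ => // i y1 y2 _ <-. Qed.

(** The candidate k = L h annuls the linear part [k *m J v + Dv v h], so f (g v + k) (v + h) is
    o(|h|), and by the expanding estimate so is g v + L h - g (v + h). *)
Lemma implicit_fdiff m v : U v -> differentiable (fun v => g v 0 m) v /\
  fdiff (fun v => g v 0 m) v = implicit_diff m v.
Proof.
move=> Uv; have uJ := implicit_unitmx Uv; apply/fdiffP => e e0.
pose L h : 'rV[R]_n := - (Dv v h *m invmx (J v)).
have LE i h : implicit_diff i v h = L h 0 i.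
  rewrite /implicit_diff -[(- _ : clin V R) h]/(-
    ((\sum_l (_ *: _) : clin V R) h)).
  rewrite clin_sumE !mxE; congr (- _); apply: eq_bigr => l _.
  by rewrite !mxE clinZE -[LHS]/(_ * _) mulrC.
pose M := 1 + \sum_i opnorm (implicit_diff i v).
have M1 : 1 <= M by rewrite lerDl sumr_ge0// => i _; exact: opnorm_ge0.
have M0 : 0 < M by exact: lt_le_trans M1.
have LM h : `|L h| <= M * `|h|.
  apply: mx_norm_le => [|i j]; first by rewrite mulr_ge0// ltW.
  rewrite ord1 -LE (le_trans (le_opnorm _ _))// ler_wpM2r// /M.
  rewrite (bigD1 j)//= addrCA lerDl addr_ge0// sumr_ge0// => k _.
  exact: opnorm_ge0.
have [K K0 [d d0 Kd]] := f_expanding Uv.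
have e'0 : 0 < e / (K * (M + 1)) by rewrite divr_gt0// mulr_gt0// addr_gt0.
have [d' d'0 Jd] := f_diff Uv e'0.
pose r := Num.min d d' / M.
have r0 : 0 < r by rewrite divr_gt0// lt_min d0.
apply/nbhs_ballP; exists r => //= h; rewrite -ball_normE/= sub0r normrN => hr.
have Lr : `|L h| < Num.min d d'.
  by rewrite (le_lt_trans (LM h))// mulrC -ltr_pdivlMr.
have hr' : `|h| < Num.min d d'.
  by rewrite (lt_le_trans hr)// ler_pdivrMr// ler_peMr// le_min !ltW.
move: Lr hr'; rewrite !lt_min => /andP[Ld Ld'] /andP[hd hd'].
have := Jd _ _ Ld' hd'; rewrite mulNmx mulmxKV// addNr subr0 => Jh.
have Kh := Kd _ _ Ld hd.
rewrite -[X in `|_ - (_ + X)|]/(implicit_diff m v h) LE distrC.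
have -> : g v 0 m + L h 0 m - g (h + v) 0 m = (g v + L h - g (v + h)) 0 m.
  by rewrite !mxE [h + v]addrC.
apply: (le_trans (mx_norm_coord _ _ _)); apply: (le_trans Kh).
apply: (le_trans (ler_wpM2l (ltW K0) Jh)).
have hM : `|L h| + `|h| <= (M + 1) * `|h| by rewrite mulrDl mul1r lerD2r.
rewrite mulrA; apply: le_trans (ler_wpM2l _ hM) _.
  by rewrite ltW// mulr_gt0.
rewrite mulrA ler_wpM2r// invfM [e * _]mulrA -mulrA.
rewrite divfK ?(gt_eqF (addr_gt0 M0 ltr01))//.
by rewrite mulrC divfK// gt_eqF.
Qed.

(** Bootstrap: the differential of g is built from D and the inverse of J, so if these inherit the
    class C^k of g, then g is of class C^(k+1). The start, continuity, comes from
    differentiability. *)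
Lemma implicit_class_C (K : nat) : open U ->
  (forall k, (k < K)%N -> (forall m, class_C_on k U (fun v => g v 0 m)) ->
     (forall i j, class_C_on k U (fun v => J v i j)) /\
     (forall l, class_C_on k U (D l))) ->
  forall m, class_C_on K U (fun v => g v 0 m).
Proof.
move=> oU; elim: K => [|K ih] step m.
  move=> v Uv; apply: differentiable_continuous.
  by have [] := implicit_fdiff m Uv.
have {ih} gK : forall m, class_C_on K U (fun v => g v 0 m).
  by apply: ih => k kK; apply: step; exact: ltnW.
have [CJ CD] := step K (ltnSn K) gK.
split=> [v Uv|]; first by have [] := implicit_fdiff m Uv.
apply: (class_C_on_eq oU (f := implicit_diff m)).
  by move=> v Uv; have [_ ->] := implicit_fdiff m Uv.
rewrite /implicit_diff.
rewrite (_ : (fun v => _) = (fun v =>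
  (-1) *: \sum_l invmx (J v) l m *: D l v)); last first.
  by apply/funext => v; rewrite scaleN1r.
apply: class_C_on_scale => //; first exact: class_C_on_cst.
apply: class_C_on_sum => // l; apply: class_C_on_scale => //.
by apply: class_C_on_invmx => //; exact: implicit_unitmx.
Qed.

End ImplicitFunction.

Section Composition.
Context (R : realType).
Implicit Types V W X : normedModType R.

Lemma class_C_on_linear V W k (U : set V) (L : clin V W) :
  class_C_on k U (fun x => L x).
Proof.
have dL x : differentiable (fun x => L x) x /\ fdiff (fun x => L x) x = L.
  apply/fdiffP => e e0; apply/nbhs_ballP; exists 1 => //= h _.
  by rewrite linearD [L h + _]addrC subrr normr0 mulr_ge0// ltW.
case: k => [|k].
  by move=> x _; exact: clin_continuous.
split=> [x _|]; first by have [] := dL x.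
rewrite (_ : fdiff _ = fun=> L); last by apply/funext => x; have [] := dL x.
exact: class_C_on_cst.
Qed.

Lemma class_C_on_comp V W X k (U : set V) (U' : set W) (f : W -> X)
    (g : V -> W) : open U -> (forall x, U x -> U' (g x)) ->
  class_C_on k U' f -> class_C_on k U g -> class_C_on k U (fun x => f (g x)).
Proof.
move=> oU gU; elim: k X f => [|k ih] X f Cf Cg.
  by move=> x Ux; apply: continuous_comp; [exact: Cg|apply: Cf; exact: gU].
have [df Cdf] := Cf; have [dg Cdg] := Cg.
have dfg x : U x -> differentiable (fun x => f (g x)) x.
  move=> Ux; apply: differentiable_comp; first exact: dg.
  by apply: df; exact: gU.
split=> //; have Cg' := class_C_onS Cg.
apply: (class_C_on_eq oU (f := fun x =>
  bcompr (fun (L : clin W X) w => L w) (fdiff f (g x)) (fdiff g x))).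
  move=> x Ux; apply/esym/eq_fdiff; first exact: dfg.
  move=> h; rewrite (bcomprE (@apply_bilinear R W X)).
  rewrite (@diff_comp _ _ _ _ g f)/=; [|exact: dg|by apply: df; exact: gU].
  by rewrite !fdiffE//; [exact: dg|by apply: df; exact: gU].
apply: class_C_on_bilinear => //; first exact/bcompr_bilinear/apply_bilinear.
exact: (ih _ (fdiff f)).
Qed.

Lemma pair_clin V W : exists L : clin V (W * V)%type,
  forall v, L v = (0, v).
Proof.
have l : linear (fun v : V => ((0 : W), v)).
  by move=> a x y; congr (_, _); rewrite /= ?scaler0 ?addr0.
have b (v : V) : `|((0 : W), v)| <= 1 * `|v|.
  by rewrite mul1r prod_normE/= normr0 ge_max lexx normr_ge0.
by have [L LE] := bounded_linear_clin l b; exists L => v; rewrite LE.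
Qed.

Lemma coord_clin n (i : 'I_n) :
  exists L : clin 'rV[R]_n R, forall x, L x = x 0 i.
Proof.
have l : linear (fun x : 'rV[R]_n => x 0 i : R^o).
  by move=> a x y; rewrite !mxE.
have b (x : 'rV[R]_n) : `|x 0 i| <= 1 * `|x| by rewrite mul1r mx_norm_coord.
by have [L LE] := bounded_linear_clin l b; exists L => x; rewrite LE.
Qed.

Lemma fst_clin V W : exists L : clin (V * W)%type V, forall x, L x = x.1.
Proof.
have l : linear (fun x : V * W => x.1) by [].
have b (x : V * W) : `|x.1| <= 1 * `|x|.
  by rewrite mul1r prod_normE le_max lexx.
by have [L LE] := bounded_linear_clin l b; exists L => x; rewrite LE.
Qed.

Lemma snd_clin V W : exists L : clin (V * W)%type W, forall x, L x = x.2.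
Proof.
have l : linear (fun x : V * W => x.2) by [].
have b (x : V * W) : `|x.2| <= 1 * `|x|.
  by rewrite mul1r prod_normE le_max lexx orbT.
by have [L LE] := bounded_linear_clin l b; exists L => x; rewrite LE.
Qed.

End Composition.

Section ImplicitFunctionC.
Context (R : realType) (V : normedModType R) (n : nat) (U : set V).
Variables (g : V -> 'rV[R]_n) (f : 'I_n -> ('rV[R]_n * V)%type -> R).

Hypothesis f_expanding : forall v, U v -> exists2 K : R, 0 < K &
  exists2 d : R, 0 < d & forall (k : 'rV[R]_n) (h : V), `|k| < d -> `|h| < d ->
    `|g v + k - g (v + h)| <= K * `|\row_l f l (g v + k, v + h)|.
Hypothesis f_zero : forall l v, U v -> f l (g v, v) = 0.

(** [J] and [D] are the restrictions to the two factors of the differential of f at (g v, v); they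
    are as regular as g as long as f has one more derivative. *)
Theorem expanding_implicit_class_C (K : nat) : open U ->
  (forall l, class_C_on K.+1 setT (f l)) ->
  forall m, class_C_on K.+1 U (fun v => g v 0 m).
Proof.
move=> oU Cf.
have [ip ipE] := pair_clin V 'rV[R]_n.
pose J v : 'M[R]_n := \matrix_(i, l) fdiff (f l) (g v, v) (delta_mx 0 i, 0).
(* Written with [bcompr] and the injection of the second factor, so that D depends on the
   differential of f through a bounded bilinear map. *)
pose D l v : clin V R := bcompr (fun (L : clin ('rV[R]_n * V)%type R) w => L w)
  (fdiff (f l) (g v, v)) ip.
have DE l v h : D l v h = fdiff (f l) (g v, v) (0, h).
  by rewrite /D (bcomprE (@apply_bilinear R _ _)) ipE.
have df l x : differentiable (f l) x by have [d _] := Cf l; exact: d.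
have JE v (k : 'rV[R]_n) l : (k *m J v) 0 l = fdiff (f l) (g v, v) (k, 0).
  rewrite mxE; transitivity (fdiff (f l) (g v, v)
      (\sum_i k 0 i *: ((delta_mx 0 i : 'rV[R]_n), (0 : V)))).
    by rewrite linear_sum; apply: eq_bigr => i _; rewrite linearZ !mxE.
  congr (fdiff _ _ _); rewrite {2}[k]row_sum_delta.
  elim/big_rec2: _ => // i y1 y2 _ ->.
  by congr (_, _); rewrite /= ?scaler0 ?addr0.
have cg : (forall k m, class_C_on k U (fun v => g v 0 m)) -> True by [].
apply: (@implicit_class_C _ _ _ U g (fun u v => \row_l f l (u, v)) J D) => //.
- move=> v Uv e e0.
  have nf : \forall y \near nbhs (0 : 'rV[R]_n * V), forall l : 'I_n,
      `|f l (y + (g v, v)) - (f l (g v, v) + fdiff (f l) (g v, v) y)| <=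
      e * `|y|.
    by apply: filter_forall => l; exact: fdiff_near.
  have /nbhs_ballP[d /= d0 dP] := nf.
  exists d => // k h kd hd.
  have kh : `|((k, h) : 'rV[R]_n * V)| <= `|k| + `|h|.
    by rewrite prod_normE/= ge_max lerDl lerDr !normr_ge0.
  apply: mx_norm_le => [|i l]; first by rewrite mulr_ge0 ?addr_ge0// ltW.
  rewrite ord1 !mxE; have := dP (k, h).
  rewrite -ball_normE/= sub0r normrN prod_normE/= gt_max kd hd => /(_ isT l).
  rewrite f_zero// add0r.
  have -> : (k, h) + (g v, v) = (g v + k, v + h) by congr (_, _); exact: addrC.
  have -> : fdiff (f l) (g v, v) (k, h) =
      (k *m J v) 0 l + D l v h.
    rewrite JE DE -linearD; congr (fdiff _ _ _).
    by congr (_, _); rewrite /= ?addr0 ?add0r.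
  rewrite mxE => /le_trans; apply.
  by rewrite ler_wpM2l// ltW.
- move=> k kK Cg.
  have Cp : class_C_on k U (fun v => (g v, v)).
    rewrite (_ : (fun v => _) = fun v =>
      \sum_m g v 0 m *: ((delta_mx 0 m : 'rV[R]_n), (0 : V)) + ip v);
        last first.
      apply/funext => v; rewrite ipE.
      rewrite {1}[g v]row_sum_delta.
      have -> : \sum_m g v 0 m *: ((delta_mx 0 m : 'rV[R]_n), (0 : V)) =
          (\sum_m g v 0 m *: (delta_mx 0 m : 'rV[R]_n), 0).
        elim/big_rec2: _ => // i y1 y2 _ ->.
        by congr (_, _); rewrite /= ?scaler0 ?addr0.
      by congr (_, _); rewrite /= ?addr0 ?add0r.
    apply: class_C_onD => //; last exact: class_C_on_linear.
    apply: class_C_on_sum => // m; apply: class_C_on_scale => //.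
    exact: class_C_on_cst.
  have Cd l : class_C_on k U (fun v => fdiff (f l) (g v, v)).
    apply: (class_C_on_comp oU (U' := setT)) => //.
    by have [_ Cd] := Cf l; exact: class_C_on_le Cd.
  split=> [i l|l].
    rewrite (_ : (fun v => _) = fun v =>
      fdiff (f l) (g v, v) (delta_mx 0 i, 0)); last first.
      by apply/funext => v; rewrite mxE.
    apply: (class_C_on_bilinear (@apply_bilinear R _ _) oU (Cd l)).
    exact: class_C_on_cst.
  apply: (class_C_on_bilinear _ oU (Cd l)); last exact: class_C_on_cst.
  exact/bcompr_bilinear/apply_bilinear.
Qed.

End ImplicitFunctionC.

(** * Hilbert spaces and Taylor remainders *)

Section Hilbert.
Context (R : realType) (H : completeNormedModType R) (dot : {dot H for idfun}).
Hypothesis dot_norm : forall x : H, dot x x = `|x| ^+ 2.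

Lemma dotC x y : dot x y = dot y x.
Proof. by rewrite hermC/= expr0 mul1r. Qed.

Lemma dotDr x y z : dot x (y + z) = dot x y + dot x z.
Proof. exact: linearDr. Qed.

Lemma dotZr a x y : dot x (a *: y) = a * dot x y.
Proof. exact: linearZr. Qed.

Lemma dotDl x y z : dot (x + y) z = dot x z + dot y z.
Proof. by rewrite dotC dotDr dotC [dot z y]dotC. Qed.

Lemma dotZl a x y : dot (a *: x) y = a * dot x y.
Proof. by rewrite dotC dotZr dotC. Qed.

Lemma dotNr x y : dot x (- y) = - dot x y.
Proof. exact: linearNr. Qed.

Lemma dotNl x y : dot (- x) y = - dot x y.
Proof. by rewrite dotC dotNr dotC. Qed.

Lemma dotBl x y z : dot (x - y) z = dot x z - dot y z.
Proof. by rewrite dotDl dotNl. Qed.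

Lemma dotBr x y z : dot x (y - z) = dot x y - dot x z.
Proof. by rewrite dotDr dotNr. Qed.

Lemma dot0r x : dot x 0 = 0.
Proof. exact: linear0r. Qed.

Lemma dot0l x : dot 0 x = 0.
Proof. by rewrite dotC dot0r. Qed.

Lemma dot_suml (I : finType) (x : I -> H) y :
  dot (\sum_i x i) y = \sum_i dot (x i) y.
Proof.
by elim/big_rec2: _ => [|i a b _ <-]; [exact: dot0l|exact: dotDl].
Qed.

Lemma dot_sumr (I : finType) (x : I -> H) y :
  dot y (\sum_i x i) = \sum_i dot y (x i).
Proof. by rewrite dotC dot_suml; apply: eq_bigr => i _; rewrite dotC. Qed.

Lemma normD_dot x y : `|x + y| ^+ 2 = `|x| ^+ 2 + 2 * dot x y + `|y| ^+ 2.
Proof. by rewrite -!dot_norm dotDl !dotDr [dot y x]dotC; ring. Qed.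

Lemma dot_le x y : `|dot x y| <= `|x| * `|y|.
Proof.
have [->|y0] := eqVneq y 0; first by rewrite dot0r !normr0 mulr0.
have ny : 0 < `|y| by rewrite normr_gt0.
rewrite -(@ler_pXn2r _ 2)// ?nnegrE ?mulr_ge0// real_normK ?num_real//.
have := sqr_ge0 `|x + - (dot x y / `|y| ^+ 2) *: y|.
rewrite normD_dot dotZr normrZ exprMn real_normK ?num_real// exprMn.
set c := dot x y; set a := `|x|; set b := `|y| in ny *.
have -> : a ^+ 2 + 2 * (- (c / b ^+ 2) * c) + (- (c / b ^+ 2)) ^+ 2 * b ^+ 2 =
    (a ^+ 2 * b ^+ 2 - c ^+ 2) / b ^+ 2 by field; rewrite gt_eqF.
by rewrite pmulr_lge0 ?subr_ge0 ?invr_gt0 ?exprn_gt0.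
Qed.

Lemma dot_bilinear : bounded_bilinear (dot : H -> H -> R).
Proof.
split=> [y a x z|x a y z|]; first by rewrite /= dotDl dotZl.
  by rewrite dotDr dotZr.
by exists 1 => x y; rewrite mul1r dot_le.
Qed.

Lemma dot_inj (x y : H) : (forall p, dot x p = dot y p) -> x = y.
Proof.
move=> xy; apply/eqP; rewrite -subr_eq0 -normr_eq0 -sqrf_eq0 -dot_norm dotBl.
by rewrite xy subrr.
Qed.

(** h nearly minimises |h|^2 / 2 - L h, with error d^2 / 2. Moving from h along p by the optimal
    step would lower this function by c^2 / (2 |p|^2), where c = <h, p> - L p; hence |c| <= d
    |p|. *)
Lemma approx_riesz (L : H -> R) (M d : R) :
  (forall a p q, L (a *: p + q) = a * L p + L q) ->
  (forall p, `|L p| <= M * `|p|) -> 0 < d ->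
  exists h, forall p, `|dot h p - L p| <= d * `|p|.
Proof.
move=> lL ML d0.
pose J (h : H) := 2^-1 * `|h| ^+ 2 - L h.
pose E := [set J h | h in setT].
have hE : has_inf E.
  split; first by exists (J 0), 0.
  (* Completing the square in |h|^2 / 2 - M |h|. *)
  exists (- 2^-1 * M ^+ 2) => _ [h _ <-].
  have := ML h; rewrite ler_norml => /andP[_]; rewrite /J.
  have := sqr_ge0 (`|h| - M); rewrite sqrrB; set a := `|h|.
  by rewrite -mulr_natr; lra.
have d2 : 0 < d ^+ 2 / 2 by rewrite divr_gt0 ?exprn_gt0.
have [_ [h _ <-] Jh] := inf_adherent d2 hE.
exists h => p.
have [->|p0] := eqVneq p 0.
  have L0 : L 0 = 0 by have := lL (-1) 0 0; rewrite scaler0 addr0 mulN1r addNr.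
  by rewrite dot0r L0 subrr normr0 mulr_ge0// ltW.
have np : 0 < `|p| by rewrite normr_gt0.
set c := dot h p - L p.
have LL a q : L (a *: p + q) = a * L p + L q by exact: lL.
have Js : inf E <= J (- (c / `|p| ^+ 2) *: p + h).
  apply: ge_inf; first by case: hE.
  by exists (- (c / `|p| ^+ 2) *: p + h).
have nE : `|- (c / `|p| ^+ 2) *: p + h| ^+ 2 = `|h| ^+ 2 +
    2 * (- (c / `|p| ^+ 2) * dot h p) + (- (c / `|p| ^+ 2)) ^+ 2 * `|p| ^+ 2.
  rewrite addrC normD_dot dotZr normrZ exprMn real_normK//; exact: num_real.
have := lt_le_trans Jh (lerD Js (lexx _)); rewrite /J lL nE => J1.
rewrite -(@ler_pXn2r _ 2)// ?nnegrE ?mulr_ge0// ?(ltW d0)//.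
rewrite real_normK ?num_real// exprMn.
rewrite -ler_pdivrMr ?exprn_gt0//.
have dp : dot h p = c + L p by rewrite /c subrK.
move: J1; rewrite dp.
set b := `|p| in np *; set a := `|h|; set l := L p; set m := L h.
have -> : c ^+ 2 / b ^+ 2 = c * (c / b ^+ 2) by rewrite mulrA.
have : (- (c / b ^+ 2)) ^+ 2 * b ^+ 2 = c * (c / b ^+ 2).
  by field; rewrite gt_eqF.
move=> ->; set e := c / b ^+ 2; lra.
Qed.

(** Testing on h n - h m shows that two approximate representatives are no farther apart than the
    sum of their errors 1 / (n + 1) and 1 / (m + 1); completeness provides the limit. *)
Lemma riesz (L : H -> R) (M : R) :
  (forall a p q, L (a *: p + q) = a * L p + L q) ->
  (forall p, `|L p| <= M * `|p|) -> exists h, forall p, dot h p = L p.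
Proof.
move=> lL ML.
have dn n : 0 < (n.+1%:R : R)^-1 by rewrite invr_gt0.
have /choice[h hP] n := approx_riesz lL ML (dn n).
have hB n m : `|h n - h m| <= n.+1%:R^-1 + m.+1%:R^-1.
  have [->|h0] := eqVneq (h n - h m) 0; first by rewrite normr0 addr_ge0.
  have nh : 0 < `|h n - h m| by rewrite normr_gt0.
  rewrite -(ler_pM2r nh) -expr2 -dot_norm dotBl.
  rewrite mulrDl; set q := h n - h m.
  have -> : dot (h n) q - dot (h m) q =
    (dot (h n) q - L q) - (dot (h m) q - L q) by ring.
  rewrite (le_trans (ler_norm _))// (le_trans (ler_normB _ _))//.
  exact: lerD (hP n q) (hP m q).
have hc : cvg (h @ \oo).
  apply: cauchy_cvg; apply: cauchy_exP => e e0.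
  have e2 : 0 < e / 2 by rewrite divr_gt0.
  have [n _ nP] := near_infty_natSinv_lt (PosNum e2).
  exists (h n); exists n => //= m /= nm; rewrite -ball_normE/=.
  apply: (le_lt_trans (hB n m)); rewrite [e]splitr; apply: ltrD.
    exact: (nP n (leqnn n)).
  exact: (nP m nm).
exists (lim (h @ \oo)) => p.
apply/eqP; rewrite -subr_eq0 -normr_eq0; apply/eqP/le_anti; rewrite normr_ge0.
rewrite andbT; apply/ler_addgt0Pl => e e0; rewrite addr0.
pose d := e / (2 * (`|p| + 1)).
have p1 : 0 < `|p| + 1 by rewrite ltr_wpDl.
have d0 : 0 < d by rewrite divr_gt0// mulr_gt0.
have /cvgrPdist_lt/(_ _ d0) [n1 _ n1P] := hc.
have [n2 _ n2P] := near_infty_natSinv_lt (PosNum d0).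
pose n := maxn n1 n2.
have h1 : `|lim (h @ \oo) - h n| < d by apply: n1P; rewrite /= leq_maxl.
have h2 : (n.+1%:R : R)^-1 < d by apply: n2P; rewrite /= leq_maxr.
have -> : dot (lim (h @ \oo)) p - L p =
    dot (lim (h @ \oo) - h n) p + (dot (h n) p - L p) by rewrite dotBl; ring.
apply: (le_trans (ler_normD _ _)).
have e2 : e = d * (`|p| + 1) + d * (`|p| + 1).
  by rewrite /d; field; rewrite gt_eqF.
rewrite [leRHS]e2; apply: lerD.
  apply: (le_trans (dot_le _ _)); rewrite ler_pM// ?lerDl// ltW//.
apply: (le_trans (hP n p)); rewrite ler_pM// ?lerDl// ltW//.
Qed.

End Hilbert.

Section Curves.
Context (R : realType).
Implicit Types V W : normedModType R.

Lemma derive1_clin V W (L : clin V W) (f : R -> V) x : derivable f x 1 ->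
  derivable (fun y => L (f y)) x 1 /\
  ((fun y => L (f y))^`() x = L (f^`() x))%classic.
Proof.
move=> df; have dfx : differentiable f x by exact/derivable1_diffP.
have dL : differentiable L (f x).
  by apply: linear_differentiable; exact: clin_continuous.
have dLf : differentiable (fun y => L (f y)) x by exact: differentiable_comp.
split; first exact/derivable1_diffP.
rewrite derive1E'// (@diff_comp _ _ _ _ f L)//= derive1E'//.
by rewrite (diff_lin _ (@clin_continuous _ _ _ L)).
Qed.

Lemma derive1n_clin V W (L : clin V W) k (f : R -> V) : class_C k f ->
  forall i, (i <= k)%N -> derive1n i (fun y => L (f y)) =
    (fun y => L (derive1n i f y)).
Proof.
move=> [df _]; elim=> [//|i ih] ik; rewrite derive1nS ih 1?ltnW//.
apply/funext => x; have [_ ->] := derive1_clin L (df i x ik).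
by rewrite derive1nS.
Qed.

Lemma class_C_clin V W (L : clin V W) k (f : R -> V) : class_C k f ->
  class_C k (fun y => L (f y)).
Proof.
move=> Cf; have [df cf] := Cf; split=> [i x ik|i ik].
  rewrite (derive1n_clin L Cf) 1?ltnW//.
  by have [] := derive1_clin L (df i x ik).
rewrite (derive1n_clin L Cf)// => x.
apply: (@continuous_comp _ _ _ (derive1n i f) L); first exact: cf.
exact: clin_continuous.
Qed.

Lemma continuous_bounded_itv V (f : R -> V) (a : R) :
  0 <= a -> continuous f ->
  exists2 B : R, 0 < B & forall x, `|x| <= a -> `|f x| <= B.
Proof.
move=> a0 cf.
have cn : {within `[- a, a], continuous (fun x => `|f x|)}.
  apply: continuous_subspaceT => x; apply: continuous_comp; first exact: cf.
  exact: norm_continuous.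
have aa : - a <= a by rewrite (le_trans _ a0)// oppr_le0.
have [c _ cP] := EVT_max aa cn.
exists (`|f c| + 1); first exact: ltr_wpDl.
move=> x; rewrite ler_norml => xa.
by rewrite (le_trans (cP x _))// ?lerDl// in_itv.
Qed.

End Curves.

Section MeanValue.
Context (R : realType) (H : completeNormedModType R) (dot : {dot H for idfun}).
Hypothesis dot_norm : forall x : H, dot x x = `|x| ^+ 2.

Lemma dot_clin (p : H) :
  exists L : clin H R, forall x, L x = dot x p.
Proof.
have [b _ [M bM]] := dot_bilinear dot_norm.
have bMp x : `|dot x p| <= M * `|p| * `|x| by rewrite mulrAC.
have [L LE] := bounded_linear_clin (b p) bMp.
by exists L => x; rewrite LE.
Qed.

Lemma derive1_dot (f : R -> H) p x : derivable f x 1 ->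
  derivable (fun y => dot (f y) p) x 1 /\
  ((fun y => dot (f y) p)^`() x = dot (f^`() x) p)%classic.
Proof.
move=> df; have [L LE] := dot_clin p.
rewrite (_ : (fun _ => _) = fun y => L (f y)); last by apply/funext => y.
by rewrite -LE; exact: derive1_clin.
Qed.

Lemma derive1n_dot k (f : R -> H) p : class_C k f ->
  forall i, (i <= k)%N -> derive1n i (fun y => dot (f y) p) =
    (fun y => dot (derive1n i f y) p).
Proof.
move=> Cf i ik; have [L LE] := dot_clin p.
rewrite (_ : (fun _ => _) = fun y => L (f y)); last by apply/funext => y.
by rewrite (derive1n_clin L Cf)//; apply/funext => y.
Qed.

Lemma class_C_dot k (f : R -> H) p : class_C k f ->
  class_C k (fun y => dot (f y) p).
Proof.
move=> Cf; have [L LE] := dot_clin p.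
rewrite (_ : (fun _ => _) = fun y => L (f y)); last by apply/funext => y.
exact: class_C_clin.
Qed.

(* The scalar mean value theorem is applied to the component of [f] along
   [f y - f x]. *)
Lemma mean_value_le (f : R -> H) (B x y r : R) :
  (forall s : R, derivable f s 1) ->
  (forall s, `|s| <= r -> `|(f^`() s)%classic| <= B) ->
  `|x| <= r -> `|y| <= r -> `|f y - f x| <= B * `|y - x|.
Proof.
wlog xy : x y / x < y => [wl|] df fB xr yr.
  have [xy|yx|->] := ltgtP x y; first exact: wl.
    by rewrite distrC [`|y - x|]distrC; exact: wl.
  by rewrite !subrr !normr0 mulr0.
set e := f y - f x.
have [->|e0] := eqVneq e 0.
  rewrite normr0 mulr_ge0// (le_trans (normr_ge0 _) (fB x xr))//.
have ne : 0 < `|e| by rewrite normr_gt0.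
have df' (s : R) : is_derive s 1 (fun y => dot (f y) e)
  (dot (f^`() s)%classic e).
  have [d1 d2] := derive1_dot e (df s).
  by rewrite -d2 derive1E; exact: derivableP.
have cf : {within `[x, y], continuous (fun y => dot (f y) e)}.
  apply: continuous_subspaceT => s; apply: differentiable_continuous.
  by apply/derivable1_diffP; have [] := derive1_dot e (df s).
have [c] := MVT xy (fun s _ => df' s) cf.
rewrite in_itv/= => /andP[xc cy] /= fc.
have cr : `|c| <= r.
  rewrite ler_norml; move: xr yr; rewrite !ler_norml => /andP[xr _] /andP[_ yr].
  by rewrite (le_trans xr (ltW xc)) (le_trans (ltW cy) yr).
rewrite -(ler_pM2r ne) -expr2 -dot_norm {1}/e dotBl fc.
rewrite (le_trans (ler_norm _))// normrM mulrAC ler_wpM2r//.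
by rewrite (le_trans (dot_le dot_norm _ _))// ler_wpM2r// fB.
Qed.

Definition taylor_rem n (f : R -> H) (x : R) : H :=
  f x - \sum_(k < n) (x ^+ k / k`!%:R) *: derive1n k f 0.

Lemma derivable_taylor_rem n (f : R -> H) x : derivable f x 1 ->
  derivable (taylor_rem n.+1 f) x 1 /\
  ((taylor_rem n.+1 f)^`() x = taylor_rem n (f^`()) x)%classic.
Proof.
move=> df.
have ds (k : 'I_n.+1) : is_derive x 1
    (fun x : R => (x ^+ k / k`!%:R) *: derive1n k f 0)
    ((x ^+ k.-1 *+ k / k`!%:R) *: derive1n k f 0).
  have d0 : is_derive x 1 (fun y : R => y ^+ k) (x ^+ k.-1 *+ k).
    have -> : x ^+ k.-1 *+ k = 'D_1 (fun y : R => y ^+ k) x.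
      by rewrite exp_derive /GRing.scale/= mulr1 mulr_natl.
    exact/derivableP/exprn_derivable.
  have dZ (c : R) (v : H) (g : R -> R) (g' : R) : is_derive x 1 g g' ->
      is_derive x 1 (fun y => (g y * c) *: v) ((g' * c) *: v).
    move=> dg; have dg1 : derivable g x 1 by case: dg.
    pose L' : R -> H := fun a => (a * c) *: v.
    have [L LE] : exists L : clin R H, forall a, L a = (a * c) *: v.
      have lL' : linear (L' : R^o -> H).
        by move=> a y z; rewrite /L' mulrDl scalerDl scalerA mulrA.
      have bL' (y : R) : `|L' y| <= `|c| * `|v| * `|y|.
        by rewrite /L' normrZ normrM [leRHS]mulrC mulrA.
      have [L LE] := bounded_linear_clin lL' bL'.
      by exists L => a; rewrite LE.
    have [e1 e2] := derive1_clin L dg1.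
    rewrite (_ : (fun y => _) = fun y => L (g y)); last by apply/funext => y.
    rewrite -LE (_ : g' = (g^`() x)%classic);
      last by rewrite derive1E derive_val.
    by rewrite -e2 derive1E; exact: derivableP.
  exact: dZ.
have dsum : is_derive x 1
  (fun x : R => \sum_(k < n.+1) (x ^+ k / k`!%:R) *: derive1n k f 0)
  (\sum_(k < n.+1) (x ^+ k.-1 *+ k / k`!%:R) *: derive1n k f 0).
  rewrite (_ : (fun y => _) = \sum_(k < n.+1)
     (fun y : R => (y ^+ k / k`!%:R) *: derive1n k f 0)).
    exact: is_derive_sum.
  by apply/funext => y; rewrite fct_sumE.
have dB : is_derive x 1 (taylor_rem n.+1 f) (f^`()%classic x -
    \sum_(k < n.+1) (x ^+ k.-1 *+ k / k`!%:R) *: derive1n k f 0).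
  apply: is_deriveB => //; rewrite derive1E; exact: derivableP.
split; first by case: dB.
rewrite derive1E derive_val /taylor_rem big_ord_recl/= mulr0n mul0r scale0r.
rewrite add0r; congr (_ - _); apply: eq_bigr => k _.
rewrite /bump/= add1n -derive1Sn; congr (_ *: _).
by rewrite factS natrM invfM mulrA -[x ^+ k *+ _]mulr_natr mulfK// pnatr_eq0.
Qed.

Lemma taylor_rem0 n (f : R -> H) : taylor_rem n.+1 f 0 = 0.
Proof.
rewrite /taylor_rem big_ord_recl/= expr0 fact0 divr1 scale1r big1 ?addr0
  ?subrr//.
by move=> k _; rewrite expr0n/= mul0r scale0r.
Qed.

(** The derivative of the remainder of f is the remainder of f' of one order less, so the mean value
    inequality between 0 and x gives the induction step, at the price of the factor 1 / n!. *)
Lemma taylor_rem_le n (f : R -> H) (B : R) : class_C n f ->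
  (forall x, `|x| <= 1 -> `|derive1n n f x| <= B) ->
  forall x, `|x| <= 1 -> `|taylor_rem n f x| <= B * `|x| ^+ n.
Proof.
elim: n f => [|n ih] f Cf fB x x1.
  by rewrite /taylor_rem big_ord0 subr0 expr0 mulr1; exact: fB.
have [df _] := Cf.
rewrite -[taylor_rem _ _ x]subr0 -(taylor_rem0 n f).
have -> : B * `|x| ^+ n.+1 = (B * `|x| ^+ n) * `|x - 0|.
  by rewrite subr0 exprSr mulrA.
apply: (@mean_value_le _ _ _ _ `|x|) => //; last by rewrite normr0.
  by move=> s; have [] := derivable_taylor_rem n (df 0 s isT).
move=> s sx; have [_ ->] := derivable_taylor_rem n (df 0 s isT).
have B0 : 0 <= B by rewrite (le_trans (normr_ge0 _) (fB 0 _))// normr0.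
apply: (@le_trans _ _ (B * `|s| ^+ n)).
  apply: ih; [exact: class_C_derive1| |exact: le_trans x1].
  by move=> y y1; rewrite -derive1Sn; exact: fB.
by rewrite ler_wpM2l// lerXn2r// nnegrE.
Qed.

End MeanValue.

(** * Zeros of higher derivatives *)

Section Rolle.
Context (R : realType).
Implicit Types (f g h : R -> R) (s t : seq R).

Lemma Rolle_derivable f (x y : R) : x < y -> (forall u : R, derivable f u 1) ->
  f x = 0 -> f y = 0 -> exists2 c, x < c < y & (f^`() c = 0)%classic.
Proof.
move=> xy df fx fy.
have cf : {within `[x, y], continuous f}.
  apply: continuous_subspaceT => s; apply: differentiable_continuous.
  exact/derivable1_diffP.
have fxy : f x = f y by rewrite fx fy.
have [c] := @Rolle R f x y xy (fun u _ => df u) cf fxy.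
rewrite in_itv/= => cxy dc; exists c => //.
by rewrite derive1E; apply: derive_val.
Qed.

Lemma path_lt_last x s : path <%R x s -> x <= last x s.
Proof.
elim: s x => //= y s ih x /andP[xy /ih]; exact: le_trans (ltW xy).
Qed.

Lemma path_lt_mem_last x s u : path <%R x s -> u \in x :: s -> u <= last x s.
Proof.
elim: s x => [|y s ih] x /=; first by rewrite inE => _ /eqP ->.
move=> /andP[xy ys]; rewrite inE => /orP[/eqP ->|]; last exact: ih.
by rewrite (le_trans (ltW xy))// path_lt_last.
Qed.

Lemma Rolle_path f x s : (forall u : R, derivable f u 1) ->
  path <%R x s -> all (fun u => f u == 0) (x :: s) ->
  exists t, [/\ size t = size s, path <%R x t &
    all (fun u => (f^`()%classic u == 0) && (u <= last x s)) t].
Proof.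
move=> df; elim: s x => [|y s ih] x /=; first by exists [::].
move=> /andP[xy ys] /and3P[fx fy fs].
have [|t [st yt at_]] := ih y ys; first by rewrite /= fy.
have [c /andP[xc cy] dc] := Rolle_derivable xy df (eqP fx) (eqP fy).
exists (c :: t); split; rewrite /= ?st//.
  rewrite xc /=; case: t yt {st at_} => //= d t /andP[yd ->].
  by rewrite (lt_trans cy yd).
rewrite dc eqxx at_ andbT/=.
by rewrite (le_trans (ltW cy))// path_lt_last.
Qed.

(* Between consecutive zeros of [f] one inserts a zero of [f']. *)
Lemma Rolle_interleave f x s : (forall u : R, derivable f u 1) ->
  path <%R x s -> all (fun u => f u == 0) (x :: s) ->
  exists t, [/\ size t = (2 * size s)%N, path <%R x t, last x t = last x s,
    {subset s <= t} &
    all (fun u => (u \in s) || (f^`()%classic u == 0)) t].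
Proof.
move=> df; elim: s x => [|y s ih] x /=; first by exists [::].
move=> /andP[xy ys] /and3P[fx fy fs].
have [|t [st yt lt sub at_]] := ih y ys; first by rewrite /= fy.
have [c /andP[xc cy] dc] := Rolle_derivable xy df (eqP fx) (eqP fy).
exists (c :: y :: t); split; rewrite /= ?st ?mulnS//.
- by rewrite xc cy.
- by move=> u; rewrite !inE => /orP[->|/sub ->]; rewrite !orbT.
- rewrite dc eqxx orbT inE eqxx/=; apply: sub_all at_ => u.
  by move=> /orP[us|->]; rewrite ?inE ?us ?orbT.
Qed.

Lemma Rolle_iter (a b : R) k f x s :
  (forall i (u : R), (i < k)%N -> derivable (derive1n i f) u 1) ->
  size s = k -> path <%R x s -> all (fun u => f u == 0) (x :: s) ->
  all (fun u => a <= u <= b) (x :: s) ->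
  exists2 c, a <= c <= b & derive1n k f c = 0.
Proof.
elim: k f x s => [|k ih] f x s df ss xs fs abs.
  move: fs abs; case: s ss {xs} => //= _; rewrite !andbT => /eqP fx xab.
  by exists x.
have [t [st xt at_]] := Rolle_path (fun u => df 0 u isT) xs fs.
have ax : a <= x by move: abs => /= /andP[/andP[]].
have lb : last x s <= b.
  by move/allP : abs => /(_ _ (mem_last x s)) /andP[].
move: st xt at_; rewrite ss;
  case: t => // c t [st] /= /andP[xc ct] /andP[/andP[fc cl] at_].
have abt : all (fun u => a <= u <= b) (c :: t).
  rewrite /= (le_trans ax (ltW xc)) (le_trans cl lb)/=.
  apply/allP => u ut; have /(allP at_)/andP[_ ul] := ut.
  rewrite (le_trans ul lb) andbT (le_trans ax)// (le_trans (ltW xc))// ltW//.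
  by have /(order_path_min lt_trans)/allP/(_ u ut) := ct.
have ft : all (fun u => f^`()%classic u == 0) (c :: t).
  by rewrite /= fc; apply: sub_all at_ => u /andP[].
have [d dab fd] : exists2 d, a <= d <= b & derive1n k (f^`()%classic) d = 0.
  apply: (ih _ c t) => // i u ik.
  by rewrite -derive1Sn; exact: df.
by exists d => //; rewrite -derive1Sn in fd.
Qed.

Lemma derive1nB k f g : class_C k f -> class_C k g ->
  forall i, (i <= k)%N ->
  derive1n i (fun x => f x - g x) = (fun x => derive1n i f x - derive1n i g x).
Proof.
move=> [df _] [dg _]; elim=> [//|i ih] ik; rewrite derive1nS ih 1?ltnW//.
apply/funext => x; rewrite derive1E deriveB; [|exact: df|exact: dg].
by rewrite !derive1nS !derive1E.
Qed.

Lemma class_CB k f g : class_C k f -> class_C k g ->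
  class_C k (fun x => f x - g x).
Proof.
move=> Cf Cg; have [df cf] := Cf; have [dg cg] := Cg; split=> [i x ik|i ik].
  rewrite (derive1nB Cf Cg) 1?ltnW//; apply: derivableB; [exact: df|exact: dg].
rewrite (derive1nB Cf Cg)// => x; apply: continuousB; [exact: cf|exact: cg].
Qed.

Lemma derive1n_horner k (p : {poly R}) :
  derive1n k (horner p) = horner (p^`(k))%R.
Proof.
elim: k => [|k ih]; first by rewrite derivn0.
by rewrite derive1nS ih derivnS derivE.
Qed.

Lemma class_C_horner k (p : {poly R}) : class_C k (horner p).
Proof.
split=> [i x _|i _]; rewrite derive1n_horner; first exact: derivable_horner.
exact: continuous_horner.
Qed.

Lemma derivn_monic (p : {poly R}) n : p \is monic -> size p = n.+1 ->
  (p^`(n))%R = (n`!%:R)%:P.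
Proof.
move=> mp sp; apply/polyP => i; rewrite coef_derivn coefC.
case: i => [|i]; last by rewrite nth_default ?mul0rn// sp addnS ltnS leq_addr.
rewrite addn0 ffactnn; move/monicP : mp; rewrite lead_coefE sp/= => ->.
by [].
Qed.

(* The function [h - c * \prod_i (X - x_i)^2] vanishing at [y] has [N] double
   zeros and one more zero, so its derivative of order [2N] vanishes. *)
Lemma double_zeros_lt0 (N : nat) (x : 'I_N -> R) h (r : R) :
  class_C (2 * N) h -> injective x -> (forall i, `|x i| <= r) ->
  (forall i, h (x i) = 0) -> (forall i, (h^`() (x i) = 0)%classic) ->
  (forall u, `|u| <= r -> derive1n (2 * N) h u < 0) ->
  forall y, `|y| <= r -> (forall i, y != x i) -> h y < 0.
Proof.
case: N x => [x|N x] Ch injx xr hx dhx hneg y yr yx; first exact: hneg.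
rewrite ltNge; apply/negP => hy.
pose P : {poly R} := \prod_(a <- [seq x i | i <- enum 'I_N.+1]) ('X - a%:P).
pose Q := P ^+ 2.
have Px i : P.[x i] = 0.
  by apply/eqP; rewrite -rootE root_prod_XsubC map_f// mem_enum.
have mP : P \is monic by rewrite monic_prod_XsubC.
have mQ : Q \is monic by rewrite monic_exp.
have sQ : size Q = (2 * N.+1).+1.
  rewrite -[LHS]prednK ?size_poly_gt0 ?monic_neq0// size_exp size_prod_XsubC/=.
  by rewrite size_map size_enum_ord mulnC.
have Py : P.[y] != 0.
  rewrite -rootE root_prod_XsubC; apply/negP => /mapP[i _ yi].
  by have := yx i; rewrite yi eqxx.
have Qy : 0 < Q.[y] by rewrite horner_exp exprn_even_gt0//= Py orbT.
(* This c makes [F] below vanish at y as well. Under the assumption h y >= 0 it is nonnegative, and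
   a zero of the top derivative of F contradicts the sign of that of h, since the top derivative of
   Q is a positive constant. *)
pose c := h y / Q.[y].
have c0 : 0 <= c by rewrite divr_ge0// ltW.
pose F u := h u - (c *: Q).[u].
have CF : class_C (2 * N.+1) F by apply: class_CB => //; exact: class_C_horner.
have Fy : F y = 0 by rewrite /F hornerZ /c divfK ?gt_eqF// subrr.
have Fx i : F (x i) = 0 by rewrite /F hornerZ horner_exp Px hx expr0n mulr0
  subrr.
have dF (u : R) : derivable F u 1 by have [d _] := CF; exact: (d 0 u isT).
have dFx i : (F^`() (x i) = 0)%classic.
  have := derive1nB Ch (class_C_horner (2 * N.+1) (c *: Q))
    (isT : (1 <= 2 * N.+1)%N).
  rewrite !derive1n1 -/F => ->;
    rewrite dhx -derivE derivZ hornerZ /Q expr2 derivM.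
  by rewrite hornerD !hornerM Px mulr0 mul0r addr0 mulr0 subrr.
pose l := sort <=%R (y :: [seq x i | i <- enum 'I_N.+1]).
have ul : uniq l.
  rewrite sort_uniq/= map_inj_uniq// enum_uniq andbT.
  by apply/negP => /mapP[i _ yi]; have := yx i; rewrite yi eqxx.
have memx i : x i \in [seq x i | i <- enum 'I_N.+1] by rewrite map_f ?mem_enum.
have slt : sorted <%R l.
  by rewrite lt_sorted_uniq_le ul sort_le_sorted.
have sl : size l = N.+2 by rewrite size_sort/= size_map size_enum_ord.
have inl u : u \in l -> u = y \/ exists i, u = x i.
  rewrite mem_sort inE => /orP[/eqP ->|/mapP[i _ ->]]; first by left.
  by right; exists i.
case El : l sl slt ul inl => [//|l0 l'] [sl'] slt ul inl.
have zl : all (fun u => F u == 0) (l0 :: l').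
  by apply/allP => u /inl[->|[i ->]]; rewrite ?Fy ?Fx.
have [t [st l0t lt sub at_]] := Rolle_interleave dF slt zl.
have yl : y \in l0 :: l' by rewrite -El mem_sort inE eqxx.
have yt : y \in l0 :: t.
  by move: yl; rewrite !inE => /orP[->//|/sub ->]; rewrite orbT.
have rl u : u \in l0 :: l' -> - r <= u <= r.
  by rewrite -ler_norml => /inl[->|[i ->]].
have rt : all (fun u => - r <= u <= r) (l0 :: t).
  apply/allP => u ut.
  have /andP[r1 r2] : - r <= l0 <= r by apply: rl; rewrite inE eqxx.
  have /andP[r3 r4] : - r <= last l0 l' <= r by apply: rl; exact: mem_last.
  have l0u : l0 <= u.
    move: ut; rewrite inE => /orP[/eqP ->//|ut].
    by have /(order_path_min lt_trans)/allP/(_ u ut)/ltW := l0t.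
  rewrite (le_trans r1 l0u)/= (le_trans _ r4)// -lt.
  exact: path_lt_mem_last l0t ut.
(* Among the points of the list, y is the only one where F' need not vanish. Removing it leaves as
   many zeros of F' as the degree of Q. *)
pose t1 := [seq u <- l0 :: t | u != y].
have dt1 : all (fun u => F^`()%classic u == 0) t1.
  apply/allP => u; rewrite mem_filter => /andP[uy].
  have xi i : F^`()%classic (x i) == 0 by rewrite dFx.
  have ul' : u \in l0 :: l' -> F^`()%classic u == 0.
    by move=> /inl[uy'|[i ->//]]; rewrite uy' eqxx in uy.
  rewrite inE => /orP[u0|/(allP at_)/orP[ut|//]].
    by apply: ul'; rewrite inE u0.
  by apply: ul'; rewrite inE ut orbT.
have ut : uniq (l0 :: t).
  by have : sorted <%R (l0 :: t) by []; rewrite lt_sorted_uniq_le => /andP[].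
have st1 : size t1 = (2 * N.+1)%N.
  have := count_predC (pred1 y) (l0 :: t).
  rewrite -[count (predC _) _]size_filter -/t1 (count_uniq_mem _ ut) yt.
  by rewrite [size (_ :: _)]/= st sl' add1n => -[].
have slt1 : sorted <%R t1 by apply: sorted_filter; [exact: lt_trans|].
have rt1 : all (fun u => - r <= u <= r) t1.
  by apply/allP => u; rewrite mem_filter => /andP[_]; exact: (allP rt).
case Et : t1 st1 slt1 dt1 rt1 => [//|u t2];
  rewrite mulnS => -[st2] slt1 dt1 rt1.
have [] := @Rolle_iter (- r) r (size t2) (F^`()%classic) u t2 _ erefl slt1 dt1
  rt1.
  move=> i v it2; rewrite -derive1Sn; have [d _] := CF; apply: d.
  by move: it2; rewrite st2 mulnS => it2; exact: it2.
move=> d dr; rewrite -derive1Sn st2 -[X in derive1n X]/(2 + 2 * N)%N -mulnS =>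
  Fd.
have := hneg d; rewrite ler_norml => /(_ dr); apply/negP; rewrite -leNgt.
have := derive1nB Ch (class_C_horner (2 * N.+1) (c *: Q)) (leqnn (2 * N.+1)).
rewrite -/F => FE; move: Fd;
  rewrite FE derive1n_horner derivnZ (derivn_monic mQ sQ).
rewrite hornerZ hornerC => /eqP; rewrite subr_eq0 => /eqP ->.
by rewrite mulr_ge0.
Qed.

(** By the mean value theorem h u = u h'(c) with 0 < c < u, and h' satisfies the same hypotheses
    with m lowered by one. *)
Lemma flat_gt0 (r : R) m h : class_C m h ->
  (forall j, (j < m)%N -> derive1n j h 0 = 0) ->
  (forall u, 0 < u <= r -> 0 < derive1n m h u) ->
  forall u, 0 < u <= r -> 0 < h u.
Proof.
elim: m h => [//|m ih] h Ch h0 hm u /andP[u0 ur].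
have [dh _] := Ch.
have dh' (s : R) : is_derive s 1 h (h^`()%classic s).
  by rewrite derive1E; apply: derivableP; exact: (dh 0).
have cf : {within `[0, u], continuous h}.
  apply: continuous_subspaceT => s; apply: differentiable_continuous.
  by apply/derivable1_diffP; exact: (dh 0).
have [c] := @MVT R h _ 0 u u0 (fun v _ => dh' v) cf.
rewrite in_itv/= => /andP[c0 cu]; have := h0 0 isT; rewrite /= => ->.
rewrite !subr0 => ->; rewrite mulr_gt0//.
apply: (ih (h^`()%classic)).
- exact: class_C_derive1.
- by move=> j jm; rewrite -derive1Sn; exact: h0.
- by move=> v vr; rewrite -derive1Sn; exact: hm.
- by rewrite c0/= (le_trans (ltW cu)).
Qed.

End Rolle.

(** * Stability of the certificate *)

Section Domain.
Context (R : realType).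
Local Open Scope quotient_scope.

Lemma to_torus_eq (x y : R) : to_torus x = to_torus y <-> x - y \is a Num.int.
Proof.
split=> [xy|xy]; last by apply/eqmodP.
by have /eqmodP := xy.
Qed.

Lemma intr_norm_lt1 (k : int) : `|k%:~R : R| < 1 -> k = 0.
Proof.
rewrite -intr_norm -[ltRHS]/(1%:~R) ltr_int -abszE -[ltRHS]/(Posz 1) ltz_nat.
by rewrite ltnS leqn0 absz_eq0 => /eqP.
Qed.

Lemma cls_surj X (x : carrier R X) : exists2 r : R, x = cls X r &
  X = Torus -> `|r| <= 2^-1.
Proof.
case: X x => x; first by exists x.
pose r : R := repr x; have xr : x = to_torus r by rewrite /to_torus reprK.
(* An integer nearest to r is subtracted, whence |s| <= 1/2. *)
pose s := r - (Num.floor (r + 2^-1))%:~R.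
exists s => [|_].
  by rewrite xr; apply/to_torus_eq; rewrite /s subKr; exact: intr_int.
have := ge_floor (r + 2^-1); have := floorD1_gt (r + 2^-1).
rewrite ler_norml /s intrD; set k := (Num.floor _)%:~R; lra.
Qed.

Lemma cls_inj X (d r s : R) : (X = Torus -> d <= 2^-1) -> `|r| < d ->
  `|s| < d ->
  cls X r = cls X s -> r = s.
Proof.
case: X => //= /(_ erefl) d2 rd sd /to_torus_eq/intrP[k rsk].
suff : k = 0 by move=> k0; apply/eqP; rewrite -subr_eq0 rsk k0.
have : `|r - s| < 1.
  rewrite (le_lt_trans (ler_normB _ _))//.
  by have := ltrD rd sd; lra.
by rewrite rsk => /intr_norm_lt1.
Qed.

Lemma cls_eq0 X (r : R) : (X = Torus -> `|r| < 1) -> cls X r = cls X 0 -> r = 0.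
Proof.
case: X => //= /(_ erefl) r1 /to_torus_eq; rewrite subr0 => /intrP[k rk].
by move: r1; rewrite rk => /intr_norm_lt1 ->.
Qed.

End Domain.

Section Kernel.
Context (R : realType) (H : completeNormedModType R) (dot : {dot H for idfun}).
Hypothesis dot_norm : forall x : H, dot x x = `|x| ^+ 2.
Context (X : domain) (phi : carrier R X -> H).

Lemma KER_continuous k : KER dot phi k -> continuous phi.
Proof.
case=> -[_ /(_ 0 isT) c] _; move: phi c; rewrite /phiR.
case: X => //= f c; apply/quotient_continuous; exact: c.
Qed.

Lemma KER_bounded k : KER dot phi k ->
  exists2 B : R, 0 < B & forall x, `|phi x| <= B.
Proof.
case=> -[_ /(_ 0 isT) c] L.
case: (pselect (X = Torus)) => XT.
  have [B B0 phiB] := continuous_bounded_itv (ltW (ltr01 : 0 < 1 :> R)) c.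
  exists B => // x; have [r -> /(_ XT) r2] := cls_surj x.
  by apply: phiB; rewrite (le_trans r2)// invf_le1// ler1n.
have XL : X = Line by case: X XT => // /(_ erefl).
have [_ _ /(_ 0 isT)[B phiB]] := L XL.
exists (`|B| + 1) => [|x]; first exact: ltr_wpDl.
have [r -> _] := cls_surj x.
by rewrite (le_trans (phiB r))// (le_trans (ler_norm _))// lerDl.
Qed.

(* Away from [0] it suffices to control [eta] on a bounded set of the
   coordinate: by periodicity on the torus, by decay on the line. *)
Lemma KER_away k (p : H) : KER dot phi k ->
  exists2 A : R, 0 < A & (X = Torus -> A < 1) /\ forall x,
    (exists2 r : R, x = cls X r & `|r| <= A) \/ `|dot (phi x) p| <= 2^-1.
Proof.
case=> _ L; case: (pselect (X = Torus)) => XT.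
  exists 2^-1 => //; split=> [_|x]; first by rewrite invf_lt1// ltr1n.
  by left; have [r -> /(_ XT) r2] := cls_surj x; exists r.
have XL : X = Line by case: X XT => // /(_ erefl).
have [cp cm _] := L XL.
have h2 : 0 < 2^-1 :> R by rewrite invr_gt0.
have /cvgrPdist_le/(_ _ h2)[a [ar aP]] := cp p.
have /cvgrPdist_le/(_ _ h2)[b [br bP]] := cm p.
exists (`|a| + `|b| + 1); first by rewrite ltr_wpDl// addr_ge0.
split=> // x; have [r -> _] := cls_surj x.
have [rA|Ar] := leP `|r| (`|a| + `|b| + 1); first by left; exists r.
right; have [r0|r0] := leP 0 r.
  have := aP r; rewrite sub0r normrN; apply; move: Ar; rewrite (ger0_norm r0).
  move=> Ar; apply: (le_lt_trans (ler_norm a)); apply: le_lt_trans Ar.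
  by rewrite -addrA lerDl addr_ge0.
have := bP r; rewrite sub0r normrN; apply; move: Ar; rewrite (ltr0_norm r0).
rewrite ltrNr => Ar; apply: (lt_le_trans Ar); rewrite lerNl.
apply: (le_trans (ler_norm _)); rewrite normrN.
by rewrite [`|a| + _]addrC -addrA lerDl addr_ge0.
Qed.

End Kernel.

Lemma unitmx_col_inj (F : fieldType) n (A : 'M[F]_n) :
  (forall c : 'cV_n, A *m c = 0 -> c = 0) -> A \in unitmx.
Proof.
move=> A0; rewrite -unitmx_tr -row_free_unit -kermx_eq0.
apply/eqP/row_matrixP => i; rewrite row0; apply: trmx_inj; rewrite trmx0.
apply: A0; apply: trmx_inj; rewrite trmx_mul trmxK trmx0.
by apply/sub_kermxP; exact: row_sub.
Qed.

Section Certificate.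
Context (R : realType) (H : completeNormedModType R) (dot : {dot H for idfun}).
Hypothesis dot_norm : forall x : H, dot x x = `|x| ^+ 2.
Context (X : domain) (phi : carrier R X -> H).

(** A vector c of the kernel satisfies |calF c|^2 = c^T gram c = 0. *)
Lemma gram_unitmx k : hypI dot phi k -> gram dot phi k \in unitmx.
Proof.
move=> [_ inj]; apply: unitmx_col_inj => c; rewrite gramE => c0; apply: inj.
apply/eqP; rewrite -normr_eq0 -sqrf_eq0 -dot_norm {2}/calF (dot_sumr).
rewrite big1// => j _; rewrite dotZr dotC.
have := congr1 (fun M : 'cV_k.+1 => M j 0) c0; rewrite !mxE => ->.
by rewrite mulr0.
Qed.

Lemma pW_dot N j : hypI dot phi (2 * N).-1 -> (j <= (2 * N).-1)%N ->
  dot (phi_ phi j) (pW dot phi N) = (j == 0%N)%:R.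
Proof.
move=> hI; rewrite -ltnS => jN.
have := gramE dot phi (invmx (gram dot phi (2 * N).-1) *m delta_mx 0 0).
rewrite mulKVmx ?gram_unitmx// =>
  /(congr1 (fun M : 'cV_ _ => M (Ordinal jN) 0)).
by rewrite !mxE eqxx andbT -val_eqE/= => <-.
Qed.

Lemma continuous_near0 (f : R -> R) (e : R) : continuous f -> 0 < e ->
  exists2 d : R, 0 < d & forall u, `|u| <= d -> `|f u - f 0| <= e.
Proof.
move=> cf e0; have /cvgrPdist_le/(_ _ e0) := cf 0.
move=> /nbhs_ballP[d /= d0 dP]; exists (d / 2); first by rewrite divr_gt0.
move=> u ud; rewrite distrC; apply: dP; rewrite -ball_normE/= sub0r normrN.
by rewrite (le_lt_trans ud)// ltr_pdivrMr// ltr_pMr// ltr1n.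
Qed.

(** Non-degeneracy only says that this derivative is nonzero. If it were positive, eta_W - 1, whose
    derivatives of order less than 2N vanish at 0, would be positive just to the right of 0, against
    |eta_W| < 1. *)
Lemma etaW_derive_lt0 N : (0 < N)%N -> etaW_nondegenerate dot phi N ->
  derive1n (2 * N) (fun s => dot (phiR phi s) (pW dot phi N)) 0 < 0.
Proof.
move=> N0 [hI [Ck _] eN0 eta1]; rewrite lt_neqAle eN0/= leNgt; apply/negP => eN.
set e := (fun s => _) in eN; have Ce : class_C (2 * N) e by exact: class_C_dot.
pose h s := e s - (1%:P).[s].
have Ch : class_C (2 * N) h by apply: class_CB => //; exact: class_C_horner.
have hE := derive1nB Ce (class_C_horner (2 * N) 1%:P).
have N20 : (0 < 2 * N)%N by rewrite muln_gt0.
have h2N : derive1n (2 * N) h = derive1n (2 * N) e.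
  rewrite hE//; apply/funext => u; rewrite derive1n_horner derivnC.
  by rewrite gtn_eqF// horner0 subr0.
have h0 j : (j < 2 * N)%N -> derive1n j h 0 = 0.
  move=> jN; rewrite hE 1?ltnW// (derive1n_dot dot_norm _ Ck) 1?ltnW//.
  rewrite -/(phi_ phi j) pW_dot//; last by rewrite -ltnS prednK.
  rewrite derive1n_horner derivnC; case: j {jN} => [|j] /=.
    by rewrite hornerC subrr.
  by rewrite horner0 subrr.
have [_ cD] := Ce.
have e2 : 0 < derive1n (2 * N) e 0 / 2 by rewrite divr_gt0.
have [d d0 dP] := continuous_near0 (cD _ (leqnn _)) e2.
(* The bound 1/2 gives u and 0 different classes on the torus. *)
pose u := Num.min d 2^-1.
have u0 : 0 < u by rewrite lt_min d0/= invr_gt0.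
have : 0 < h u.
  apply: (@flat_gt0 _ d _ _ Ch h0); last by rewrite u0 ge_min lexx.
  move=> v /andP[v0 vd]; have := dP v; rewrite gtr0_norm// => /(_ vd).
  rewrite h2N ler_norml => /andP[+ _]; set q := derive1n _ e v.
  move: e2; set q0 := derive1n _ _ 0; lra.
rewrite /h hornerC subr_gt0 => e1.
have := eta1 (cls X u); rewrite /etaW /Phi_adj.
have -> : cls X u != cls X 0.
  apply/eqP => /cls_eq0 u0'; move: u0; rewrite u0' ?ltxx// => _.
  rewrite gtr0_norm ?lt_min ?d0/= ?invr_gt0// gt_min invf_lt1 ?ltr1n ?orbT//.
move=> /(_ isT); rewrite ltNge => /negP; apply.
by rewrite (le_trans (ltW e1))// ler_norm.
Qed.

(** The set t <= |u| <= A is folded onto the interval [t, A] by taking the larger of the values at u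
    and - u, so that the extreme value theorem on an interval applies. *)
Lemma max_away (e : R -> R) (t A : R) : 0 < t -> continuous e ->
  (forall u, u != 0 -> `|u| <= A -> `|e u| < 1) ->
  exists2 g : R, 0 < g & forall u, t <= `|u| -> `|u| <= A -> `|e u| <= 1 - g.
Proof.
move=> t0 ce e1; have [tA|At] := leP t A; last first.
  exists 1 => // u tu uA; have := le_lt_trans (le_trans tu uA) At.
  by rewrite ltxx.
have cf : {within `[t, A], continuous (fun u => Num.max `|e u| `|e (- u)|)}.
  apply: continuous_subspaceT => u.
  apply: (@continuous_max _ _ (fun u => `|e u|) (fun u => `|e (- u)|)).
    by apply: continuous_comp; [exact: ce|exact: norm_continuous].
  apply: (@continuous_comp _ _ _ -%R (fun u => `|e u|)).
    exact: opp_continuous.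
  by apply: continuous_comp; [exact: ce|exact: norm_continuous].
have [c] := EVT_max tA cf; rewrite in_itv/= => /andP[tc cA] cP.
have c0 : 0 < c by exact: lt_le_trans tc.
have fc : Num.max `|e c| `|e (- c)| < 1.
  by rewrite gt_max !e1 ?oppr_eq0 ?gt_eqF// ?normrN gtr0_norm.
exists (1 - Num.max `|e c| `|e (- c)|); first by rewrite subr_gt0.
move=> u tu uA; rewrite subKr; have := cP `|u|;
  rewrite in_itv/= tu uA => /(_ isT).
apply: le_trans; rewrite le_max; have [u0|u0] := leP 0 u.
  by rewrite (ger0_norm u0) lexx.
by rewrite (ltr0_norm u0) opprK lexx orbT.
Qed.

(** Three zones are distinguished: beyond A, where |eta_W| <= 1/2; between d and A, where |eta_W|
    keeps a uniform gap to 1; and within d, where the derivative of order 2N of <phi, p> is negative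
    and where the N double contacts lie. The constants e and d involve no lower bound on the mutual
    distances of the x i, which are free to merge. *)
Lemma certificate_stable N : (0 < N)%N -> etaW_nondegenerate dot phi N ->
  exists2 e : R, 0 < e & exists2 d : R, 0 < d &
  forall (p : H) (x : 'I_N -> R), `|p - pW dot phi N| <= e ->
    injective x -> (forall i, `|x i| <= d) ->
    (forall i, dot (phiR phi (x i)) p = 1) ->
    (forall i, dot ((phiR phi)^`()%classic (x i)) p = 0) ->
    forall y, (forall i, y != cls X (x i)) -> `|dot (phi y) p| < 1.
Proof.
move=> N0 nd; have lt0 := etaW_derive_lt0 N0 nd.
have [hI KN _ eta1] := nd; have [Ck _] := KN.
have N20 : (0 < 2 * N)%N by rewrite muln_gt0.
set P := pW dot phi N in lt0 eta1 *.
set e := (fun s => _) in lt0; have Ce : class_C (2 * N) e by exact: class_C_dot.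
have [_ cD] := Ce; have ce : continuous e := cD 0%N isT.
have [B0 B00 phiB] := KER_bounded KN.
have [_ cphi] := Ck.
have [B2 B20 phi2B] := continuous_bounded_itv (ltW (ltr01 : 0 < 1 :> R))
  (cphi _ (leqnn (2 * N))).
have e0 : e 0 = 1 by exact: (pW_dot hI (leq0n _)).
(* Half the modulus of eta_W^(2N)(0): the derivative of order 2N is at most -k for |u| <= d, and at
   most -k/2 after replacing p_W by p. *)
pose k := - derive1n (2 * N) e 0 / 2.
have k0 : 0 < k by rewrite divr_gt0// oppr_gt0.
have h2 : 0 < 2^-1 :> R by rewrite invr_gt0.
have [d1 d10 d1P] := continuous_near0 (cD _ (leqnn _)) k0.
have [d2 d20 d2P] := continuous_near0 ce h2.
have [A A0 [A1 Aw]] := KER_away P KN.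
pose d := Num.min 1 (Num.min d1 d2).
have d0 : 0 < d by rewrite !lt_min ltr01 d10 d20.
have [g g0 gP] : exists2 g : R, 0 < g &
    forall u, d <= `|u| -> `|u| <= A -> `|e u| <= 1 - g.
  apply: max_away => // u u0 uA; apply: eta1; apply: contra_neq u0.
  by apply: cls_eq0 => XT; exact: le_lt_trans uA (A1 XT).
(* The three terms bound the effect of p - p_W: by k/2 on the derivative of order 2N, by 1/4 on the
   values near 0 and beyond A, by half the gap g in between. *)
pose E := Num.min (k / (2 * B2)) (Num.min (1 / (4 * B0)) (g / (2 * B0))).
have E0 : 0 < E.
  by rewrite !lt_min; apply/and3P; split; apply: divr_gt0 => //;
    exact: mulr_gt0.
exists E => //; exists d => // p x pE injx xd x1 dx0 y yx.
have E1 : E * B2 <= k / 2.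
  rewrite -ler_pdivlMr// -mulrA -invfM; by rewrite /E ge_min lexx.
have E2 : E * B0 <= 4^-1.
  rewrite -ler_pdivlMr// -invfM -div1r; by rewrite /E !ge_min lexx orbT.
have E3 : E * B0 <= g / 2.
  rewrite -ler_pdivlMr// -mulrA -invfM; by rewrite /E !ge_min lexx !orbT.
have pP v B : `|v| <= B -> `|dot v p - dot v P| <= E * B.
  move=> vB; rewrite -dotBr (le_trans (dot_le dot_norm _ _))// mulrC ler_pM//.
have py z : `|dot (phi z) p - dot (phi z) P| <= E * B0 by exact: pP.
have [[r yr rA]|y2] := Aw y; last first.
  have -> : dot (phi y) p = (dot (phi y) p - dot (phi y) P) + dot (phi y) P.
    by rewrite subrK.
  apply: le_lt_trans (ler_normD _ _) _.
  apply: le_lt_trans (lerD (le_trans (py y) E2) y2) _; lra.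
have [rd|dr] := leP `|r| d; last first.
  have er : `|e r| <= 1 - g by apply: gP => //; exact: ltW.
  have -> : dot (phi y) p = (dot (phi y) p - dot (phi y) P) + e r.
    by rewrite /e yr subrK.
  apply: le_lt_trans (ler_normD _ _) _.
  apply: le_lt_trans (lerD (le_trans (py y) E3) er) _; lra.
have rle : `|r| <= 1 /\ `|r| <= d1 /\ `|r| <= d2.
  by move: rd; rewrite !le_min => /andP[-> /andP[-> ->]].
(* Counting zeros only bounds <phi, p> from above. From below it is close to eta_W, which is at
   least 1/2 here. *)
have lower : - 1 < dot (phi y) p.
  have := le_trans (py y) E2; have := d2P r rle.2.2.
  rewrite e0 {1}/e /phiR/= -yr !ler_norml => /andP[+ _] /andP[+ _]; lra.
rewrite ltr_norml lower/= -subr_lt0.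
pose q s := dot (phiR phi s) p - (1%:P).[s].
have Cp : class_C (2 * N) (fun s => dot (phiR phi s) p) by exact: class_C_dot.
have qE := derive1nB Cp (class_C_horner (2 * N) 1%:P).
suff : q r < 0 by rewrite /q hornerC yr.
apply: (@double_zeros_lt0 _ N x q d) => //.
- by apply: class_CB => //; exact: class_C_horner.
- by move=> i; rewrite /q x1 hornerC subrr.
- move=> i; have := qE 1%N N20; rewrite !derive1n1 => ->.
  rewrite -derive1n1 (derive1n_dot dot_norm _ Ck)// derive1n1 dx0.
  by rewrite -derivE derivC horner0 subrr.
- move=> u ud; rewrite qE// derive1n_horner derivnC gtn_eqF// horner0 subr0.
  rewrite (derive1n_dot dot_norm _ Ck)//.
  have ule : `|u| <= 1 /\ `|u| <= d1.
    by move: ud; rewrite !le_min => /andP[-> /andP[-> _]].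
  have := d1P u ule.2; rewrite (derive1n_dot dot_norm _ Ck)//.
  have := le_trans (pP _ _ (phi2B u ule.1)) E1.
  have kE : dot (derive1n (2 * N) (phiR phi) 0) P = - (2 * k).
    by rewrite /k (derive1n_dot dot_norm _ Ck)//; lra.
  rewrite !ler_norml kE => /andP[_ +] /andP[_ +].
  move: k0; set s1 := dot _ p; set s2 := dot _ P; lra.
- by move=> i; apply: contra_neq (yx i) => <-.
Qed.

End Certificate.

Lemma in_bigsetU (T : Type) (I : finType) (F : I -> set T) x :
  (\big[setU/set0]_(i : I) F i) x <-> exists i, F i x.
Proof.
rewrite -bigcup_seq; split=> [[i _ Fx]|[i Fx]]; exists i => //.
by rewrite /= mem_index_enum.
Qed.

(** * Optimality conditions *)

Section ChargeIntegral.
Context d (T : measurableType d) (R : realType).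
Implicit Types (m : {charge set T -> \bar R}) (f g : T -> R).

Definition bounded_mfun f :=
  measurable_fun setT f /\ exists B : R, forall x, `|f x| <= B.

Lemma bounded_mfun_integrable (mu : {finite_measure set T -> \bar R}) f :
  bounded_mfun f -> mu.-integrable setT (EFin \o f).
Proof.
move=> [mf [B fB]]; apply: measurable_bounded_integrable => //.
  by rewrite ltey_eq fin_num_measure.
exists B; split; first exact: num_real.
by move=> M BM x _; apply: (le_trans (fB x)); exact: ltW.
Qed.

Lemma bounded_mfun_cst (c : R) : bounded_mfun (fun=> c).
Proof. by split; [exact: measurable_cst|exists `|c|]. Qed.

Lemma bounded_mfunD f g :
  bounded_mfun f -> bounded_mfun g -> bounded_mfun (fun x => f x + g x).
Proof.
move=> [mf [B fB]] [mg [C gC]]; split; first exact: measurable_funD.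
by exists (B + C) => x; rewrite (le_trans (ler_normD _ _))// lerD.
Qed.

Lemma bounded_mfunZ (a : R) f :
  bounded_mfun f -> bounded_mfun (fun x => a * f x).
Proof.
move=> [mf [B fB]]; split; first exact: measurable_funM.
by exists (`|a| * B) => x; rewrite normrM ler_wpM2l.
Qed.

Lemma Rintegral_lin (mu : {finite_measure set T -> \bar R}) (a : R) f g :
  bounded_mfun f -> bounded_mfun g ->
  \int[mu]_x (a * f x + g x) = a * \int[mu]_x f x + \int[mu]_x g x.
Proof.
move=> bf bg; rewrite RintegralD//; last 2 first.
- exact/bounded_mfun_integrable/bounded_mfunZ.
- exact: bounded_mfun_integrable.
by rewrite RintegralZl//; exact: bounded_mfun_integrable.
Qed.

Lemma charge_int_lin m (a : R) f g :
  bounded_mfun f -> bounded_mfun g ->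
  charge_int m (fun x => a * f x + g x) = a * charge_int m f + charge_int m g.
Proof. by move=> bf bg; rewrite /charge_int !Rintegral_lin//; ring. Qed.

Lemma tv_normE m : tv_norm m =
  fine (jordan_pos (hahnP m) setT) + fine (jordan_neg (hahnP m) setT).
Proof.
by rewrite /tv_norm /Defs.variation /charge_variation/= fineD// fin_num_measure.
Qed.

Lemma Rintegral_cstT (mu : {finite_measure set T -> \bar R}) (c : R) :
  \int[mu]_x c = c * fine (mu setT).
Proof. by rewrite Rintegral_cst. Qed.

Lemma Rintegral_le (mu : {finite_measure set T -> \bar R}) f g :
  bounded_mfun f -> bounded_mfun g -> (forall x, f x <= g x) ->
  \int[mu]_x f x <= \int[mu]_x g x.
Proof.
by move=> bf bg fg; apply: le_Rintegral => //; exact: bounded_mfun_integrable.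
Qed.

Lemma charge_int_le m f (B : R) : measurable_fun setT f ->
  (forall x, `|f x| <= B) -> `|charge_int m f| <= B * tv_norm m.
Proof.
move=> mf fB; have bf : bounded_mfun f by split => //; exists B.
have bc (c : R) := bounded_mfun_cst c.
rewrite /charge_int tv_normE.
have fle x : f x <= B by rewrite (le_trans (ler_norm _)).
have fge x : - B <= f x by rewrite lerNl (le_trans (ler_norm _))// normrN.
have p1 := Rintegral_le (jordan_pos (hahnP m)) bf (bc B) fle.
have p2 := Rintegral_le (jordan_pos (hahnP m)) (bc (- B)) bf fge.
have n1 := Rintegral_le (jordan_neg (hahnP m)) bf (bc B) fle.
have n2 := Rintegral_le (jordan_neg (hahnP m)) (bc (- B)) bf fge.
move: p1 p2 n1 n2; rewrite !Rintegral_cstT !mulNr mulrDr ler_norml.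
set ip := \int[_]_x f x; set ineg := \int[_]_x f x.
set u := B * fine _; set v := B * fine _; lra.
Qed.

(** [msum] adds the first terms of a sequence indexed by the natural numbers; past n the terms are
    the zero measure. *)
Definition dirac_seq n (b : 'I_n -> R) (s : 'I_n -> T) (b0 : forall i, 0 <= b i)
    (k : nat) : {measure set T -> \bar R} :=
  if insub k is Some i then mscale (NngNum (b0 i)) \d_(s i) else mzero.

(** [charge_int] and [tv_norm] go through a Hahn decomposition of m. As m is nonnegative, its
    negative part vanishes and its positive part agrees with a finite sum of weighted Dirac
    measures. The measure is described by its values on measurable sets, so that the lemma applies
    to [spikes] and to an arbitrary minimiser alike. *)
Lemma charge_atomic n (b : 'I_n -> R) (s : 'I_n -> T) m :
  (forall i, 0 <= b i) ->
  (forall A : set T, measurable A ->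
     m A = (\sum_(i < n) (b i)%:E * \d_(s i) A)%E) ->
  [/\ forall f, bounded_mfun f -> charge_int m f = \sum_(i < n) b i * f (s i),
      tv_norm m = \sum_(i < n) b i &
      forall A : set T, measurable A -> Defs.variation m A = m A].
Proof.
move=> b0 mE.
have m0 (A : set T) : measurable A -> (0 <= m A)%E.
  move=> mA; rewrite mE//; apply: sume_ge0 => i _.
  by rewrite mule_ge0// lee_fin.
have [[mP _] [mN nN] _ _] := hahnP m.
have neg0 (A : set T) : measurable A -> jordan_neg (hahnP m) A = 0%E.
  move=> mA; apply/eqP; rewrite eq_le measure_ge0 andbT.
  rewrite jordan_negE cjordan_negE /crestr0 mem_set// /crestr oppe_le0.
  by apply: m0; exact: measurableI.
have posE (A : set T) : measurable A -> jordan_pos (hahnP m) A = m A.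
  move=> mA; rewrite [RHS](jordan_decomp (hahnP m) mA) /cadd/= /cscale/=.
  by rewrite neg0// mule0 adde0.
have posS (A : set T) : measurable A ->
    jordan_pos (hahnP m) A = msum (dirac_seq s b0) n A.
  move=> mA; rewrite posE// mE// /msum; apply: eq_bigr => i _.
  by rewrite /dirac_seq valK.
have intneg f : \int[jordan_neg (hahnP m)]_x f x = 0.
  rewrite /Rintegral (@eq_measure_integral _ _ _ _ (@mzero _ T R))//.
    by rewrite integral_measure_zero.
  by move=> A mA _; exact: neg0.
have int0 f : measurable_fun setT f -> (forall x, 0 <= f x) ->
    \int[jordan_pos (hahnP m)]_x f x = \sum_(i < n) b i * f (s i).
  move=> mf f0.
  have mfE : measurable_fun setT (EFin \o f) by exact/measurable_EFinP.
  rewrite /Rintegral (@eq_measure_integral _ _ _ _ (msum (dirac_seq s b0) n));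
    last first.
    by move=> A mA _; exact: posS.
  rewrite ge0_integral_measure_sum//; last by move=> x _; rewrite lee_fin.
  rewrite (eq_bigr (fun i : 'I_n => (b i * f (s i))%:E)) ?sumEFin//.
  move=> i _; rewrite /dirac_seq valK ge0_integral_mscale//; last first.
    by move=> x _; rewrite lee_fin.
  by rewrite integral_dirac//= diracT mul1e.
have tvE : tv_norm m = \sum_(i < n) b i.
  rewrite tv_normE neg0// addr0 posE// mE// (eq_bigr (fun i => (b i)%:E)).
    by rewrite sumEFin.
  by move=> i _; rewrite diracT mule1.
split => //; last first.
  by move=> A mA; rewrite /Defs.variation /charge_variation/= neg0// adde0 posE.
move=> f bf; have [mf [B fB]] := bf.
rewrite /charge_int intneg subr0.
(* The formula is known for nonnegative functions; it is applied to f + |B|, and the integral of the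
   constant is then removed. *)
have B0 : forall x, 0 <= f x + `|B|.
  move=> x; have := le_trans (fB x) (ler_norm B); rewrite ler_norml; lra.
have := int0 _ (bounded_mfunD bf (bounded_mfun_cst `|B|)).1 B0.
rewrite RintegralD//; last 2 first.
- exact: bounded_mfun_integrable.
- exact/bounded_mfun_integrable/bounded_mfun_cst.
have -> : \int[jordan_pos (hahnP m)]_x `|B| = `|B| * \sum_(i < n) b i.
  rewrite -tvE tv_normE neg0// addr0; exact: Rintegral_cstT.
rewrite mulr_sumr => /eqP; rewrite -subr_eq0 -addrA -sumrB.
rewrite addr_eq0 -sumrN => /eqP ->; apply: eq_bigr => i _; ring.
Qed.

Lemma Rintegral_eq0_negligible (mu : {finite_measure set T -> \bar R}) f :
  bounded_mfun f -> (forall x, 0 <= f x) -> \int[mu]_x f x = 0 ->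
  forall A, measurable A -> (forall x, A x -> f x != 0) -> mu A = 0%E.
Proof.
move=> bf f0 If A mA Af; have [mf _] := bf.
have mfE : measurable_fun setT (EFin \o f) by exact/measurable_EFinP.
have I0 : (\int[mu]_x `|(EFin \o f) x| = 0)%E.
  rewrite (eq_integral (EFin \o f)); last first.
    by move=> x _; rewrite gee0_abs// lee_fin.
  have fin := integrable_fin_num measurableT (bounded_mfun_integrable mu bf).
  by rewrite -[LHS]fineK//; congr (_%:E); rewrite -[RHS]If.
have /(ae_eq_integral_abs _ measurableT mfE)[N [mN N0 fN]] := I0.
apply: (subset_measure0 mA mN _ N0) => x Ax; apply: fN => /= /(_ I)[fx].
by have := Af x Ax; rewrite fx eqxx.
Qed.

(* If [m] is normed by [eta], then [eta] is [1] a.e. for the positive part of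
   [m] and [-1] a.e. for the negative one. *)
Lemma charge_extremal n (s : 'I_n -> T) m (eta : T -> R) :
  (forall i, measurable [set s i]) -> injective s ->
  measurable_fun setT eta -> (forall i, eta (s i) = 1) ->
  (forall x, (forall i, x <> s i) -> `|eta x| < 1) ->
  tv_norm m <= charge_int m eta ->
  exists2 b : 'I_n -> R, forall i, 0 <= b i &
    forall A : set T, measurable A ->
      m A = (\sum_(i < n) (b i)%:E * \d_(s i) A)%E.
Proof.
move=> ms injs meta eta1 etalt tvle.
have eta_le x : `|eta x| <= 1.
  have [[i ->]|xs] := pselect (exists i, x = s i); first by rewrite eta1 normr1.
  by apply/ltW/etalt => i xi; apply: xs; exists i.
have beta : bounded_mfun eta by split => //; exists 1.
have bm : bounded_mfun (fun x => 1 + (-1) * eta x).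
  by apply: bounded_mfunD; [exact: bounded_mfun_cst|exact: bounded_mfunZ].
have bp : bounded_mfun (fun x => 1 + 1 * eta x).
  by apply: bounded_mfunD; [exact: bounded_mfun_cst|exact: bounded_mfunZ].
have m0 x : 0 <= 1 + (-1) * eta x.
  by have := eta_le x; rewrite ler_norml; lra.
have p0 x : 0 <= 1 + 1 * eta x.
  by have := eta_le x; rewrite ler_norml; lra.
set pos := jordan_pos (hahnP m); set neg := jordan_neg (hahnP m).
have Im : 0 <= \int[pos]_x (1 + (-1) * eta x).
  by apply: Rintegral_ge0 => x _.
have Ip : 0 <= \int[neg]_x (1 + 1 * eta x).
  by apply: Rintegral_ge0 => x _.
have IE (mu : {finite_measure set T -> \bar R}) (c : R) :
    \int[mu]_x (1 + c * eta x) = fine (mu setT) + c * \int[mu]_x eta x.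
  rewrite RintegralD//; last 2 first.
  - exact/bounded_mfun_integrable/bounded_mfun_cst.
  - exact/bounded_mfun_integrable/bounded_mfunZ.
  rewrite Rintegral_cstT mul1r RintegralZl//.
  exact: bounded_mfun_integrable.
have ImE := IE pos (-1); have IpE := IE neg 1.
(* Both integrals are nonnegative, and their sum is [tv_norm m - charge_int m eta], at most 0. *)
have [Im0 Ip0] : \int[pos]_x (1 + (-1) * eta x) = 0 /\
    \int[neg]_x (1 + 1 * eta x) = 0.
  move: tvle Im Ip; rewrite tv_normE /charge_int ImE IpE -/pos -/neg.
  set a := fine _; set c := fine _; set u := Rintegral _ _ _.
  set v := Rintegral _ _ _ => tvle Im Ip; split; lra.
pose S := \big[setU/set0]_(i < n) [set s i].
have mS : measurable S by apply: bigsetU_measurable.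
have Sx x : ~ S x -> forall i, x <> s i.
  by move=> nS i xi; apply: nS; apply/in_bigsetU; exists i.
have posS : pos (~` S) = 0%E.
  apply: (Rintegral_eq0_negligible bm m0 Im0); first exact: measurableC.
  move=> x /Sx xs; have := etalt x xs; rewrite ltr_norml => /andP[_ e1].
  by rewrite gt_eqF// mulN1r subr_gt0.
(* The function 1 + eta vanishes nowhere: it is 2 at the points [s i] and positive elsewhere. *)
have neg0 : neg setT = 0%E.
  apply: (Rintegral_eq0_negligible bp p0 Ip0) => // x _.
  have [[i ->]|xs] := pselect (exists i, x = s i).
    by rewrite eta1 mul1r gt_eqF// addr_gt0.
  have := etalt x; rewrite ltr_norml => e1.
  have /andP[e2 _] : -1 < eta x < 1 by apply: e1 => i xi; apply: xs; exists i.
  by rewrite gt_eqF// mul1r -ltrBlDl sub0r.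
have b0 i : 0 <= fine (pos [set s i]) by rewrite fine_ge0.
exists (fun i => fine (pos [set s i])) => // A mA.
rewrite [LHS](jordan_decomp (hahnP m) mA) /cadd/= /cscale/= -/pos -/neg.
have -> : neg A = 0%E by apply: (subset_measure0 mA measurableT _ neg0).
rewrite mule0 adde0.
rewrite [LHS](_ : _ = pos (A `\` S) + pos (A `&` S))%E; last exact: measureDI.
have -> : pos (A `\` S) = 0%E.
  apply: (subset_measure0 _ (measurableC mS) _ posS).
    exact: measurableD.
  by move=> x [].
have -> : A `&` S = \big[setU/set0]_(i < n) (A `&` [set s i]).
  apply/seteqP; split=> x.
    by move=> [Ax /in_bigsetU[i xi]]; apply/in_bigsetU; exists i.
  by move=> /in_bigsetU[i [Ax xi]]; split => //; apply/in_bigsetU; exists i.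
rewrite add0e [LHS](_ : _ = \sum_(i < n) pos (A `&` [set s i]))%E; last first.
apply: measure_bigsetU_ord.
- by move=> i; exact: measurableI.
- by move=> i j _ _ [x [[_ ->] [_ /injs]]].
apply: eq_bigr => i _; rewrite diracE;
  case: (boolP (s i \in A)) => [/set_mem|] sA.
  rewrite mule1 fineK ?fin_num_measure//; congr (pos _).
  by apply/seteqP; split=> x [] // ->.
rewrite mule0 (_ : A `&` _ = set0) ?measure0//.
by rewrite -subset0 => x [Ax xs]; move/negP: sA; apply; rewrite -xs;
  exact/mem_set.
Qed.

End ChargeIntegral.

Section BorelDomain.
Context (R : realType) (X : domain).

Lemma borel_continuous (f : carrier R X -> R) : continuous f ->
  measurable_fun setT (f : borel R X -> R).
Proof.
move=> /continuousP cf.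
apply: (measurability _ (RGenOInfty.measurableE R)) => _ [_ [x ->] <-].
by rewrite setTI; apply: sub_sigma_algebra; apply: cf; exact: interval_open.
Qed.

Lemma closed_measurable (A : set (carrier R X)) : closed A ->
  measurable (A : set (borel R X)).
Proof.
move=> cA; rewrite -[A]setCK; apply: measurableC.
by apply: sub_sigma_algebra; exact: closed_openC.
Qed.

(** On the torus, openness of the complement is openness of its preimage: if s - r is not an
    integer, it lies strictly between two consecutive ones, and so does u - r for u close to s. *)
Lemma closed_cls (r : R) : closed [set cls X r].
Proof.
rewrite -[[set _]]setCK; apply: open_closedC; case: X => /=.
  apply: closed_openC; apply: compact_closed; last exact: compact_set1.
  exact: Rhausdorff.
change (open [set s : R | to_torus s <> to_torus r]).
rewrite openE => s /= sr; apply/nbhs_ballP.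
have srZ : s - r \isn't a Num.int by apply/negP => /to_torus_eq.
pose k : R := (Num.floor (s - r))%:~R.
have ks : k < s - r.
  rewrite lt_neqAle ge_floor andbT; apply: contraNneq srZ => <-.
  exact: intr_int.
have sk : s - r < k + 1 by have := floorD1_gt (s - r); rewrite intrD.
exists (Num.min (s - r - k) (k + 1 - (s - r))) => /=.
  by rewrite lt_min !subr_gt0 ks.
move=> u; rewrite -ball_normE/= lt_min => /andP[u1 u2] /to_torus_eq/intrP[j uj].
have k1 : k < j%:~R.
  by rewrite -uj; move: u1; rewrite ltr_norml; lra.
have k2 : j%:~R < k + 1.
  by rewrite -uj; move: u2; rewrite ltr_norml; lra.
move: k1 k2; rewrite /k ltr_int -[1]/(1%:~R) -intrD ltr_int.
by rewrite ltzD1 => /lt_le_trans /[apply]; rewrite ltxx.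
Qed.

End BorelDomain.

Section Optimality.
Context (R : realType) (H : completeNormedModType R) (dot : {dot H for idfun}).
Hypothesis dot_norm : forall x : H, dot x x = `|x| ^+ 2.
Context (X : domain) (phi : carrier R X -> H) (k : nat).
Hypothesis phiK : KER dot phi k.

Lemma dot_phi_bounded p :
  bounded_mfun (fun x : borel R X => dot (phi x) p).
Proof.
have [B _ phiB] := KER_bounded phiK.
split.
  apply: borel_continuous => x; have [L LE] := dot_clin dot_norm p.
  rewrite (_ : (fun _ => _) = fun x => L (phi x)); last by apply/funext => y.
  apply: continuous_comp; last exact: clin_continuous.
  exact: (KER_continuous phiK).
exists (B * `|p|) => x.
by rewrite (le_trans (dot_le dot_norm _ _))// ler_wpM2r// phiB.
Qed.

(** The integral of <phi, p> is bounded linearly in p, so Riesz representation shows that the set in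
    the definition of [Phi] is inhabited and [xget] picks one of its elements. *)
Lemma Phi_dot (m : {charge set (borel R X) -> \bar R}) p :
  dot (Phi dot phi m) p = charge_int m (fun x => dot (phi x) p).
Proof.
pose L p := charge_int m (fun x : borel R X => dot (phi x) p).
have lL a q r : L (a *: q + r) = a * L q + L r.
  rewrite /L -charge_int_lin; [|exact: dot_phi_bounded..].
  by congr charge_int; apply/funext => x; rewrite dotDr dotZr.
have [B _ phiB] := KER_bounded phiK.
have bL q : `|L q| <= B * tv_norm m * `|q|.
  rewrite mulrAC; apply: charge_int_le; first by have [] := dot_phi_bounded q.
  by move=> x; rewrite (le_trans (dot_le dot_norm _ _))// ler_wpM2r// phiB.
have [h hP] := riesz dot_norm lL bL.
have := @xgetPex _ (0 : H) [set h | forall p, dot h p =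
   charge_int m (fun x => dot (phi x) p)].
by apply; exists h.
Qed.

Lemma Phi_atomic n (b : 'I_n -> R) (z : 'I_n -> R)
  (m : {charge set (borel R X) -> \bar R}) :
  (forall i, 0 <= b i) ->
  (forall A : set (borel R X), measurable A ->
     m A = (\sum_(i < n) (b i)%:E * \d_((cls X (z i) : borel R X)) A)%E) ->
  Phi dot phi m = \sum_(i < n) b i *: phiR phi (z i).
Proof.
move=> b0 mE; apply: (dot_inj dot_norm) => p; rewrite Phi_dot.
have [cE _ _] := charge_atomic b0 mE.
rewrite (cE _ (dot_phi_bounded p)) dot_suml.
by apply: eq_bigr => i _; rewrite dotZl.
Qed.

Lemma spikesE n (a z : 'rV[R]_n) (A : set (borel R X)) :
  spikes X a z A = (\sum_(i < n) (a 0%R i)%:E * \d_(cls X (z 0%R i) : borel R X)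
    A)%E.
Proof. exact: dirac_sumE. Qed.

Lemma Phi_spikes n (a z : 'rV[R]_n) : (forall i, 0 <= a 0 i) ->
  Phi dot phi (spikes X a z) = \sum_(i < n) a 0 i *: phiR phi (z 0 i).
Proof.
move=> a0.
by apply: (@Phi_atomic n (fun i => a 0 i) (fun i => z 0 i)) => // A _;
  exact: spikesE.
Qed.

Lemma tv_norm_spikes n (a z : 'rV[R]_n) : (forall i, 0 <= a 0 i) ->
  tv_norm (spikes X a z) = \sum_(i < n) a 0 i.
Proof.
move=> a0; have [_ tE _] := @charge_atomic _ (borel R X) R n (fun i => a 0 i)
  (fun i => cls X (z 0 i)) (spikes X a z) a0 (fun A _ => spikesE a z A).
exact: tE.
Qed.

Lemma radon_spikes n (a z : 'rV[R]_n) : (forall i, 0 <= a 0 i) ->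
  radon (spikes X a z).
Proof.
move=> a0 A mA e e0.
pose S := \big[setU/set0]_(i < n) [set (cls X (z 0 i) : borel R X)].
have mS : measurable S.
  by apply: bigsetU_measurable => i _; apply: closed_measurable;
    exact: closed_cls.
exists (A `&` S); split => //.
- apply: finite_compact; apply: finite_setIr; rewrite /S.
  by rewrite -bigcup_seq; apply: bigcup_finite => // i _; exact: finite_set1.
- exact: measurableI.
- have mD : measurable (A `\` (A `&` S)).
    by apply: measurableD => //; exact: measurableI.
  have [_ _ vE] := @charge_atomic _ (borel R X) R n (fun i => a 0 i)
    (fun i => cls X (z 0 i)) (spikes X a z) a0 (fun A _ => spikesE a z A).
  rewrite vE// spikesE big1 ?lte_fin// => i _.
  rewrite diracE memNset ?mule0// => -[Az] []; split => //.
  by apply/in_bigsetU; exists i.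
Qed.

(** Let v be the image of the spikes. As lam p = y - v, the objective at m exceeds that at the
    spikes by |Phi m - v|^2 / 2 + lam (|m| - <Phi m, p>), a sum of two nonnegative terms. Another
    minimiser annuls both: the second confines it to the spikes with nonnegative masses, and the
    first, with the hypothesis on the coefficients, fixes these masses. *)
Lemma spikes_unique_solution n (a z : 'rV[R]_n) (lam : R) (y : H) :
  let p := lam^-1 *: (y - \sum_(i < n) a 0 i *: phiR phi (z 0 i)) in
  0 < lam -> (forall i, 0 < a 0 i) -> injective (fun i => cls X (z 0 i)) ->
  (forall i, dot (phiR phi (z 0 i)) p = 1) ->
  (forall x, (forall i, x != cls X (z 0 i)) -> `|dot (phi x) p| < 1) ->
  (forall b : 'I_n -> R, \sum_(i < n) b i *: phiR phi (z 0 i) =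
     \sum_(i < n) a 0 i *: phiR phi (z 0 i) -> forall i, b i = a 0 i) ->
  blasso_solution dot phi lam y (spikes X a z) /\
  forall m, blasso_solution dot phi lam y m -> same_charge m (spikes X a z).
Proof.
move=> p lam0 agt0 injz p1 plt free.
have a0 i : 0 <= a 0 i by exact: ltW.
pose v := \sum_(i < n) a 0 i *: phiR phi (z 0 i).
have vp : dot v p = \sum_(i < n) a 0 i.
  by rewrite dot_suml; apply: eq_bigr => i _; rewrite dotZl p1 mulr1.
have ple x : `|dot (phi x) p| <= 1.
  have [[i ->]|xz] := pselect (exists i, x = cls X (z 0 i)).
    by rewrite -/(phiR phi (z 0 i)) p1 normr1.
  by apply/ltW/plt => i; apply/eqP => xi; apply: xz; exists i.
have up m : dot (Phi dot phi m) p <= tv_norm m.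
  rewrite Phi_dot -[leRHS]mul1r (le_trans (ler_norm _))//.
  by apply: charge_int_le => //; have [] := dot_phi_bounded p.
have E m : blasso dot phi lam y m = blasso dot phi lam y (spikes X a z) +
    (2^-1 * `|Phi dot phi m - v| ^+ 2 +
     lam * (tv_norm m - dot (Phi dot phi m) p)).
  rewrite /blasso Phi_spikes// -/v tv_norm_spikes//; set u := Phi dot phi m.
  have -> : u - y = (u - v) + (v - y) by rewrite addrA subrK.
  have vy : v - y = - (lam *: p).
    by rewrite /p -/v scalerA mulfV ?gt_eqF// scale1r opprB.
  rewrite (normD_dot dot_norm (u - v)) vy dotNr dotZr dotBl vp.
  by field.
have ge0 m : 0 <= 2^-1 * `|Phi dot phi m - v| ^+ 2 /\
    0 <= lam * (tv_norm m - dot (Phi dot phi m) p).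
  split; first by rewrite mulr_ge0// exprn_ge0.
  by rewrite mulr_ge0 ?subr_ge0// ltW.
split.
  split; first exact: radon_spikes.
  by move=> m _; rewrite (E m) lerDl; have [? ?] := ge0 m; exact: addr_ge0.
move=> m [_ /(_ _ (radon_spikes z a0))]; rewrite (E m) gerDl => le0.
have [ge1 ge2] := ge0 m.
have e1 : 2^-1 * `|Phi dot phi m - v| ^+ 2 = 0.
  by apply/le_anti; rewrite ge1 andbT (le_trans _ le0)// lerDl.
have e2 : lam * (tv_norm m - dot (Phi dot phi m) p) = 0.
  by apply/le_anti; rewrite ge2 andbT (le_trans _ le0)// lerDr.
have uv : Phi dot phi m = v.
  apply/eqP; rewrite -subr_eq0 -normr_eq0 -sqrf_eq0; move/eqP: e1.
  by rewrite mulf_eq0 invr_eq0 pnatr_eq0.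
have tvE : tv_norm m <= charge_int m (fun x => dot (phi x) p).
  rewrite -Phi_dot; move/eqP: e2; rewrite mulf_eq0 gt_eqF//= subr_eq0.
  by move=> /eqP ->.
have [b b0 mE] : exists2 b : 'I_n -> R, forall i, 0 <= b i &
    forall A : set (borel R X), measurable A ->
      m A = (\sum_(i < n) (b i)%:E * \d_(cls X (z 0%R i) : borel R X) A)%E.
  apply: (@charge_extremal _ (borel R X) R n
    (fun i => cls X (z 0%R i)) m (fun x => dot (phi x) p)) => //.
  - by move=> i; apply: closed_measurable; exact: closed_cls.
  - by have [] := dot_phi_bounded p.
  - by move=> x xz; apply: plt => i; apply/eqP; exact: xz.
have ba := free b; rewrite -(Phi_atomic b0 mE) in ba.
move=> A mA; rewrite mE// spikesE; apply: eq_bigr => i _.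
by rewrite ba.
Qed.

End Optimality.

(** * Families with uniform Lipschitz bounds *)

Section UniformlyLipschitz.
Context (R : realType) (V : normedModType R) (T : Type).
Implicit Types (W X : normedModType R) (P : set T) (D : set V).

(* [ubl] stands for: uniformly bounded and Lipschitz. *)
Definition ubl W P D (f : T -> V -> W) := exists2 K : R, 0 < K &
  forall t, P t -> forall x, D x -> `|f t x| <= K /\
    forall y, D y -> `|f t x - f t y| <= K * `|x - y|.

Lemma ubl_sub W P D P' D' (f : T -> V -> W) : P' `<=` P -> D' `<=` D ->
  ubl P D f -> ubl P' D' f.
Proof.
move=> PP DD [K K0 fK]; exists K => // t Pt x Dx.
have [f1 f2] := fK t (PP t Pt) x (DD x Dx); split=> // y Dy.
by apply: f2; exact: DD.
Qed.

Lemma eq_ubl W P D (f g : T -> V -> W) : (forall t x, f t x = g t x) ->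
  ubl P D f -> ubl P D g.
Proof.
by move=> fg; rewrite (_ : g = f)//; apply/funext => t; apply/funext.
Qed.

Lemma ubl_cst W P D (c : T -> W) (K : R) : (forall t, P t -> `|c t| <= K) ->
  ubl P D (fun t _ => c t).
Proof.
move=> cK; exists (`|K| + 1) => [|t Pt x Dx]; first exact: ltr_wpDl.
split=> [|y _].
  by rewrite (le_trans (cK t Pt))// (le_trans (ler_norm _))// lerDl.
by rewrite subrr normr0 mulr_ge0// addr_ge0.
Qed.

Lemma ublD W P D (f g : T -> V -> W) : ubl P D f -> ubl P D g ->
  ubl P D (fun t x => f t x + g t x).
Proof.
move=> [K K0 fK] [L L0 gL]; exists (K + L); first exact: addr_gt0.
move=> t Pt x Dx; have [f1 f2] := fK t Pt x Dx.
have [g1 g2] := gL t Pt x Dx; split=> [|y Dy].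
  exact: le_trans (ler_normD _ _) (lerD f1 g1).
rewrite opprD addrACA mulrDl.
exact: le_trans (ler_normD _ _) (lerD (f2 y Dy) (g2 y Dy)).
Qed.

Lemma ubl_sum W P D (I : finType) (f : I -> T -> V -> W) :
  (forall i, ubl P D (f i)) -> ubl P D (fun t x => \sum_i f i t x).
Proof.
move=> fP; elim: (index_enum I) => [|i s ih].
  apply: (eq_ubl (f := fun _ _ => 0)) => [t x|]; first by rewrite big_nil.
  by apply: (@ubl_cst _ _ _ _ 0) => t _; rewrite normr0.
apply: (eq_ubl (f := fun t x => f i t x + \sum_(j <- s) f j t x)).
  by move=> t x; rewrite big_cons.
exact: ublD.
Qed.

Lemma ubl_bilinear W X (Y : normedModType R) (b : W -> X -> Y) P D
    (f : T -> V -> W) (g : T -> V -> X) :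
  bounded_bilinear b -> ubl P D f -> ubl P D g ->
  ubl P D (fun t x => b (f t x) (g t x)).
Proof.
move=> bb [K K0 fK] [L L0 gL]; have [M M0 bM] := bbilin_bound bb.
have MKL : 0 < M * K * L by rewrite !mulr_gt0.
exists (M * K * L + M * K * L); first exact: addr_gt0.
have bB u v A B : `|u| <= A -> `|v| <= B -> `|b u v| <= M * A * B.
  move=> uA vB; apply: (le_trans (bM u v)).
  by apply: ler_pM => //; [rewrite mulr_ge0// ltW|rewrite ler_pM2l].
move=> t Pt x Dx; have [f1 f2] := fK t Pt x Dx.
have [g1 g2] := gL t Pt x Dx; split=> [|y Dy].
  by apply: (le_trans (bB _ _ _ _ f1 g1)); rewrite lerDl ltW.
have [h1 _] := fK t Pt y Dy.
have -> : b (f t x) (g t x) - b (f t y) (g t y) =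
    b (f t x - f t y) (g t x) + b (f t y) (g t x - g t y).
  by rewrite (bbilinDl bb) (bbilinDr bb) (bbilinNl bb) (bbilinNr bb) addrA
    subrK.
rewrite mulrDl; apply: (le_trans (ler_normD _ _)); apply: lerD.
  apply: (le_trans (bB _ _ _ _ (f2 y Dy) g1)).
  by rewrite mulrA mulrAC.
apply: (le_trans (bB _ _ _ _ h1 (g2 y Dy))).
by rewrite mulrA.
Qed.

Lemma ubl_scale W P D (f : T -> V -> R) (g : T -> V -> W) :
  ubl P D f -> ubl P D g -> ubl P D (fun t x => f t x *: g t x).
Proof. exact: ubl_bilinear (@scale_bilinear R W). Qed.

Lemma ublM P D (f g : T -> V -> R) :
  ubl P D f -> ubl P D g -> ubl P D (fun t x => f t x * g t x).
Proof. exact: ubl_bilinear (@mul_bilinear R). Qed.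

Lemma ublN W P D (f : T -> V -> W) :
  ubl P D f -> ubl P D (fun t x => - f t x).
Proof.
move=> [K K0 fK]; exists K => // t Pt x Dx; have [f1 f2] := fK t Pt x Dx.
split=> [|y Dy]; first by rewrite normrN.
by rewrite -opprD normrN; exact: f2.
Qed.

Lemma ublB W P D (f g : T -> V -> W) : ubl P D f -> ubl P D g ->
  ubl P D (fun t x => f t x - g t x).
Proof. by move=> fP gP; apply: ublD => //; exact: ublN. Qed.

Lemma ubl_prod P D (I : finType) (f : I -> T -> V -> R) :
  (forall i, ubl P D (f i)) -> ubl P D (fun t x => \prod_i f i t x).
Proof.
move=> fP; elim: (index_enum I) => [|i s ih].
  apply: (eq_ubl (f := fun _ _ => 1 : R)) => [t x|]; first by rewrite big_nil.
  by apply: (@ubl_cst _ _ _ _ 1) => t _; rewrite normr1.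
apply: (eq_ubl (f := fun t x => f i t x * \prod_(j <- s) f j t x)).
  by move=> t x; rewrite big_cons.
exact: ublM.
Qed.

Lemma ublX P D (f : T -> V -> R) k :
  ubl P D f -> ubl P D (fun t x => f t x ^+ k).
Proof.
move=> fP; apply: (eq_ubl (f := fun t x => \prod_(i < k) f t x)).
  by move=> t x; rewrite prodr_const card_ord.
exact: ubl_prod.
Qed.

Lemma ubl_det P D n (A : T -> V -> 'M[R]_n) :
  (forall i j, ubl P D (fun t x => A t x i j)) ->
  ubl P D (fun t x => \det (A t x)).
Proof.
move=> AP; apply: ubl_sum => s; apply: ublM; last exact: ubl_prod.
by apply: (@ubl_cst _ _ _ _ 1) => t _; rewrite normrX normrN1 expr1n.
Qed.

Lemma ublV P D (f : T -> V -> R) (c : R) : 0 < c ->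
  (forall t, P t -> forall x, D x -> c <= `|f t x|) ->
  ubl P D f -> ubl P D (fun t x => (f t x)^-1).
Proof.
move=> c0 cf [K K0 fK].
have f0 t x : P t -> D x -> f t x != 0.
  by move=> Pt Dx; rewrite -normr_gt0 (lt_le_trans c0)// cf.
have fV t x : P t -> D x -> `|(f t x)^-1| <= c^-1.
  move=> Pt Dx; rewrite normfV lef_pV2 ?posrE// ?cf//.
  by rewrite normr_gt0 f0.
exists (c^-1 + K * (c^-1 * c^-1)).
  by rewrite addr_gt0 ?mulr_gt0 ?invr_gt0.
move=> t Pt x Dx; split=> [|y Dy].
  apply: (le_trans (fV t x Pt Dx)); rewrite lerDl ltW//.
  by rewrite !mulr_gt0 ?invr_gt0.
have -> : (f t x)^-1 - (f t y)^-1 = (f t y - f t x) * ((f t x)^-1 * (f t y)^-1).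
  by field; rewrite !f0.
rewrite normrM normrM distrC.
have [_ /(_ y Dy) fxy] := fK t Pt x Dx.
have cc : 0 <= c^-1 by rewrite invr_ge0 ltW.
have p1 : `|(f t x)^-1| * `|(f t y)^-1| <= c^-1 * c^-1.
  by apply: ler_pM => //; exact: fV.
apply: (@le_trans _ _ (K * `|x - y| * (c^-1 * c^-1))).
  by apply: ler_pM => //; rewrite mulr_ge0.
by rewrite mulrAC ler_wpM2r// lerDr.
Qed.

Lemma ubl_invmx P D n (A : T -> V -> 'M[R]_n) (c : R) i j : 0 < c ->
  (forall t, P t -> forall x, D x -> c <= `|\det (A t x)|) ->
  (forall i j, ubl P D (fun t x => A t x i j)) ->
  ubl P D (fun t x => invmx (A t x) i j).
Proof.
move=> c0 cA AP.
have [K K0 KP] : ubl P D (fun t x => (\det (A t x))^-1 *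
   ((-1) ^+ (j + i) * \det (row' j (col' i (A t x))))).
  apply: ublM; first by apply: (ublV c0) => //; exact: ubl_det.
  apply: ublM.
    by apply: (@ubl_cst _ _ _ _ 1) => t _; rewrite normrX normrN1 expr1n.
  apply: ubl_det => i' j'.
  apply: (eq_ubl (f := fun t x => A t x (lift j i') (lift i j'))) => // t x.
  by rewrite !mxE.
have E t x : P t -> D x -> invmx (A t x) i j = (\det (A t x))^-1 *
   ((-1) ^+ (j + i) * \det (row' j (col' i (A t x)))).
  move=> Pt Dx; rewrite /invmx unitmxE unitfE -normr_gt0.
  by rewrite (lt_le_trans c0) ?cA// !mxE.
exists K => // t Pt x Dx; rewrite E//; have [K1 K2] := KP t Pt x Dx.
by split=> // y Dy; rewrite E//; exact: K2.
Qed.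

Lemma ubl_curve W P D (f : T -> V -> R) (c : T -> R -> W) (Z B : R) :
  (forall t, P t -> forall x, D x -> `|f t x| <= Z) ->
  (forall t, P t -> forall s, `|s| <= Z -> `|c t s| <= B) ->
  (forall t, P t -> forall s r, `|s| <= Z -> `|r| <= Z ->
     `|c t s - c t r| <= B * `|s - r|) ->
  ubl P D f -> ubl P D (fun t x => c t (f t x)).
Proof.
move=> fZ cB cL [K K0 fK]; exists (`|B| + `|B| * K + 1).
  by rewrite ltr_wpDl// addr_ge0// mulr_ge0// ltW.
move=> t Pt x Dx; split=> [|y Dy].
  apply: (le_trans (cB t Pt _ (fZ t Pt x Dx))).
  apply: (le_trans (ler_norm _)); rewrite -addrA lerDl addr_ge0//.
  by rewrite mulr_ge0// ltW.
apply: (le_trans (cL t Pt _ _ (fZ t Pt x Dx) (fZ t Pt y Dy))).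
have [_ /(_ y Dy) fxy] := fK t Pt x Dx.
apply: (@le_trans _ _ (`|B| * (K * `|x - y|))).
  apply: (@le_trans _ _ (`|B| * `|f t x - f t y|)).
    by rewrite ler_wpM2r// ler_norm.
  by rewrite ler_wpM2l.
rewrite mulrA ler_wpM2r// addrAC lerDr addr_ge0//.
Qed.

(** The radius c / (2 K) involves only the common Lipschitz constant K, hence is the same for all
    t. *)
Lemma ubl_away P (x0 : V) (f : T -> V -> R) (D : set V) (c : R) :
  0 < c -> ubl P D f -> D x0 -> (forall t, P t -> c <= `|f t x0|) ->
  exists2 d : R, 0 < d & forall t, P t -> forall x, D x -> `|x - x0| <= d ->
    c / 2 <= `|f t x|.
Proof.
move=> c0 [K K0 fK] Dx0 fc; exists (c / 2 / K) => [|t Pt x Dx xd].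
  by rewrite !divr_gt0.
have [_ /(_ x0 Dx0) fxx] := fK t Pt x Dx.
have : `|f t x - f t x0| <= c / 2.
  by rewrite (le_trans fxx)// mulrC -ler_pdivlMr.
have := fc t Pt; have := lerB_dist (f t x0) (f t x0 - f t x).
rewrite subKr [`|f t x0 - _|]distrC.
set p := `|f t x0|; set q := `|f t x - f t x0|; set r := `|f t x|; lra.
Qed.

End UniformlyLipschitz.

(** * Fixed points of contractions of a ball *)

Section FixedPoint.
Context (R : realType).

Lemma complete_ball_fixed_point (C : completeNormedModType R) (x0 : C) (e : R)
    (T : C -> C) :
  0 <= e -> (forall x, `|x - x0| <= e -> `|T x - x0| <= e) ->
  (forall x y, `|x - x0| <= e -> `|y - x0| <= e ->
    `|T x - T y| <= 2^-1 * `|x - y|) ->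
  exists2 x, `|x - x0| <= e & T x = x.
Proof.
move=> e0 Te Tl.
pose U : set C := [set x | `|x - x0| <= e].
have TU : set_fun U U T by move=> x; exact: Te.
pose fM := isFun.Build _ _ U U T TU.
pose f : {fun U >-> U} := HB.pack T fM.
have cf : is_contraction f.
  exists (2^-1)%:nng; split=> /=; first by rewrite invf_lt1// ltr1n.
  by move=> [x y] [/= Ux Uy]; exact: Tl.
have cU : closed U.
  rewrite (_ : U = (fun x => `|x - x0|) @^-1` [set y | y <= e])//.
  apply: closed_comp => [x _|]; last exact: closed_le.
  apply: (@continuous_comp _ _ _ (fun x => x - x0) Num.norm).
    by apply: continuousB => //; exact: cst_continuous.
  exact: norm_continuous.
have [|x Ux fx] := @banach_fixed_point R C U f cf cU.
  by exists x0; rewrite /U /= subrr normr0.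
by exists x.
Qed.

Lemma ball_fixed_point n (x0 : 'rV[R]_n) (e : R) (T : 'rV[R]_n -> 'rV[R]_n) :
  0 <= e -> (forall x : 'rV[R]_n, `|x - x0| <= e -> `|T x - x0| <= e) ->
  (forall x y : 'rV[R]_n, `|x - x0| <= e -> `|y - x0| <= e ->
    `|T x - T y| <= 2^-1 * `|x - y|) ->
  exists2 x : 'rV[R]_n, `|x - x0| <= e & T x = x.
Proof.
pose C : completeNormedModType R :=
  HB.pack 'rV[R]_n (Complete.on 'rV[R]_n) (NormedModule.on 'rV[R]_n).
exact: (@complete_ball_fixed_point C).
Qed.

End FixedPoint.

(** * Confluent Vandermonde matrices *)

Section ConfluentVandermonde.
Context (R : realType) (N : nat).
Implicit Types z : 'I_N -> R.

Definition confluent z : 'M[R]_(N + N) := \matrix_(k, l)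
  match fintype.split l with inl i => z i ^+ k | inr i => z i ^+ k.-1 *+ k end.

(* [x ^+ k - y ^+ k = (x - y) * divdiff y x k] *)
Definition divdiff (y x : R) k := \sum_(j < k) x ^+ (k.-1 - j) * y ^+ j.

(* Between the Vandermonde matrices at two configurations: it maps
   [(a - b, a * (z - y))] to the increments [a * z ^+ k - b * y ^+ k] of the
   moments; for [z = y] it is [confluent z]. *)
Definition semiconfluent (y z : 'I_N -> R) : 'M[R]_(N + N) := \matrix_(k, l)
  match fintype.split l with inl i => y i ^+ k | inr i =>
    divdiff (y i) (z i) k end.

Lemma split_lshiftE i : fintype.split (lshift N i : 'I_(N + N)) = inl i.
Proof. exact: (unsplitK (inl i)). Qed.

Lemma split_rshiftE i : fintype.split (rshift N i : 'I_(N + N)) = inr i.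
Proof. exact: (unsplitK (inr i)). Qed.

Lemma divdiffxx x k : divdiff x x k = x ^+ k.-1 *+ k.
Proof.
rewrite /divdiff (eq_bigr (fun=> x ^+ k.-1)) ?sumr_const ?card_ord//.
by case: k => [[]//|k] j _; rewrite -exprD subnK// -ltnS.
Qed.

Lemma semiconfluentE z : semiconfluent z z = confluent z.
Proof.
by apply/matrixP => k l; rewrite !mxE; case: fintype.split => // i;
  exact: divdiffxx.
Qed.

(** A vector of the left kernel is the list of coefficients of a polynomial of degree less than 2N
    with a double root at each of the N distinct points [z i], hence zero. *)
Lemma confluent_unitmx z : injective z -> confluent z \in unitmx.
Proof.
move=> injz; rewrite -row_free_unit -kermx_eq0; apply/eqP/row_matrixP => r.
rewrite row0; set c := row r _.
have cV : c *m confluent z = 0 by apply/sub_kermxP; exact: row_sub.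
pose p := rVpoly c.
have pS : p = \sum_(k < N + N) c 0 k *: 'X^k.
  by rewrite /p /rVpoly poly_def; apply: eq_bigr => k _; rewrite valK.
have pE x : p.[x] = \sum_(k < N + N) c 0 k * x ^+ k.
  by rewrite pS horner_sum; apply: eq_bigr => k _; rewrite hornerZ hornerXn.
have dpE x : p^`().[x] = \sum_(k < N + N) c 0 k * (x ^+ k.-1 *+ k).
  rewrite pS linear_sum horner_sum; apply: eq_bigr => k _.
  by rewrite linearZ/= derivXn hornerZ hornerMn hornerXn.
have p0 i : root p (z i).
  rewrite rootE pE; apply/eqP.
  have := congr1 (fun A : 'rV_(N + N) => A 0 (lshift N i)) cV.
  rewrite !mxE => h; rewrite -[RHS]h.
  by apply: eq_bigr => k _; rewrite !mxE split_lshiftE.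
have dp0 i : p^`().[z i] = 0.
  rewrite dpE; have := congr1 (fun A : 'rV_(N + N) => A 0 (rshift N i)) cV.
  rewrite !mxE => h; rewrite -[RHS]h.
  by apply: eq_bigr => k _; rewrite !mxE split_rshiftE.
pose rs := [seq z i | i <- enum 'I_N].
have urs : uniq_roots rs.
  by rewrite uniq_rootsE map_inj_uniq// enum_uniq.
pose q := \prod_(x <- rs) ('X - x%:P).
have rsP (P : pred R) : (forall i, P (z i)) -> all P rs.
  by move=> Pz; apply/allP => _ /mapP[i _ ->].
have [p1 pq] : {p1 | p = p1 * q}.
  by apply: sig_eqW; apply: uniq_roots_prod_XsubC => //; exact: rsP.
have sq : separable_poly q by rewrite separable_prod_XsubC -uniq_rootsE.
(* As q is separable, q' does not vanish at z i, so p'(z i) = p1(z i) q'(z i) = 0 makes z i a root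
   of p1. *)
have [p2 p1q] : {p2 | p1 = p2 * q}.
  apply: sig_eqW; apply: uniq_roots_prod_XsubC => //; apply: rsP => i.
  have qz : root q (z i) by rewrite root_prod_XsubC map_f ?mem_enum.
  have := dp0 i; rewrite pq derivM hornerD !hornerM (eqP qz) mulr0 add0r.
  move=> /eqP; rewrite mulf_eq0 => /orP[//|].
  by have := sq; rewrite unlock => /coprimep_root/(_ qz)/negPf ->.
have p00 : p = 0.
  apply/eqP; apply: contraT => pn0.
  have mq : q \is monic by exact: monic_prod_XsubC.
  have p2n0 : p2 != 0 by apply: contraNneq pn0 => p20;
    rewrite pq p1q p20 !mul0r.
  have : (size p <= N + N)%N by exact: size_poly.
  rewrite pq p1q (size_Mmonic (mulf_neq0 p2n0 (monic_neq0 mq)) mq).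
  rewrite (size_Mmonic p2n0 mq).
  rewrite size_prod_XsubC size_map size_enum_ord addnS/= addnS/= -addnA.
  rewrite leqNgt -{1}[(N + N)%N]add0n ltn_add2r lt0n size_poly_eq0.
  by rewrite p2n0.
by rewrite -[LHS]rVpolyK -/p p00 linear0.
Qed.

End ConfluentVandermonde.

Lemma sum_shift (V : nmodType) m (g : nat -> V) : (0 < m)%N -> g 0%N = 0 ->
  \sum_(k < m) g k = \sum_(k < m.-1) g k.+1.
Proof. by case: m => // m _ g0; rewrite big_ord_recl g0 add0r. Qed.

(** * Taylor expansion of the atoms *)

Section TaylorSystem.
Context (R : realType) (H : completeNormedModType R) (dot : {dot H for idfun}).
Hypothesis dot_norm : forall x : H, dot x x = `|x| ^+ 2.
Context (N : nat) (f : R -> H).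
Hypothesis N0 : (0 < N)%N.
Hypothesis Cf : class_C (N + N).+1 f.
Local Notation n := (N + N)%N.
Local Notation f' := (f^`()%classic).
Local Notation f_ k := (derive1n k f 0).
Implicit Types (z : 'I_N -> R) (t : R) (l : 'I_(N + N)).

(** For the second kind of index this is the derivative of f (t z_i) in z_i, with its factor t.
    Thanks to this factor both kinds expand with coefficients t^k / k! times a column of
    [confluent], and the remainder of f', of one order less, also gets t^n in [atomE]. *)
Definition atom t z l : H :=
  match fintype.split l with inl i => f (t * z i) | inr i =>
    t *: f' (t * z i) end.

Definition atom_rem t z l : H :=
  match fintype.split l with
  | inl i => t ^- n *: taylor_rem n f (t * z i)
  | inr i => t ^- n.-1 *: taylor_rem n.-1 f' (t * z i)
  end.

Lemma taylorE m (g : R -> H) x :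
  g x = \sum_(k < m) (x ^+ k / k`!%:R) *: derive1n k g 0 + taylor_rem m g x.
Proof. by rewrite /taylor_rem addrC subrK. Qed.

Lemma n_gt0 : (0 < n)%N. Proof. by rewrite addn_gt0 N0. Qed.

Lemma atomE t z l : t != 0 -> atom t z l =
  \sum_(k < n) (confluent z k l * (t ^+ k / k`!%:R)) *: f_ k +
  t ^+ n *: atom_rem t z l.
Proof.
move=> t0; rewrite /atom /atom_rem; case E : (fintype.split l) => [i|i].
  rewrite scalerA mulfV ?expf_neq0// scale1r {1}[f _](taylorE n).
  congr (_ + _); apply: eq_bigr => k _; rewrite mxE E; congr (_ *: _).
  by rewrite exprMn; ring.
rewrite scalerA -[in t ^+ n](prednK n_gt0) exprS mulfK ?expf_neq0//.
rewrite {1}[f' _](taylorE n.-1) scalerDr; congr (_ + _).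
pose g k := ((z i ^+ k.-1 *+ k) * (t ^+ k / k`!%:R)) *: f_ k.
rewrite [RHS](eq_bigr (fun k : 'I_n => g k)); last first.
  by move=> k _; rewrite mxE E.
rewrite sum_shift ?n_gt0//; last by rewrite /g mulr0n mul0r scale0r.
rewrite scaler_sumr; apply: eq_bigr => k _.
rewrite /g -derive1Sn scalerA; congr (_ *: _).
rewrite /= exprMn factS natrM -mulr_natr exprS.
by field; rewrite nat1r !pnatr_eq0 -lt0n fact_gt0.
Qed.

(** B does not depend on t: the remainder is O(x^m), which compensates t^-m; for the Lipschitz
    bound, its derivative is O(x^(m-1)) and the inner derivative supplies the missing factor t. The
    condition t Z <= 1 confines the arguments to [-1, 1]. *)
Lemma rem_curve m (g : R -> H) (Z : R) : (0 < m)%N -> class_C m g -> 0 <= Z ->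
  exists B : R, forall t, 0 < t -> t * Z <= 1 ->
    (forall s, `|s| <= Z -> `|t ^- m *: taylor_rem m g (t * s)| <= B) /\
    (forall s r, `|s| <= Z -> `|r| <= Z ->
       `|t ^- m *: taylor_rem m g (t * s) - t ^- m *: taylor_rem m g (t * r)| <=
       B * `|s - r|).
Proof.
case: m => // m _ Cg Z0; have [dg cg] := Cg.
have [B B0 gB] := continuous_bounded_itv (ltW (ltr01 : 0 < 1 :> R))
  (cg _ (leqnn m.+1)).
have gB' x : `|x| <= 1 -> `|derive1n m (g^`()%classic) x| <= B.
  by move=> x1; rewrite -derive1Sn; exact: gB.
have le1 := taylor_rem_le dot_norm Cg gB.
have le2 := taylor_rem_le dot_norm (class_C_derive1 Cg) gB'.
exists (B * Z ^+ m.+1 + B * Z ^+ m) => t t0 tZ.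
have ts1 s : `|s| <= Z -> `|t * s| <= t * Z.
  by move=> sZ; rewrite normrM gtr0_norm// ler_pM2l.
have BZ k : 0 <= B * Z ^+ k by rewrite mulr_ge0 ?exprn_ge0// ltW.
have tm k : 0 < t ^+ k by rewrite exprn_gt0.
split=> [s sZ|s r sZ rZ].
  rewrite normrZ normfV (gtr0_norm (tm _)) ler_pdivrMl//.
  apply: (le_trans (le1 _ (le_trans (ts1 s sZ) tZ))).
  apply: (@le_trans _ _ (B * (t * Z) ^+ m.+1)).
    rewrite ler_wpM2l ?(ltW B0)// lerXn2r ?nnegrE ?mulr_ge0// ?ts1//.
    exact: ltW.
  rewrite exprMn mulrCA ler_pM2l// lerDl//.
rewrite -scalerBr normrZ normfV (gtr0_norm (tm _)) ler_pdivrMl//.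
have := @mean_value_le _ _ _ dot_norm (taylor_rem m.+1 g)
  (B * (t * Z) ^+ m) (t * r) (t * s) (t * Z).
have dr (u : R) := derivable_taylor_rem m (dg 0%N u isT).
move=> /(_ (fun u => (dr u).1))/(_ _ (ts1 r rZ) (ts1 s sZ)) h.
apply: le_trans (h _) _ => [u uZ|].
  rewrite (dr u).2; apply: (le_trans (le2 _ (le_trans uZ tZ))).
  by rewrite ler_wpM2l ?(ltW B0)// lerXn2r ?nnegrE ?mulr_ge0// ltW.
rewrite -mulrBr normrM (gtr0_norm t0) exprMn.
have -> : B * (t ^+ m * Z ^+ m) * (t * `|s - r|) =
    t ^+ m.+1 * (B * Z ^+ m * `|s - r|) by rewrite exprS; ring.
by rewrite ler_pM2l// ler_wpM2r// lerDr.
Qed.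

End TaylorSystem.

Lemma finite_pos_lb (R : realFieldType) (I : finType) (c : I -> R) :
  (forall i, 0 < c i) -> exists2 d : R, 0 < d & forall i, d <= c i.
Proof.
move=> c0; suff [d d0 dc] : exists2 d : R, 0 < d &
    forall i, i \in index_enum I -> d <= c i.
  by exists d => // i; apply: dc; rewrite mem_index_enum.
elim: (index_enum I) => [|i s [d d0 dc]]; first by exists 1.
exists (Num.min (c i) d) => [|j]; first by rewrite lt_min c0.
by rewrite inE ge_min => /orP[/eqP ->|/dc ->]; rewrite ?lexx ?orbT.
Qed.

Section ublMore.
Context (R : realType) (V : normedModType R) (T : Type).
Implicit Types (P : set T) (D : set V).

Lemma ubl_1lip (W : normedModType R) P D (g : V -> W) (K : R) :
  (forall x, D x -> `|g x| <= K) ->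
  (forall x y, `|g x - g y| <= `|x - y|) -> ubl P D (fun _ x => g x).
Proof.
move=> gK gl; exists (`|K| + 1) => [|t _ x Dx]; first exact: ltr_wpDl.
split=> [|y _].
  by rewrite (le_trans (gK x Dx))// (le_trans (ler_norm _))// lerDl.
by rewrite (le_trans (gl x y))// ler_peMl// lerDr.
Qed.

Lemma ubl_row P D m (f : 'I_m -> T -> V -> R) :
  (forall j, ubl P D (f j)) -> ubl P D (fun t x => \row_j f j t x).
Proof.
move=> fP; apply: (eq_ubl (f := fun t x =>
    \sum_j f j t x *: (delta_mx 0 j : 'rV[R]_m))).
  move=> t x; rewrite [RHS]row_sum_delta; apply: eq_bigr => j _.
  by rewrite mxE.
apply: ubl_sum => j; apply: ubl_scale => //.
by apply: ubl_cst => t _; exact: lexx.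
Qed.

Lemma ublMn P D (f : T -> V -> R) k :
  ubl P D f -> ubl P D (fun t x => f t x *+ k).
Proof.
move=> fP; apply: (eq_ubl (f := fun t x => f t x * k%:R)).
  by move=> t x; rewrite mulr_natr.
by apply: ublM => //; apply: ubl_cst => t _; exact: lexx.
Qed.

End ublMore.

(** * The rescaled equations *)

Section Maps.
Context (R : realType) (H : completeNormedModType R) (dot : {dot H for idfun}).
Hypothesis dot_norm : forall x : H, dot x x = `|x| ^+ 2.
Context (N : nat) (f : R -> H) (a0 z0 : 'I_N -> R).
Hypothesis N0 : (0 < N)%N.
Hypothesis Cf : class_C (N + N).+1 f.
Hypothesis a0_gt0 : forall i, 0 < a0 i.
Hypothesis z0_inj : injective z0.
Local Notation n := (N + N)%N.
Local Notation f_ k := (derive1n k f 0).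
Local Notation E := ('rV[R]_(n + n) * (R^o * H))%type.

Definition base_amp_pos : 'rV[R]_n := row_mx (\row_i a0 i) (\row_i z0 i).
Definition base : 'rV[R]_(n + n) := row_mx base_amp_pos 0.

Definition amp (x : E) i := x.1 0 (lshift n (lshift N i)).
Definition pos (x : E) i := x.1 0 (lshift n (rshift N i)).
Definition coef (x : E) k := x.1 0 (rshift n k).

Definition remsum t (a z : 'I_N -> R) : H :=
  \sum_i a i *: atom_rem f t z (lshift N i).

(* The unknowns [x.1] are the amplitudes, the positions and the increments of
   the moments [\sum_i a i * z i ^+ k], the latter divided by
   [kap * weight t k]. The bound on [map_amp_pos] does not depend on [kap], so
   that a small [kap] makes [fixmap] below a contraction. *)
Definition weight t k : R := k`!%:R * t ^+ (n.-1 - k).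

(** Inverts [semiconfluent] on the moment increments: up to the factor kap, the components of a lift
    are a_i - a0_i and a_i (z_i - z0_i), see [pshift_lift]. Hence the division by the amplitude in
    [map_amp_pos]. *)
Definition pshift t (x : E) (l : 'I_n) : R :=
  \sum_k invmx (semiconfluent z0 (pos x)) l k * (weight t k * coef x k).

Definition map_amp_pos t (x : E) : 'rV[R]_n :=
  \row_l match fintype.split l with
         | inl i => pshift t x l
         | inr i => pshift t x l * (amp x i)^-1
         end.

(* The misfit [Phi m - y_t - w] divided by [t ^+ n.-1]. *)
Definition resid (kap : R) t (x : E) : H :=
  \sum_k (kap * coef x k) *: f_ k +
  t *: (remsum t (amp x) (pos x) - remsum t a0 z0) - x.2.2.

(** What remains of [defect] beside its linear part with constant coefficients, divided by t, see
    [defectE]. *)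
Definition pert (kap : R) t (x : E) : 'rV[R]_n :=
  \row_k (dot (f_ k) (remsum t (amp x) (pos x) - remsum t a0 z0) +
    weight t k * \sum_l invmx (confluent (pos x)) l k *
      dot (atom_rem f t (pos x) l) (resid kap t x)).

Definition dom (e : R) : set E := [set x | `|x.1 - base| <= e /\ `|x.2| <= 1].
(** Bounds the unknowns on [dom 1], in particular the positions: a t with t rbase <= 1 keeps every t
    z_i in [-1, 1], where the Taylor estimates hold. *)
Definition rbase : R := `|base| + 1.
Definition times : set R := [set t | 0 < t /\ t * rbase <= 1].

Lemma rbase_ge1 : 1 <= rbase. Proof. by rewrite lerDr. Qed.

Lemma rbase_gt0 : 0 < rbase. Proof. exact: lt_le_trans rbase_ge1. Qed.

Lemma times_le1 t : times t -> t <= 1.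
Proof.
by move=> [t0 tr]; rewrite (le_trans _ tr)// ler_peMr ?(ltW t0)// rbase_ge1.
Qed.

Lemma dom_fst x : dom 1 x -> `|x.1| <= rbase.
Proof.
move=> [x1 _]; rewrite -(subrK base x.1) (le_trans (ler_normD _ _))//.
by rewrite /rbase addrC lerD2l.
Qed.

Lemma fst_norm (x : E) : `|x.1| <= `|x|.
Proof. by rewrite prod_normE le_max lexx. Qed.

Lemma ubl_coord j : ubl times (dom 1) (fun _ x => x.1 0 j).
Proof.
apply: (@ubl_1lip _ _ _ R _ _ _ rbase) => [x Dx|x y].
  exact: le_trans (mx_norm_coord _ _ _) (dom_fst Dx).
have -> : x.1 0 j - y.1 0 j = (x - y).1 0 j by rewrite !mxE.
exact: le_trans (mx_norm_coord _ _ _) (fst_norm _).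
Qed.

Lemma dom_pos x i : dom 1 x -> `|pos x i| <= rbase.
Proof. by move=> Dx; exact: le_trans (mx_norm_coord _ _ _) (dom_fst Dx). Qed.

Lemma ubl_om : ubl times (dom 1) (fun _ x => x.2.2).
Proof.
apply: (@ubl_1lip _ _ _ H _ _ _ 1) => [x [_ x1]|x y].
  by rewrite (le_trans _ x1)// prod_normE le_max lexx orbT.
have -> : x.2.2 - y.2.2 = (x - y).2.2 by [].
apply: (@le_trans _ _ `|(x - y).2|).
  by rewrite [leRHS]prod_normE le_max lexx orbT.
by rewrite [leRHS]prod_normE le_max lexx orbT.
Qed.

Lemma ubl_cstx (W : normedModType R) (D : set E) (c : W) :
  ubl times D (fun _ _ => c).
Proof. by apply: ubl_cst => t _; exact: lexx. Qed.

Lemma ubl_weight D k : ubl times D (fun t (x : E) => weight t k).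
Proof.
apply: (@ubl_cst _ _ _ _ _ _ (weight ^~ k) k`!%:R) => t Pt.
have [t0 _] := Pt; rewrite /weight normrM normr_nat ler_piMr//.
by rewrite normrX exprn_ile1// ?gtr0_norm// times_le1.
Qed.

Lemma ubl_time D : ubl times D (fun t (x : E) => t).
Proof.
apply: (@ubl_cst _ _ _ _ _ _ id 1) => t Pt.
by have [t0 _] := Pt; rewrite gtr0_norm// times_le1.
Qed.

Lemma ubl_atom_rem l : ubl times (dom 1) (fun t x => atom_rem f t (pos x) l).
Proof.
have r0 : 0 <= rbase by rewrite ltW// rbase_gt0.
have n1 : (0 < n.-1)%N by move: N0; case: N => // m _; rewrite addnS.
have Cn : class_C n f by exact: class_CS.
have Cn' : class_C n.-1 (f^`()%classic).
  by apply: class_C_derive1; rewrite prednK ?addn_gt0 ?N0//.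
rewrite /atom_rem; case: fintype.split => i.
  have [B BP] := rem_curve dot_norm (n_gt0 N0) Cn r0.
  apply: (@ubl_curve _ _ _ _ _ _ (fun _ x => pos x i)
    (fun t s => t ^- n *: taylor_rem n f (t * s)) rbase B).
  - by move=> t _ x Dx; exact: dom_pos.
  - by move=> t [t0 tr] s sr; have [h _] := BP t t0 tr; exact: h.
  - by move=> t [t0 tr] s s' sr sr'; have [_ h] := BP t t0 tr; exact: h.
  - exact: ubl_coord.
have [B BP] := rem_curve dot_norm n1 Cn' r0.
apply: (@ubl_curve _ _ _ _ _ _ (fun _ x => pos x i)
  (fun t s => t ^- n.-1 *: taylor_rem n.-1 (f^`()%classic) (t * s)) rbase B).
- by move=> t _ x Dx; exact: dom_pos.
- by move=> t [t0 tr] s sr; have [h _] := BP t t0 tr; exact: h.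
- by move=> t [t0 tr] s s' sr sr'; have [_ h] := BP t t0 tr; exact: h.
- exact: ubl_coord.
Qed.

Lemma base_coord : (forall v, amp (base, v) = a0) /\
  (forall v, pos (base, v) = z0)
  /\ (forall v k, coef (base, v) k = 0).
Proof.
split; last split=> [v|v k].
- by move=> v; apply/funext => i; rewrite /amp /base !row_mxEl mxE.
- by apply/funext => i; rewrite /pos /base row_mxEl row_mxEr mxE.
- by rewrite /coef /base row_mxEr mxE.
Qed.

Lemma base_dom e v : 0 <= e -> `|v| <= 1 -> dom e (base, v).
Proof. by move=> e0 v1; split => //=; rewrite subrr normr0. Qed.

Lemma dom_sub e e' : e <= e' -> dom e `<=` dom e'.
Proof. by move=> ee x [x1 x2]; split=> //; exact: le_trans ee. Qed.

Lemma ubl_confluent k l : ubl times (dom 1) (fun _ x => confluent (pos x) k l).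
Proof.
apply: (eq_ubl (f := fun _ x => match fintype.split l with
    inl i => pos x i ^+ k | inr i => pos x i ^+ k.-1 *+ k end : R)).
  by move=> t x; rewrite mxE.
case: fintype.split => i; first exact/ublX/ubl_coord.
exact/ublMn/ublX/ubl_coord.
Qed.

Lemma ubl_semiconfluent k l :
  ubl times (dom 1) (fun _ x => semiconfluent z0 (pos x) k l).
Proof.
apply: (eq_ubl (f := fun _ x => match fintype.split l with
    inl i => z0 i ^+ k | inr i => divdiff (z0 i) (pos x i) k end : R)).
  by move=> t x; rewrite mxE.
case: fintype.split => i; first exact: ubl_cstx.
apply: ubl_sum => j; apply: ublM; last exact: ubl_cstx.
exact/ublX/ubl_coord.
Qed.

(** At the base point both determinants equal that of [confluent z0], nonzero because the [z0 i] are
    distinct; the Lipschitz bounds carry half of its modulus to a small ball. *)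
Lemma dom_good : exists2 e : R, 0 < e & e <= 1 /\ exists2 c : R, 0 < c &
  forall x, dom e x -> [/\ forall i, c <= amp x i,
    c <= `|\det (confluent (pos x))| &
    c <= `|\det (semiconfluent z0 (pos x))|].
Proof.
have det0 : 0 < `|\det (confluent z0)|.
  by rewrite normr_gt0 -unitfE -unitmxE confluent_unitmx.
have [bA [bP bC]] := base_coord.
have D0 : dom 1 (base, 0) by apply: base_dom; rewrite ?normr0.
(* The determinants do not depend on t; the estimates on families are read at one admissible
   time. *)
pose t0 := rbase^-1.
have Pt0 : times t0 by rewrite /times/= invr_gt0 mulVf ?gt_eqF ?rbase_gt0.
have near (x : E) (d : R) : `|x.1 - base| <= d ->
    `|((x.1, 0) : E) - (base, 0)| <= d.
  move=> xd; rewrite prod_normE/= subr0 normr0 ge_max xd/=.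
  exact: le_trans (normr_ge0 _) xd.
have db1 t : times t -> `|\det (confluent z0)| <=
    `|\det (confluent (pos (base, 0)))| by rewrite bP.
have db2 t : times t -> `|\det (confluent z0)| <=
    `|\det (semiconfluent z0 (pos (base, 0)))| by rewrite bP semiconfluentE.
have [d1 d10 d1P] := ubl_away det0
  (ubl_det (fun i j => ubl_confluent i j)) D0 db1.
have [d2 d20 d2P] := ubl_away det0
  (ubl_det (fun i j => ubl_semiconfluent i j)) D0 db2.
have [d d0 da] := finite_pos_lb a0_gt0.
pose e := Num.min 1 (Num.min d1 (Num.min d2 (d / 2))).
have e0 : 0 < e by rewrite !lt_min ltr01 d10 d20 divr_gt0.
have e1 : e <= 1 by rewrite ge_min lexx.
exists e => //; split => //.
exists (Num.min (d / 2) (`|\det (confluent z0)| / 2)).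
  by rewrite lt_min !divr_gt0.
move=> x Dx; have [x1 _] := Dx; move: (x1); rewrite !le_min.
move=> /and4P[_ xd1 xd2 xd].
have Dx' : dom 1 (x.1, 0).
  by split => /=; rewrite ?normr0//; exact: le_trans x1 e1.
split=> [i||].
- rewrite ge_min; apply/orP; left.
  have := le_trans (mx_norm_coord (x.1 - base) 0 (lshift n (lshift N i))) xd.
  rewrite mxE -/(amp x i) mxE.
  have -> : base 0 (lshift n (lshift N i)) = a0 i.
    by rewrite -[RHS](congr1 (fun g => g i) (bA 0)).
  by rewrite ler_norml; have := da i; lra.
- rewrite ge_min; apply/orP; right.
  by have := d1P t0 Pt0 (x.1, 0) Dx' (near x _ xd1).
- rewrite ge_min; apply/orP; right.
  by have := d2P t0 Pt0 (x.1, 0) Dx' (near x _ xd2).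
Qed.

Section Good.
Variables (e c : R).
Hypotheses (e0 : 0 < e) (e1 : e <= 1) (c0 : 0 < c).
Hypothesis good : forall x, dom e x -> [/\ forall i, c <= amp x i,
    c <= `|\det (confluent (pos x))| &
    c <= `|\det (semiconfluent z0 (pos x))|].

Lemma ubl_dom (W : normedModType R) (g : R -> E -> W) :
  ubl times (dom 1) g -> ubl times (dom e) g.
Proof. by apply: ubl_sub => //; exact: dom_sub. Qed.

Lemma ubl_inv_semiconfluent l k :
  ubl times (dom e) (fun _ x => invmx (semiconfluent z0 (pos x)) l k).
Proof.
apply: (ubl_invmx l k c0) => [t _ x Dx|i j]; first by have [] := good Dx.
exact/ubl_dom/ubl_semiconfluent.
Qed.

Lemma ubl_inv_confluent l k :
  ubl times (dom e) (fun _ x => invmx (confluent (pos x)) l k).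
Proof.
apply: (ubl_invmx l k c0) => [t _ x Dx|i j]; first by have [] := good Dx.
exact/ubl_dom/ubl_confluent.
Qed.

Lemma ubl_pshift l : ubl times (dom e) (fun t x => pshift t x l).
Proof.
apply: ubl_sum => k; apply: ublM; first exact: ubl_inv_semiconfluent.
by apply: ublM; [exact: ubl_weight|exact/ubl_dom/ubl_coord].
Qed.

Lemma ubl_map_amp_pos : ubl times (dom e) map_amp_pos.
Proof.
apply: ubl_row => l; case: fintype.split => i; first exact: ubl_pshift.
apply: ublM; first exact: ubl_pshift.
apply: (ublV c0) => [t _ x Dx|]; last exact/ubl_dom/ubl_coord.
by have [h _ _] := good Dx; rewrite (le_trans (h i))// ler_norm.
Qed.

Lemma ubl_remsum : ubl times (dom 1)
  (fun t x => remsum t (amp x) (pos x) - remsum t a0 z0).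
Proof.
have remP : ubl times (dom 1) (fun t x => remsum t (amp x) (pos x)).
  by apply: ubl_sum => i; apply: ubl_scale;
    [exact: ubl_coord|exact: ubl_atom_rem].
apply: ublB => //; have [bA [bP _]] := base_coord; have [K K0 KP] := remP.
apply: (@ubl_cst _ _ _ _ _ _ (fun t => remsum t a0 z0) K) => t Pt.
have [] := KP t Pt (base, 0); last by rewrite bA bP.
by apply: base_dom; rewrite ?normr0.
Qed.

Lemma ubl_resid kap : ubl times (dom 1) (resid kap).
Proof.
apply: ublB; last exact: ubl_om.
apply: ublD.
  apply: ubl_sum => k; apply: ubl_scale; last exact: ubl_cstx.
  by apply: ublM; [exact: ubl_cstx|exact: ubl_coord].
by apply: ubl_scale; [exact: ubl_time|exact: ubl_remsum].
Qed.

Lemma ubl_dot D (g h : R -> E -> H) : ubl times D g -> ubl times D h ->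
  ubl times D (fun t x => dot (g t x) (h t x)).
Proof. exact: (ubl_bilinear (dot_bilinear dot_norm)). Qed.

Lemma ubl_pert kap : ubl times (dom e) (pert kap).
Proof.
apply: ubl_row => k; apply: ublD.
  by apply: ubl_dot; [exact: ubl_cstx|exact/ubl_dom/ubl_remsum].
apply: ublM; first exact: ubl_weight.
apply: ubl_sum => l; apply: ublM; first exact: ubl_inv_confluent.
by apply: ubl_dot; apply: ubl_dom; [exact: ubl_atom_rem|exact: ubl_resid].
Qed.

End Good.

End Maps.

Section Equation.
Context (R : realType) (H : completeNormedModType R) (dot : {dot H for idfun}).
Hypothesis dot_norm : forall x : H, dot x x = `|x| ^+ 2.
Context (N : nat) (f : R -> H) (a0 z0 : 'I_N -> R).
Hypothesis N0 : (0 < N)%N.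
Local Notation n := (N + N)%N.
Local Notation f_ k := (derive1n k f 0).
Local Notation E := ('rV[R]_(n + n) * (R^o * H))%type.
Local Notation base_amp_pos := (base_amp_pos a0 z0).
Local Notation base := (base a0 z0).
Local Notation resid := (resid f a0 z0).
Local Notation pert := (pert dot f a0 z0).
Local Notation map_amp_pos := (map_amp_pos z0).

Definition ramp (u : 'rV[R]_n) i := u 0 (lshift N i).
Definition rpos (u : 'rV[R]_n) i := u 0 (rshift N i).

Definition fsum t (u : 'rV[R]_n) : H := \sum_i ramp u i *: f (t * rpos u i).

Definition misfit t (x : ('rV[R]_n * (R^o * H))%type) : H :=
  fsum t x.1 - fsum t base_amp_pos - x.2.2.

(* At a critical point, [- misfit / lambda] takes the value 1 and has a
   vanishing derivative at every spike. *)
Definition optim t l (x : ('rV[R]_n * (R^o * H))%type) : R :=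
  dot (atom f t (rpos x.1) l) (misfit t x) +
  (if fintype.split l is inl _ then x.2.1 else 0).

Definition dmoment (u : 'rV[R]_n) k : R :=
  \sum_i ramp u i * rpos u i ^+ k - \sum_i a0 i * z0 i ^+ k.

(** Completes amplitudes and positions by the coefficients compatible with them, the rescaled
    increments of their moments. *)
Definition lift_coef (kap : R) t (u : 'rV[R]_n) : 'rV[R]_(n + n) :=
  row_mx u (\row_k (kap^-1 * (dmoment u k / weight N t k))).

Definition scale_par t (v : R^o * H) : R^o * H :=
  (v.1 / t ^+ n.-1, (t ^+ n.-1)^-1 *: v.2).

Lemma rampE : ramp base_amp_pos = a0.
Proof. by apply/funext => i; rewrite /ramp row_mxEl mxE. Qed.

Lemma rposE : rpos base_amp_pos = z0.
Proof. by apply/funext => i; rewrite /rpos row_mxEr mxE. Qed.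

Lemma amp_lift kap t u (v : R^o * H) : amp (lift_coef kap t u, v) = ramp u.
Proof. by apply/funext => i; rewrite /amp row_mxEl. Qed.

Lemma pos_lift kap t u (v : R^o * H) : pos (lift_coef kap t u, v) = rpos u.
Proof. by apply/funext => i; rewrite /pos row_mxEl. Qed.

Lemma coef_lift kap t u (v : R^o * H) k :
  coef (lift_coef kap t u, v) k = kap^-1 * (dmoment u k / weight N t k).
Proof. by rewrite /coef row_mxEr mxE. Qed.

Lemma weight_neq0 (t : R) k : t != 0 -> weight N t k != 0.
Proof.
by move=> t0; rewrite mulf_neq0 ?expf_neq0// pnatr_eq0 -lt0n fact_gt0.
Qed.

(** The reason for the weights: order k of the Taylor expansion carries t^k / k!, and with this unit
    for the k-th moment it contributes to the misfit with the power t^(n-1) for every k. *)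
Lemma weightE (t : R) (k : 'I_n) : weight N t k * (t ^+ k / k`!%:R) = t ^+ n.-1.
Proof.
have kn : (k <= n.-1)%N by rewrite -ltnS prednK ?n_gt0.
rewrite /weight -[in RHS](subnK kn) exprD.
by field; rewrite pnatr_eq0 -lt0n fact_gt0.
Qed.

Lemma fsumE t u : t != 0 -> fsum t u =
  \sum_(k < n) ((\sum_i ramp u i * rpos u i ^+ k) * (t ^+ k / k`!%:R)) *: f_ k +
  t ^+ n *: remsum f t (ramp u) (rpos u).
Proof.
move=> t0; rewrite /fsum /remsum.
rewrite (eq_bigr (fun i => ramp u i *: (\sum_(k < n)
  (rpos u i ^+ k * (t ^+ k / k`!%:R)) *: f_ k +
  t ^+ n *: atom_rem f t (rpos u) (lshift N i)))); last first.
  move=> i _; congr (_ *: _).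
  have := atomE f N0 (rpos u) (lshift N i) t0.
  rewrite {1}/atom split_lshiftE => ->; congr (_ + _).
  by apply: eq_bigr => k _; rewrite mxE split_lshiftE.
under eq_bigr do rewrite scalerDr.
rewrite big_split/=; congr (_ + _); last first.
  by rewrite scaler_sumr; apply: eq_bigr => i _; rewrite !scalerA mulrC.
under eq_bigr do rewrite scaler_sumr.
rewrite exchange_big/=; apply: eq_bigr => k _.
by rewrite mulr_suml scaler_suml; apply: eq_bigr => i _; rewrite scalerA mulrA.
Qed.

Lemma misfitE kap t u v : t != 0 -> kap != 0 ->
  misfit t (u, v) =
  t ^+ n.-1 *: resid kap t (lift_coef kap t u, scale_par t v).
Proof.
move=> t0 kap0; rewrite /misfit/= !fsumE// /resid amp_lift pos_lift.
rewrite rampE rposE /= [RHS]scalerBr [X in _ = _ - X]scalerA.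
rewrite mulfV ?expf_neq0// scale1r scalerDr.
congr (_ - _); rewrite [in LHS]opprD [LHS]addrACA; congr (_ + _).
  rewrite [RHS]scaler_sumr -[LHS]sumrB; apply: eq_bigr => k _;
    rewrite coef_lift !scalerA -scalerBl; congr (_ *: _).
  rewrite -mulrBl -/(dmoment u k) -(weightE t k).
  by field; rewrite kap0 (weight_neq0 k t0)//=.
by rewrite scalerA -exprSr prednK ?n_gt0// scalerBr.
Qed.

(* The equations [optim = 0] after inversion of the confluent Vandermonde
   matrix and rescaling; as [t] tends to 0 their linear part tends to the
   Gram matrix of the derivatives at 0, see [defectE]. *)
Definition defect (kap : R) t (x : E) : 'rV[R]_n := \row_k (
  dot (f_ k) (resid kap t x) + (k == 0%N :> nat)%:R * x.2.1 +
  t * (weight N t k * \sum_l invmx (confluent (pos x)) l k *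
      dot (atom_rem f t (pos x) l) (resid kap t x))).

(** Row 0 of the confluent matrix is the pattern with which lambda enters [optim]; after inversion
    lambda occurs directly in component 0 only. *)
Lemma confluent0 (z : 'I_N -> R) (k l : 'I_n) : (k == 0%N :> nat) ->
  confluent z k l = if fintype.split l is inl _ then 1 else 0.
Proof.
by move=> /eqP k0; rewrite mxE k0; case: fintype.split => i; rewrite ?expr0.
Qed.

(** By [atomE] the row of equations is a row times [confluent], plus a remainder with the factor
    t^(n-1) t^n; multiplying by the inverse isolates the orders k, each with its own power of t. *)
Lemma optim_defect kap t u v : t != 0 -> kap != 0 ->
  confluent (rpos u) \in unitmx ->
  (\row_l optim t l (u, v)) *m invmx (confluent (rpos u)) =
  \row_k (t ^+ n.-1 * (t ^+ k / k`!%:R) *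
          defect kap t (lift_coef kap t u, scale_par t v) 0 k).
Proof.
move=> t0 kap0 uV.
set x := (lift_coef kap t u, scale_par t v).
have posx : pos x = rpos u by exact: pos_lift.
set Q := resid kap t x.
have n0 : (0 < n)%N by exact: n_gt0.
pose y : 'rV[R]_n := \row_k (t ^+ n.-1 * (t ^+ k / k`!%:R) *
   (dot (f_ k) Q + (k == 0%N :> nat)%:R * (v.1 / t ^+ n.-1))).
pose s : 'rV[R]_n := \row_l dot (atom_rem f t (rpos u) l) Q.
have Fy : \row_l optim t l (u, v) =
    y *m confluent (rpos u) + (t ^+ n.-1 * t ^+ n) *: s.
  apply/rowP => l; rewrite !mxE /optim (misfitE _ _ t0 kap0) -/x -/Q.
  rewrite (atomE f N0 _ _ t0) dotZr dotDl dotZl dot_suml.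
  rewrite mulrDr mulrA -addrA [X in _ + X = _]addrC addrA; congr (_ + _).
  transitivity (t ^+ n.-1 * (\sum_(k < n) confluent (rpos u) k l *
      (t ^+ k / k`!%:R) * dot (f_ k) Q) +
    \sum_(k < n) (k == 0%N :> nat)%:R * (v.1 * confluent (rpos u) k l)).
    congr (_ * _ + _); first by apply: eq_bigr => k _; rewrite dotZl.
    rewrite (bigD1 (Ordinal n0))//= mul1r confluent0//.
    rewrite big1 ?addr0 => [|k k0]; last first.
      by rewrite (_ : (k == 0%N :> nat) = false) ?mul0r//; exact/negbTE.
    by case: fintype.split => ? /=; rewrite ?mulr1 ?mulr0.
  rewrite mulr_sumr -big_split/=; apply: eq_bigr => k _; rewrite [y 0 k]mxE.
  rewrite mulrDr mulrDl; congr (_ + _); first by ring.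
  case: (eqVneq (k : nat) 0%N) => [->|k0]; last by rewrite !mul0r mulr0 mul0r.
  by rewrite fact0 expr0 divr1 mulr1 !mul1r mulrCA mulfV ?expf_neq0// mulr1.
rewrite Fy mulmxDl mulmxK// -scalemxAl; apply/rowP => k; rewrite !mxE -/Q posx.
rewrite -[x.2.1]/(v.1 / t ^+ n.-1) [in RHS]mulrDr; congr (_ + _).
have -> : \sum_j s 0 j * invmx (confluent (rpos u)) j k =
    \sum_l invmx (confluent (rpos u)) l k * dot (atom_rem f t (rpos u) l) Q.
  by apply: eq_bigr => l _; rewrite mxE mulrC.
set w := \sum_l _.
have -> : t ^+ n = t * (weight N t k * (t ^+ k / k`!%:R)).
  by rewrite weightE -exprS prednK.
ring.
Qed.

Lemma optim_eq0P kap t u v : t != 0 -> kap != 0 ->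
  confluent (rpos u) \in unitmx ->
  defect kap t (lift_coef kap t u, scale_par t v) = 0 ->
  forall l, optim t l (u, v) = 0.
Proof.
move=> t0 kap0 uV d0 l.
have := optim_defect v t0 kap0 uV; rewrite d0 => F0.
have {}F0 : (\row_l optim t l (u, v)) *m invmx (confluent (rpos u)) = 0.
  by rewrite F0; apply/rowP => k; rewrite !mxE mulr0.
have : \row_l optim t l (u, v) = 0.
  by rewrite -[LHS](mulmxKV uV) F0 mul0mx.
by move=> /rowP/(_ l); rewrite !mxE.
Qed.

Definition gramn : 'M[R]_n := \matrix_(k, j) dot (f_ k) (f_ j).

Definition lead (v : R^o * H) : 'rV[R]_n :=
  \row_k (dot (f_ k) v.2 - (k == 0%N :> nat)%:R * v.1).

Lemma defectE kap t x : defect kap t x =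
  (kap *: \row_k coef x k) *m gramn - (lead x.2 - t *: pert kap t x).
Proof.
apply/rowP => k; rewrite !mxE opprB addrA.
set Q := resid kap t x; set w := weight N t k * _.
set dr := remsum f t (amp x) (pos x) - _.
have -> : dot (f_ k) Q = \sum_(j < n) (kap * coef x j) * dot (f_ j) (f_ k) +
    t * dot (f_ k) dr - dot (f_ k) x.2.2.
  rewrite /Q /resid dotBr dotDr dotZr dot_sumr; congr (_ + _ - _).
  by apply: eq_bigr => j _; rewrite dotZr [dot (f_ j) _]dotC.
have -> : \sum_j (kap *: \row_k0 coef x k0) 0 j * gramn j k =
    \sum_(j < n) (kap * coef x j) * dot (f_ j) (f_ k).
  by apply: eq_bigr => j _; rewrite !mxE.
ring.
Qed.

Definition increment (u : 'rV[R]_n) (l : 'I_n) : R :=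
  match fintype.split l with
  | inl i => ramp u i - a0 i
  | inr i => ramp u i * (rpos u i - z0 i)
  end.

Lemma dmomentE u (k : 'I_n) :
  dmoment u k = \sum_l semiconfluent z0 (rpos u) k l * increment u l.
Proof.
rewrite big_split_ord/= /dmoment -sumrB -big_split/=; apply: eq_bigr => i _.
rewrite !mxE /increment split_lshiftE split_rshiftE.
have := subrXX (rpos u i) (z0 i) k; rewrite -/(divdiff (z0 i) (rpos u i) k).
move=> /eqP; rewrite subr_eq => /eqP ->; ring.
Qed.

Lemma pshift_lift kap t u (v : R^o * H) l : t != 0 -> kap != 0 ->
  semiconfluent z0 (rpos u) \in unitmx ->
  kap * pshift z0 t (lift_coef kap t u, v) l = increment u l.
Proof.
move=> t0 kap0 uS; rewrite /pshift pos_lift mulr_sumr.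
transitivity ((invmx (semiconfluent z0 (rpos u)) *m
  (semiconfluent z0 (rpos u) *m (\col_l increment u l))) l 0); last first.
  by rewrite mulKmx// mxE.
rewrite [RHS]mxE; apply: eq_bigr => k _; rewrite coef_lift mxE.
have -> : \sum_j semiconfluent z0 (rpos u) k j * (\col_l0 increment u l0) j 0 =
    dmoment u k.
  by rewrite dmomentE; apply: eq_bigr => j _; rewrite [X in _ * X]mxE.
by field; rewrite kap0 (weight_neq0 k t0).
Qed.

Lemma map_amp_pos_lift kap t u (v : R^o * H) : t != 0 -> kap != 0 ->
  semiconfluent z0 (rpos u) \in unitmx -> (forall i, ramp u i != 0) ->
  base_amp_pos + kap *: map_amp_pos t (lift_coef kap t u, v) = u.
Proof.
move=> t0 kap0 uS u0; apply/rowP => l; rewrite !mxE.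
have := pshift_lift v l t0 kap0 uS; rewrite /increment.
case: (splitP l) => i li.
  have -> : l = lshift N i by exact: val_inj.
  by rewrite mxE => ->; rewrite addrC subrK.
have -> : l = rshift N i by exact: val_inj.
rewrite mxE mulrA => ->; rewrite amp_lift [_ * (_ - _)]mulrC mulfK//.
by rewrite addrC subrK.
Qed.

(** The first half of the fixed point equation alone forces the coefficients to be the rescaled
    moment increments, by invertibility of [semiconfluent]. A fixed point in 4N unknowns thus comes
    from a genuine pair (a, z). *)
Lemma lift_fixed kap t (x : E) : t != 0 -> kap != 0 ->
  semiconfluent z0 (pos x) \in unitmx -> (forall i, amp x i != 0) ->
  base_amp_pos + kap *: map_amp_pos t x = lsubmx x.1 ->
  x.1 = lift_coef kap t (lsubmx x.1).
Proof.
move=> t0 kap0 uS x0 fx; set u := lsubmx x.1 in fx *.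
have ru : ramp u = amp x by apply/funext => i; rewrite /ramp mxE.
have pu : rpos u = pos x by apply/funext => i; rewrite /rpos mxE.
have sE l : kap * pshift z0 t x l = increment u l.
  have /rowP/(_ l) := fx; rewrite !mxE /increment => fl.
  move: fl; case: (splitP l) => i li.
    have -> : l = lshift N i by exact: val_inj.
    rewrite mxE ru /amp => <-.
    by rewrite addrAC subrr add0r.
  have -> : l = rshift N i by exact: val_inj.
  rewrite mxE pu ru /pos => <-.
  by rewrite addrAC subrr add0r [RHS]mulrC -mulrA divfK.
rewrite -[LHS]hsubmxK; congr row_mx; apply/rowP => k.
rewrite !mxE -/(coef x k) dmomentE.
under eq_bigr do rewrite -sE mulrCA.
rewrite -mulr_sumr pu.
have -> : \sum_l semiconfluent z0 (pos x) k l * pshift z0 t x l =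
    weight N t k * coef x k.
  transitivity ((semiconfluent z0 (pos x) *m (invmx (semiconfluent z0 (pos x))
     *m \col_j (weight N t j * coef x j))) k 0).
    rewrite [RHS]mxE; apply: eq_bigr => l _; congr (_ * _).
    by rewrite [RHS]mxE; apply: eq_bigr => j _; rewrite [X in _ = _ * X]mxE.
  by rewrite mulKVmx// mxE.
by field; rewrite kap0 (weight_neq0 k t0).
Qed.

End Equation.

(** * Regularity of the equations at fixed t *)

Section Smoothness.
Context (R : realType) (H : completeNormedModType R) (dot : {dot H for idfun}).
Hypothesis dot_norm : forall x : H, dot x x = `|x| ^+ 2.
Context (N : nat) (f : R -> H) (a0 z0 : 'I_N -> R).
Local Notation n := (N + N)%N.
Local Notation X := ('rV[R]_n * (R^o * H))%type.

Lemma class_C_on_coord m (V : normedModType R) k (U : set V)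
    (g : V -> 'rV[R]_m) j : open U -> class_C_on k U g ->
  class_C_on k U (fun x => g x 0 j).
Proof.
move=> oU Cg; have [L LE] := @coord_clin R m j.
rewrite (_ : (fun _ => _) = fun x => L (g x)); first exact: class_C_on_clin.
by apply/funext => x; rewrite LE.
Qed.

Lemma class_C_on_fst (V W : normedModType R) k (U : set (V * W)%type) :
  class_C_on k U (fun x => x.1).
Proof.
have [L LE] := fst_clin V W; rewrite (_ : (fun _ => _) = fun x => L x).
  exact: class_C_on_linear.
by apply/funext => x; rewrite LE.
Qed.

Lemma class_C_on_snd (V W : normedModType R) k (U : set (V * W)%type) :
  class_C_on k U (fun x => x.2).
Proof.
have [L LE] := snd_clin V W; rewrite (_ : (fun _ => _) = fun x => L x).
  exact: class_C_on_linear.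
by apply/funext => x; rewrite LE.
Qed.

Lemma class_C_on_id (V : normedModType R) k (U : set V) :
  class_C_on k U (fun x => x).
Proof.
have [L LE] : exists L : clin V V, forall x, L x = x.
  have l : linear (fun x : V => x) by [].
  have b (x : V) : `|x| <= 1 * `|x| by rewrite mul1r.
  by have [L LE] := bounded_linear_clin l b; exists L => x; rewrite LE.
rewrite (_ : (fun _ => _) = fun x => L x); first exact: class_C_on_linear.
by apply/funext => x; rewrite LE.
Qed.

Lemma class_C_on_X (V : normedModType R) k (U : set V) (g : V -> R) m :
  open U -> class_C_on k U g -> class_C_on k U (fun x => g x ^+ m).
Proof.
move=> oU Cg; rewrite (_ : (fun _ => _) = fun x => \prod_(i < m) g x).
  exact: class_C_on_prod.
by apply/funext => x; rewrite prodr_const card_ord.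
Qed.

(** The atoms contain f', which costs one derivative: f of class C^(n+1) gives equations of class
    C^n, the class of the branch. *)
Lemma optim_class_C k t l : class_C k.+1 f ->
  class_C_on k (setT : set X) (optim dot f a0 z0 t l).
Proof.
move=> Cf; have oT : open (setT : set X) by exact: openT.
have C1 : class_C_on k (setT : set X) (fun x => x.1) by exact: class_C_on_fst.
have C2 : class_C_on k (setT : set X) (fun x => x.2) by exact: class_C_on_snd.
have C21 : class_C_on k (setT : set X) (fun x => x.2.1).
  have [L LE] := fst_clin R^o H.
  rewrite (_ : (fun _ => _) = fun x : X => L x.2); first exact: class_C_on_clin.
  by apply/funext => x; rewrite LE.
have C22 : class_C_on k (setT : set X) (fun x => x.2.2).
  have [L LE] := snd_clin R^o H.
  rewrite (_ : (fun _ => _) = fun x : X => L x.2); first exact: class_C_on_clin.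
  by apply/funext => x; rewrite LE.
have Cz i : class_C_on k (setT : set X) (fun x => t * rpos x.1 i).
  apply: class_C_onM => //; first exact: class_C_on_cst.
  exact: class_C_on_coord.
have Cm : class_C_on k (setT : set X) (misfit f a0 z0 t).
  rewrite (_ : misfit _ _ _ _ = fun x : X => fsum f t x.1 +
      ((- fsum f t (base_amp_pos a0 z0)) + (-1) *: x.2.2)).
    apply: class_C_onD => //.
      apply: class_C_on_sum => // i; apply: class_C_on_scale => //.
        exact: class_C_on_coord.
      by apply: class_C_on_curve => //; exact: class_CS.
    apply: class_C_onD => //; first exact: class_C_on_cst.
    by apply: class_C_on_scale => //; exact: class_C_on_cst.
  by apply/funext => x; rewrite /misfit scaleN1r addrA.
apply: class_C_onD => //; last first.
  by case: fintype.split => _ //; exact: class_C_on_cst.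
apply: (class_C_on_bilinear (dot_bilinear dot_norm)) => //.
rewrite /atom; case: fintype.split => i.
  by apply: class_C_on_curve => //; exact: class_CS.
apply: class_C_on_scale => //; first exact: class_C_on_cst.
by apply: class_C_on_curve => //; exact: class_C_derive1.
Qed.

Lemma lift_coef_near kap t (u : 'rV[R]_n) (e : R) : 0 < e ->
  exists2 d : R, 0 < d & forall k : 'rV[R]_n, `|k| < d ->
  `|lift_coef a0 z0 kap t (u + k) - lift_coef a0 z0 kap t u| < e.
Proof.
move=> e0; have oT : open (setT : set 'rV[R]_n) by exact: openT.
have Cc j : class_C_on 0 (setT : set 'rV[R]_n) (fun u => u 0 j).
  by apply: class_C_on_coord => //; exact: class_C_on_id.
have Cl : class_C_on 0 (setT : set 'rV[R]_n) (lift_coef a0 z0 kap t).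
  rewrite (_ : lift_coef _ _ _ _ = fun u =>
    \sum_j lift_coef a0 z0 kap t u 0 j *: (delta_mx 0 j : 'rV[R]_(n + n))).
    apply: class_C_on_sum => // j; apply: class_C_on_scale => //; last first.
      exact: class_C_on_cst.
    case: (splitP j) => i ji.
      have -> : j = lshift n i by exact: val_inj.
      rewrite (_ : (fun _ => _) = fun u : 'rV[R]_n => u 0 i); first exact: Cc.
      by apply/funext => v; rewrite row_mxEl.
    have -> : j = rshift n i by exact: val_inj.
    rewrite (_ : (fun _ => _) = fun u : 'rV[R]_n => (kap^-1 / weight N t i) *
        (\sum_i0 ramp u i0 * rpos u i0 ^+ i + - \sum_i0 a0 i0 * z0 i0 ^+ i)).
      apply: class_C_onM => //; first exact: class_C_on_cst.
      apply: class_C_onD => //; last exact: class_C_on_cst.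
      apply: class_C_on_sum => // i0; apply: class_C_onM; [by []|exact: Cc|].
      by apply: class_C_on_X; [|exact: Cc].
    by apply/funext => v; rewrite row_mxEr mxE /dmoment -mulrA
      [_^-1 * (_ - _)]mulrC.
  by apply/funext => v; rewrite [LHS]row_sum_delta.
have /cvgr_dist_lt/(_ e e0) := Cl u I.
rewrite near_simpl => /nbhs_ballP[d /= d0 dP].
exists d => // k kd; rewrite distrC; apply: dP.
by rewrite -ball_normE/= opprD addrA subrr add0r normrN.
Qed.

End Smoothness.

Section RowNorms.
Context (R : realType).

Lemma row_mx_norm_le m p (A : 'rV[R]_m) (B : 'rV[R]_p) (c : R) : 0 <= c ->
  `|A| <= c -> `|B| <= c -> `|row_mx A B| <= c.
Proof.
move=> c0 Ac Bc; apply: mx_norm_le => // i j; rewrite ord1.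
case: (splitP j) => k jk.
  have -> : j = lshift p k by exact: val_inj.
  by rewrite row_mxEl; exact: le_trans (mx_norm_coord _ _ _) Ac.
have -> : j = rshift m k by exact: val_inj.
by rewrite row_mxEr; exact: le_trans (mx_norm_coord _ _ _) Bc.
Qed.

Lemma row_mxB m p (A A' : 'rV[R]_m) (B B' : 'rV[R]_p) :
  row_mx A B - row_mx A' B' = row_mx (A - A') (B - B').
Proof. by rewrite opp_row_mx add_row_mx. Qed.

Lemma mulmx_norm_le m p (A : 'M[R]_(m, p)) : exists2 K : R, 0 < K &
  forall v : 'rV[R]_m, `|v *m A| <= K * `|v|.
Proof.
exists (1 + \sum_i \sum_j `|A i j|).
  by rewrite ltr_wpDr// sumr_ge0// => i _; rewrite sumr_ge0.
move=> v; apply: mx_norm_le => [|i j].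
  by rewrite mulr_ge0// addr_ge0// sumr_ge0// => k _; rewrite sumr_ge0.
rewrite ord1 mxE (le_trans (ler_norm_sum _ _ _))// mulrDl mul1r.
apply: (@le_trans _ _ ((\sum_i \sum_j `|A i j|) * `|v|)); last by rewrite lerDr.
rewrite mulr_suml; apply: ler_sum => k _; rewrite normrM mulrC.
apply: ler_pM => //; last exact: mx_norm_coord.
by rewrite (bigD1 j)//= lerDl sumr_ge0.
Qed.

Lemma mulmx_entry_le m p (A : 'rV[R]_m) (M : 'M[R]_(m, p)) (K : R) :
  0 <= K -> (forall i j, `|M i j| <= K) -> `|A *m M| <= m%:R * K * `|A|.
Proof.
move=> K0 MK; apply: mx_norm_le => [|i j]; first by rewrite !mulr_ge0.
rewrite ord1 mxE (le_trans (ler_norm_sum _ _ _))//.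
apply: (@le_trans _ _ (\sum_(k < m) K * `|A|)).
  apply: ler_sum => k _; rewrite normrM mulrC; apply: ler_pM => //.
  exact: mx_norm_coord.
by rewrite sumr_const card_ord -[_ *+ m]mulr_natl mulrA.
Qed.

Lemma lsubmx_norm_le m p (A : 'rV[R]_(m + p)) : `|lsubmx A| <= `|A|.
Proof.
apply: mx_norm_le => // i j; rewrite mxE ord1.
exact: mx_norm_coord.
Qed.

Lemma rsubmx_norm_le m p (A : 'rV[R]_(m + p)) : `|rsubmx A| <= `|A|.
Proof.
apply: mx_norm_le => // i j; rewrite mxE ord1.
exact: mx_norm_coord.
Qed.

End RowNorms.

(** * The branch of spikes *)

Section Core.
Context (R : realType) (H : completeNormedModType R) (dot : {dot H for idfun}).
Hypothesis dot_norm : forall x : H, dot x x = `|x| ^+ 2.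
Context (N : nat) (f : R -> H) (a0 z0 : 'I_N -> R).
Hypothesis N0 : (0 < N)%N.
Hypothesis Cf : class_C (N + N).+1 f.
Hypothesis a0_gt0 : forall i, 0 < a0 i.
Hypothesis z0_inj : injective z0.
Local Notation n := (N + N)%N.
Local Notation f_ k := (derive1n k f 0).
Local Notation E := ('rV[R]_(n + n) * (R^o * H))%type.
Local Notation base_amp_pos := (base_amp_pos a0 z0).
Local Notation base := (base a0 z0).
Local Notation resid := (resid f a0 z0).
Local Notation pert := (pert dot f a0 z0).
Local Notation map_amp_pos := (map_amp_pos z0).
Local Notation dom := (@dom R H N a0 z0).
Local Notation times := (times a0 z0).
Local Notation lead := (lead dot N f).
Local Notation G := (gramn dot N f).
Local Notation optim := (optim dot f a0 z0).
Local Notation defect := (defect dot f a0 z0).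
Local Notation lift_coef := (lift_coef a0 z0).

Hypothesis uG : G \in unitmx.

(** The first half recovers amplitudes and positions from the coefficients, the second solves the
    Gram system for the coefficients. The latter depends on x only through [pert], with the factor t
    / kap; hence kap is fixed first and t is taken small afterwards. *)
Definition fixmap kap t (v : R^o * H) (x : 'rV[R]_(n + n)) : 'rV[R]_(n + n) :=
  row_mx (base_amp_pos + kap *: map_amp_pos t (x, v))
    (kap^-1 *: ((lead v - t *: pert kap t (x, v)) *m invmx G)).

Lemma lead_norm_le : exists2 K : R, 0 < K &
  forall v : R^o * H, `|lead v| <= K * `|v|.
Proof.
exists (1 + \sum_(k < n) `|f_ k|); first by rewrite ltr_wpDr// sumr_ge0.
move=> v; apply: mx_norm_le => [|i k].
  by rewrite mulr_ge0// addr_ge0// sumr_ge0.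
rewrite mxE (le_trans (ler_normB _ _))// mulrDl mul1r addrC; apply: lerD.
  rewrite normrM; apply: (@le_trans _ _ `|v.1|).
    by rewrite ler_piMl// normr_nat lern1 leq_b1.
  by rewrite prod_normE le_max lexx.
rewrite (le_trans (dot_le dot_norm _ _))//; apply: ler_pM => //.
  by rewrite (bigD1 k)//= lerDl sumr_ge0.
by rewrite prod_normE le_max lexx orbT.
Qed.

Definition params (cR t : R) : set (R^o * H) :=
  [set v | `|v.1| < cR * t ^+ n.-1 /\ `|v.2| < cR * t ^+ n.-1].

(** The interface between the contraction and the optimality conditions. In [certificate_branch], C
    bounds the ratio |w| / lambda: the certificate is close to P when t and this ratio are small. *)
Record spike_branch (P : H) (cR M K t : R) (g : R^o * H -> 'rV[R]_n) : Prop := {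
  smooth_branch : forall l, class_C_on n (params cR t) (fun v => g v 0 l);
  bound_branch : forall v, params cR t v -> `|g v - base_amp_pos| <=
    M * (`|v.1| / t ^+ n.-1 + `|v.2| / t ^+ n.-1);
  amp_gt0_branch : forall v i, params cR t v -> 0 < ramp (g v) i;
  pos_le_branch : forall v i, params cR t v -> `|rpos (g v) i| <= rbase a0 z0;
  pos_inj_branch : forall v, params cR t v -> injective (rpos (g v));
  optim_branch : forall v l, params cR t v -> optim t l (g v, v) = 0;
  free_branch : forall v (b : 'I_N -> R), params cR t v ->
    \sum_i b i *: f (t * rpos (g v) i) = fsum f t (g v) ->
    forall i, b i = ramp (g v) i;
  certificate_branch : forall v C, params cR t v -> 0 <= C -> C <= 1 ->
    0 < v.1 -> `|v.2| <= C * v.1 ->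
    `|(- v.1^-1) *: misfit f a0 z0 t (g v, v) - P| <= K * (t + C) }.

Section Constants.
(** Order of choice: e and c from the invertibility of the matrices, K1, then kap, then K2, which
    depends on kap, then Kg, Kl and cR; t comes last. *)
Variables (e c K1 kap K2 Kg Kl cR t : R).
Hypotheses (e0 : 0 < e) (e1 : e <= 1) (c0 : 0 < c).
Hypothesis good : forall x : E, dom e x -> [/\ forall i, c <= amp x i,
    c <= `|\det (confluent (pos x))| &
    c <= `|\det (semiconfluent z0 (pos x))|].
Hypotheses (kap0 : 0 < kap) (kapK1 : kap * K1 <= e / 2).
Hypothesis map_ubl : forall t, times t -> forall x : E, dom e x ->
  `|map_amp_pos t x| <= K1 /\ forall y, dom e y ->
  `|map_amp_pos t x - map_amp_pos t y| <= K1 * `|x - y|.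
Hypothesis pert_ubl : forall t, times t -> forall x : E, dom e x ->
  `|pert kap t x| <= K2 /\ forall y, dom e y ->
  `|pert kap t x - pert kap t y| <= K2 * `|x - y|.
Hypotheses (Kg0 : 0 < Kg) (Kl0 : 0 < Kl) (K20 : 0 < K2).
Hypothesis Gg : forall v : 'rV[R]_n, `|v *m invmx G| <= Kg * `|v|.
Hypothesis leadl : forall v : R^o * H, `|lead v| <= Kl * `|v|.
Let K4 := kap^-1 * Kg * (Kl + K2).
Hypotheses (cR0 : 0 < cR) (cR1 : cR <= 1) (cRK4 : cR * K4 <= e / 4).
Hypotheses (tP : times t) (tK : t * (kap^-1 * Kg * K2) <= e / 2).

Let t0 : 0 < t. Proof. by have [] := tP. Qed.

Let t1 : t <= 1. Proof. exact: times_le1 tP. Qed.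

Let KK0 : 0 < kap^-1 * Kg. Proof. by rewrite mulr_gt0// invr_gt0. Qed.

Let in_dom x v : `|x - base| <= e -> `|v| <= cR -> dom e (x, v).
Proof. by move=> xe vc; split => //; exact: le_trans cR1. Qed.

Let K4_gt0 : 0 < K4. Proof. by rewrite mulr_gt0// addr_gt0. Qed.

Let kmul_le (u : 'rV[R]_n) (b : R) : `|u| <= b ->
  `|kap^-1 *: (u *m invmx G)| <= kap^-1 * Kg * b.
Proof.
move=> ub; rewrite normrZ normfV gtr0_norm// -mulrA ler_pM2l ?invr_gt0//.
by rewrite (le_trans (Gg u))// ler_pM2l.
Qed.

(** The norm of a row being the maximum over its halves, each half is contracted separately: the
    first since kap K1 <= e / 2, the second since t Kg K2 / kap <= e / 2. *)
Lemma fixmap_lip v x y : `|v| <= cR -> `|x - base| <= e -> `|y - base| <= e ->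
  `|fixmap kap t v x - fixmap kap t v y| <= 2^-1 * `|x - y|.
Proof.
move=> vc xe ye; have Dx := in_dom xe vc; have Dy := in_dom ye vc.
have e2 : e / 2 <= 2^-1 by rewrite ler_piMl.
have xy : `|((x, v) : E) - (y, v)| = `|x - y|.
  by rewrite prod_normE/= subrr normr0 max_l.
rewrite row_mxB; apply: row_mx_norm_le; first by rewrite mulr_ge0.
  rewrite opprD addrACA subrr add0r -scalerBr normrZ gtr0_norm//.
  have [_ /(_ _ Dy)] := map_ubl tP Dx; rewrite xy => h.
  apply: (le_trans (ler_wpM2l (ltW kap0) h)); rewrite mulrA ler_wpM2r//.
  exact: le_trans kapK1 e2.
rewrite -scalerBr -mulmxBl opprB [X in X *m _]addrC addrA subrK -scalerBr.
have [_ /(_ _ Dy)] := pert_ubl tP Dx; rewrite xy => h.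
have h' : `|t *: (pert kap t (y, v) - pert kap t (x, v))| <=
  t * (K2 * `|x - y|).
  by rewrite normrZ (gtr0_norm t0) (ler_pM2l t0) distrC; exact: h.
apply: (le_trans (kmul_le h')).
have -> : kap^-1 * Kg * (t * (K2 * `|x - y|)) =
  t * (kap^-1 * Kg * K2) * `|x - y| by ring.
by rewrite ler_wpM2r// (le_trans tK e2).
Qed.

(** At the base point the coefficients vanish, and for v = 0 so do the residual and [pert]; the
    displacement is therefore bounded linearly in v. *)
Lemma fixmap_base v : `|v| <= cR -> `|fixmap kap t v base - base| <= K4 * `|v|.
Proof.
move=> vc; have Db := in_dom (x := base) (v := v).
have be : `|base - base| <= e by rewrite subrr normr0 ltW.
have {}Db := in_dom be vc.
have [bA [bP bC]] := @base_coord R H N a0 z0.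
rewrite row_mxB subr0; apply: row_mx_norm_le.
- by rewrite mulr_ge0// ltW.
- rewrite addrAC subrr add0r (_ : map_amp_pos t (base, v) = 0).
    by rewrite scaler0 normr0 mulr_ge0// ltW.
  have s0 l : pshift z0 t (base, v) l = 0.
    by rewrite /pshift big1// => k _; rewrite bC !mulr0.
  by apply/rowP => l; rewrite !mxE s0; case: fintype.split => i; rewrite ?mul0r.
have p0 : pert kap t (base, 0) = 0.
  have r0 : resid kap t (base, 0) = 0.
    rewrite /resid bA bP subrr scaler0 addr0 subr0 big1// => k _.
    by rewrite bC mulr0 scale0r.
  apply/rowP => k; rewrite !mxE bA bP subrr (dot0r dot) add0r big1 ?mulr0//.
  by move=> l _; rewrite r0 (dot0r dot) mulr0.
have D0 : dom e (base, 0) by apply: in_dom => //; rewrite normr0 ltW.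
have pv : `|pert kap t (base, v)| <= K2 * `|v|.
  have [_ /(_ _ D0)] := pert_ubl tP Db; rewrite p0 subr0.
  by rewrite prod_normE/= subrr normr0 subr0 max_r.
have lp : `|lead v - t *: pert kap t (base, v)| <= (Kl + K2) * `|v|.
  rewrite mulrDl (le_trans (ler_normB _ _))//; apply: lerD; first exact: leadl.
  rewrite normrZ gtr0_norm// (le_trans _ pv)// ler_piMl//.
by apply: (le_trans (kmul_le lp)); rewrite mulrA.
Qed.

Lemma fixmap_self v x : `|v| <= cR -> `|x - base| <= e ->
  `|fixmap kap t v x - base| <= e.
Proof.
move=> vc xe; have be : `|base - base| <= e by rewrite subrr normr0 ltW.
rewrite -(subrK (fixmap kap t v base) (fixmap kap t v x)) -addrA.
apply: (le_trans (ler_normD _ _)).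
have h1 := fixmap_lip vc xe be; have h2 := fixmap_base vc.
have h3 : K4 * `|v| <= e / 4.
  by rewrite (le_trans _ cRK4)// mulrC ler_pM2r.
have h4 : 2^-1 * `|x - base| <= e / 2 by rewrite mulrC ler_pM2r ?invr_gt0.
apply: (le_trans (lerD (le_trans h1 h4) (le_trans h2 h3))).
by rewrite -mulrDr ler_piMr ?(ltW e0)//; lra.
Qed.

Lemma fixpoint_exists v : `|v| <= cR -> exists x : 'rV[R]_(n + n),
  `|x - base| <= e /\ fixmap kap t v x = x.
Proof.
move=> vc; have [x xe fx] := ball_fixed_point (ltW e0)
  (fun x => @fixmap_self v x vc) (fun x y => @fixmap_lip v x y vc).
by exists x.
Qed.

(** For a contraction of ratio 1/2, the distance to the fixed point is at most twice the
    displacement. With y the base point this gives the linear bound on the branch, with y a lift the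
    expanding estimate. *)
Lemma fixpoint_near v x y : `|v| <= cR -> `|x - base| <= e ->
  fixmap kap t v x = x -> `|y - base| <= e ->
  `|y - x| <= 2 * `|fixmap kap t v y - y|.
Proof.
move=> vc xe fx ye.
have h := fixmap_lip vc ye xe; rewrite fx in h.
have : `|y - x| <= `|fixmap kap t v y - y| + `|fixmap kap t v y - x|.
  rewrite -[in leRHS](normrN (_ - y)) opprB.
  by rewrite -(subrKA (fixmap kap t v y) y (- x)) ler_normD.
move: h; set a := `|y - x|; set b := `|_ - y|; set d := `|_ - x|; lra.
Qed.

Lemma fixpoint_bound v x : `|v| <= cR -> `|x - base| <= e ->
  fixmap kap t v x = x -> `|x - base| <= 2 * K4 * `|v|.
Proof.
move=> vc xe fx; have be : `|base - base| <= e by rewrite subrr normr0 ltW.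
rewrite distrC (le_trans (fixpoint_near vc xe fx be))// -mulrA ler_pM2l//.
exact: fixmap_base.
Qed.

(** The margin e / 2 keeps the lifts of points near the branch inside the ball. *)
Lemma fixpoint_half v x : `|v| <= cR -> `|x - base| <= e ->
  fixmap kap t v x = x -> `|x - base| <= e / 2.
Proof.
move=> vc xe fx; apply: (le_trans (fixpoint_bound vc xe fx)).
have : K4 * `|v| <= e / 4 by rewrite (le_trans _ cRK4)// mulrC ler_pM2r.
rewrite -mulrA; set a := K4 * _; lra.
Qed.

Lemma dom_semi x : dom e x -> semiconfluent z0 (pos x) \in unitmx.
Proof.
move=> /good[_ _ h]; rewrite unitmxE unitfE -normr_gt0.
exact: lt_le_trans c0 h.
Qed.

Lemma dom_conf x : dom e x -> confluent (pos x) \in unitmx.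
Proof.
move=> /good[_ h _]; rewrite unitmxE unitfE -normr_gt0.
exact: lt_le_trans c0 h.
Qed.

Lemma dom_amp x i : dom e x -> 0 < amp x i.
Proof. by move=> /good[h _ _]; exact: lt_le_trans c0 (h i). Qed.

(** A lift satisfies the first half of the fixed point equation identically, so that its
    displacement is given by the defect alone. *)
Lemma fixmap_lift v u : dom e (lift_coef kap t u, v) ->
  fixmap kap t v (lift_coef kap t u) - lift_coef kap t u =
  row_mx 0 (- (kap^-1 *: (defect kap t (lift_coef kap t u, v) *m invmx G))).
Proof.
move=> D; rewrite {2}/lift_coef row_mxB.
have su := dom_semi D; rewrite pos_lift in su.
rewrite map_amp_pos_lift ?gt_eqF//; last first.
  by move=> i; have := dom_amp i D; rewrite amp_lift => /gt_eqF ->.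
rewrite subrr; congr row_mx.
rewrite defectE [in RHS]mulmxBl mulmxK//.
rewrite [in RHS]scalerBr [in RHS]scalerA mulVf ?gt_eqF// scale1r opprB.
congr (_ - _); apply/rowP => k.
by rewrite !mxE coef_lift.
Qed.

Lemma fixpoint_lift v x : `|v| <= cR -> `|x - base| <= e ->
  fixmap kap t v x = x ->
  x = lift_coef kap t (lsubmx x) /\ defect kap t (x, v) = 0.
Proof.
move=> vc xe fx; have D := in_dom xe vc.
have xl : x = lift_coef kap t (lsubmx x).
  apply: (@lift_fixed _ H _ a0 z0 kap t (x, v)); rewrite ?gt_eqF//.
  - exact: dom_semi.
  - by move=> i; rewrite gt_eqF// (dom_amp i D).
  - by rewrite -{2}fx /fixmap row_mxKl.
split => //.
have := fixmap_lift (v := v) (u := lsubmx x); rewrite -xl fx subrr.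
move=> /(_ D) /(congr1 (@rsubmx _ _ _ _)); rewrite row_mxKr linear0.
move=> /esym/eqP; rewrite oppr_eq0 scaler_eq0 invr_eq0 gt_eqF//= => /eqP d0.
by rewrite -[LHS](mulmxKV uG) d0 mul0mx.
Qed.

(** As |w| <= lambda, the fixed point is at distance O(lambda) from the base point, where [pert]
    (for v = 0) and the difference of the [remsum] vanish; both are therefore O(lambda). They enter
    with a factor t, and w contributes O(C lambda), so every error is lambda times O(t + C) and
    survives the division by lambda. *)
Lemma fixpoint_certificate (P : H) (p : 'rV[R]_n) (Kd F C : R) v x :
  P = \sum_k p 0 k *: f_ k ->
  (forall k : 'I_n, dot (f_ k) P = (k == 0%N :> nat)%:R) ->
  0 <= Kd -> (forall x : E, dom 1 x ->
    `|remsum f t (amp x) (pos x) - remsum f t a0 z0| <= Kd * `|x.1 - base|) ->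
  F = \sum_(k < n) `|f_ k| ->
  `|v| <= cR -> `|x - base| <= e -> fixmap kap t v x = x ->
  0 <= C -> C <= 1 -> 0 < v.1 -> `|v.2| <= C * v.1 ->
  `|resid kap t (x, v) + v.1 *: P| <=
  (F * Kg * Kl + F * Kg * K2 * (2 * K4 + 1) + 2 * Kd * K4 + 1) * (t + C) * v.1.
Proof.
move=> PE fP Kd0 drP FE vc xe fx C0 C1 L0 omL.
have [xl d0] := fixpoint_lift vc xe fx; have D := in_dom xe vc.
set Q := resid kap t (x, v); set dr := remsum f t (amp (x, v)) (pos (x, v)) -
  remsum f t a0 z0.
(* Coordinates of Q + lambda P, up to t dr - w. As <f_k, P> is 1 for k = 0 and 0 otherwise, adding
   lambda P cancels the direct contribution of lambda to the Gram system. *)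
pose zeta : 'rV[R]_n := \row_k (kap * coef (x, v) k + v.1 * p 0 k).
have vL : `|v| <= v.1.
  rewrite prod_normE ge_max gtr0_norm// lexx/= (le_trans omL)//.
  by rewrite ler_piMl// ltW.
have xb : `|x - base| <= 2 * K4 * v.1.
  rewrite (le_trans (fixpoint_bound vc xe fx))// ler_pM2l// mulr_gt0//.
have QE : Q + v.1 *: P = \sum_k zeta 0 k *: f_ k + (t *: dr - v.2).
  rewrite /Q /resid -/dr -[_ - _]addrA addrAC; congr (_ + _).
  rewrite PE scaler_sumr -big_split/=.
  by apply: eq_bigr => k _; rewrite mxE scalerDl scalerA.
have zG : zeta *m G = lead (0, v.2) - t *: pert kap t (x, v).
  apply/rowP => k.
  have := congr1 (fun A : 'rV_n => A 0 k) d0.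
  rewrite !mxE -/Q -/dr => dk.
  have : dot (f_ k) (Q + v.1 *: P) =
      \sum_j zeta 0 j * G j k + (t * dot (f_ k) dr - dot (f_ k) v.2).
    rewrite QE dotDr dotBr dotZr dot_sumr; congr (_ + _).
    by apply: eq_bigr => j _; rewrite dotZr [G j k]mxE [dot (f_ j) _]dotC.
  rewrite dotDr dotZr fP; move: dk; rewrite -[(x, v).2.1]/v.1 mulr0 subr0.
  set s1 := \sum_l _; set s2 := \sum_j _; set w := weight N t k * s1.
  set A := dot _ Q; set B := _%:R; set U := dot _ dr; set W := dot _ v.2.
  rewrite mulrDr; lra.
have pertL : `|pert kap t (x, v)| <= K2 * (2 * K4 + 1) * v.1.
  have D0 : dom e (base, 0).
    by apply: in_dom; rewrite ?subrr normr0 ltW.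
  have p0 : pert kap t (base, 0) = 0.
    have [bA [bP bC]] := @base_coord R H N a0 z0.
    have r0 : resid kap t (base, 0) = 0.
      rewrite /resid bA bP subrr scaler0 addr0 subr0 big1// => k _.
      by rewrite bC mulr0 scale0r.
    apply/rowP => k; rewrite !mxE bA bP subrr (dot0r dot) add0r big1 ?mulr0//.
    by move=> l _; rewrite r0 (dot0r dot) mulr0.
  have [_ /(_ _ D0)] := pert_ubl tP D; rewrite p0 subr0 => h.
  apply: (le_trans h); rewrite -mulrA ler_pM2l// prod_normE/= subr0.
  have KL : 0 <= K4 * v.1 by rewrite mulr_ge0// ltW.
  rewrite ge_max; apply/andP; split.
    by rewrite (le_trans xb)// ler_pM2r// lerDl.
  by rewrite (le_trans vL)// ler_peMl ?(ltW L0)// lerDr mulr_ge0// ltW.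
have zL : `|zeta| <= Kg * (Kl * (C * v.1) + t * (K2 * (2 * K4 + 1) * v.1)).
  rewrite -[zeta](mulmxK uG) zG (le_trans (Gg _))// ler_pM2l//.
  apply: (le_trans (ler_normB _ _)); apply: lerD.
    apply: (le_trans (leadl _)); rewrite ler_pM2l// prod_normE/= normr0 max_r//.
  by rewrite normrZ gtr0_norm// ler_pM2l.
have F0 : 0 <= F by rewrite FE sumr_ge0.
have sumL : `|\sum_k zeta 0 k *: f_ k| <= F * `|zeta|.
  rewrite (le_trans (ler_norm_sum _ _ _))// FE mulr_suml; apply: ler_sum => k _.
  by rewrite normrZ mulrC ler_wpM2l// mx_norm_coord.
have drL : `|dr| <= Kd * (2 * K4 * v.1).
  have D1 : dom 1 (x, v) by apply: dom_sub D.
  by apply: (le_trans (drP _ D1)); rewrite ler_wpM2l.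
rewrite QE (le_trans (ler_normD _ _))//.
apply: (le_trans (lerD (le_trans sumL (ler_wpM2l F0 zL)) (ler_normB _ _))).
have tdL : `|t *: dr| <= t * (Kd * (2 * K4 * v.1)).
  by rewrite normrZ gtr0_norm// ler_pM2l.
apply: (le_trans (lerD (lexx _) (lerD tdL omL))).
have := K4_gt0; move: K4 => k4 k40.
have m1 : 0 <= F * Kg * Kl * t * v.1.
  by rewrite !mulr_ge0// ltW.
have m2 : 0 <= F * Kg * K2 * (2 * k4 + 1) * C * v.1.
  by rewrite !mulr_ge0 ?addr_ge0 ?mulr_ge0// ltW.
have m3 : 0 <= 2 * Kd * k4 * C * v.1.
  by rewrite !mulr_ge0// ltW.
have m4 : 0 <= t * v.1 by rewrite mulr_ge0// ltW.
rewrite -subr_ge0.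
have -> : (F * Kg * Kl + F * Kg * K2 * (2 * k4 + 1) + 2 * Kd * k4 + 1) *
  (t + C) * v.1 - (F * (Kg * (Kl * (C * v.1) + t * (K2 * (2 * k4 + 1) * v.1))) +
  (t * (Kd * (2 * k4 * v.1)) + C * v.1)) = F * Kg * Kl * t * v.1 +
  F * Kg * K2 * (2 * k4 + 1) * C * v.1 + 2 * Kd * k4 * C * v.1 +
    t * v.1 by ring.
by rewrite !addr_ge0.
Qed.

Variables (K3 : R) (sol : R^o * H -> 'rV[R]_(n + n)).
Hypothesis K30 : 0 < K3.
Hypothesis conf_le : forall x : E, dom e x ->
  forall l k, `|invmx (confluent (pos x)) l k| <= K3.
Hypothesis solP : forall v, `|v| <= cR ->
  `|sol v - base| <= e /\ fixmap kap t v (sol v) = sol v.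

Definition branch (v : R^o * H) : 'rV[R]_n := lsubmx (sol (scale_par N t v)).

Let tne0 : t != 0. Proof. by rewrite gt_eqF. Qed.

Let kne0 : kap != 0. Proof. by rewrite gt_eqF. Qed.

Let tn0 : 0 < t ^+ n.-1. Proof. exact: exprn_gt0. Qed.

Lemma scale_par_le v : params cR t v -> `|scale_par N t v| <= cR.
Proof.
case: v => v1 v2 [/= h1 h2]; rewrite prod_normE/= ge_max.
rewrite normrM normfV (gtr0_norm tn0) ler_pdivrMr// ltW//=.
by rewrite normrZ normfV (gtr0_norm tn0) mulrC ler_pdivrMr// ltW.
Qed.

Lemma scale_par_norm_le (v : R^o * H) :
  `|scale_par N t v| <= `|v.1| / t ^+ n.-1 + `|v.2| / t ^+ n.-1.
Proof.
rewrite prod_normE/= ge_max normrM normrZ !normfV (gtr0_norm tn0).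
rewrite [_^-1 * _]mulrC lerDl lerDr.
by apply/andP; split; rewrite divr_ge0// ltW.
Qed.

Lemma open_params : open (params cR t).
Proof.
have oT (W : normedModType R) : open [set w : W | `|w| < cR * t ^+ n.-1].
  rewrite (_ : [set _ | _] =
    (fun w : W => `|w|) @^-1` [set x : R | x < cR * t ^+ n.-1])//.
  apply: open_comp; last exact: open_lt.
  by move=> x _; exact: norm_continuous.
rewrite (_ : params cR t = (fst : R^o * H -> R^o) @^-1`
  [set w | `|w| < cR * t ^+ n.-1] `&`
  (snd : R^o * H -> H) @^-1` [set w | `|w| < cR * t ^+ n.-1])//.
apply: openI; apply: open_comp => [x _|]; [exact: cvg_fst|exact: oT|
  exact: cvg_snd|exact: oT].
Qed.

Lemma branch_lift v : params cR t v ->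
  sol (scale_par N t v) = lift_coef kap t (branch v).
Proof.
move=> /scale_par_le vc; have [xe fx] := solP vc.
by have [] := fixpoint_lift vc xe fx.
Qed.

Lemma branch_half v : params cR t v ->
  `|lift_coef kap t (branch v) - base| <= e / 2.
Proof.
move=> Bv; rewrite -branch_lift//; have vc := scale_par_le Bv.
by have [xe fx] := solP vc; exact: fixpoint_half vc xe fx.
Qed.

Lemma branch_dom v w : params cR t v -> `|w| <= cR ->
  dom e (lift_coef kap t (branch v), w).
Proof.
move=> Bv wc; apply: in_dom => //; apply: (le_trans (branch_half Bv)).
by rewrite ler_piMr ?(ltW e0)//; lra.
Qed.

Lemma branch_optim v l : params cR t v -> optim t l (branch v, v) = 0.
Proof.
move=> Bv; have vc := scale_par_le Bv; have [xe fx] := solP vc.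
have [_] := fixpoint_lift vc xe fx; rewrite branch_lift// => d0.
apply: (optim_eq0P N0 _ _ _ d0); rewrite ?gt_eqF//.
by have := dom_conf (branch_dom Bv vc); rewrite pos_lift.
Qed.

Lemma branch_amp v i : params cR t v -> 0 < ramp (branch v) i.
Proof.
move=> Bv; have := dom_amp i (branch_dom Bv (scale_par_le Bv)).
by rewrite amp_lift.
Qed.

Lemma branch_rpos_le v i : params cR t v -> `|rpos (branch v) i| <= rbase a0 z0.
Proof.
move=> Bv; have D := branch_dom Bv (scale_par_le Bv).
by have := @dom_pos _ _ _ _ _ _ i (dom_sub e1 D); rewrite pos_lift.
Qed.

Lemma branch_rpos_inj v : params cR t v -> injective (rpos (branch v)).
Proof.
move=> Bv i j ij; have := dom_conf (branch_dom Bv (scale_par_le Bv)).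
rewrite pos_lift -unitmx_tr unitmxE unitfE; apply: contraNeq => ij'.
apply/eqP/(@determinant_alternate _ _ _ (lshift N i) (lshift N j)).
  by rewrite (inj_eq (@lshift_inj N N)).
by move=> k; rewrite !mxE !split_lshiftE ij.
Qed.

Lemma branch_bound v : params cR t v -> `|branch v - base_amp_pos| <=
  2 * K4 * (`|v.1| / t ^+ n.-1 + `|v.2| / t ^+ n.-1).
Proof.
move=> Bv; have vc := scale_par_le Bv; have [xe fx] := solP vc.
have -> : branch v - base_amp_pos = lsubmx (sol (scale_par N t v) - base).
  by rewrite linearB/= row_mxKl.
apply: (le_trans (lsubmx_norm_le _));
  apply: (le_trans (fixpoint_bound vc xe fx)).
apply: ler_wpM2l; last exact: scale_par_norm_le.
by rewrite mulr_ge0// ltW.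
Qed.

(** [fixpoint_near] is applied to the lift of branch v + k with the parameters of v + h: the
    distance to the fixed point controls the left-hand side, and the displacement comes from the
    defect, a matrix multiple of the equations. The constants may depend on t, fixed here. *)
Lemma branch_expanding v : params cR t v -> exists2 K : R, 0 < K &
  exists2 d : R, 0 < d & forall (k : 'rV[R]_n) (h : R^o * H), `|k| < d ->
  `|h| < d -> `|branch v + k - branch (v + h)| <=
  K * `|\row_l optim t l (branch v + k, v + h)|.
Proof.
(* By [weightE], each term is the inverse of the factor t^(n-1) t^k / k! between the equations and
   the defect; c1 dominates them all. *)
move=> Bv; pose c1 := \sum_(k < n) weight N t k / (t ^+ n.-1 * t ^+ n.-1).
have w0 (k : 'I_n) : 0 <= weight N t k / (t ^+ n.-1 * t ^+ n.-1).
  rewrite divr_ge0//; last by rewrite mulr_ge0// ltW.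
  by rewrite mulr_ge0// exprn_ge0// ltW.
have c10 : 0 <= c1 by apply: sumr_ge0.
pose K := 2 * (kap^-1 * Kg * (c1 * (n%:R * K3))) + 1.
have K0 : 0 < K.
  by rewrite ltr_wpDl// mulr_ge0// mulr_ge0 ?(ltW KK0)// mulr_ge0// mulr_ge0//
    ltW.
have e20 : 0 < e / 2 by rewrite divr_gt0.
have [d1 d10 d1P] := lift_coef_near a0 z0 kap t (branch v) e20.
have [d2 /= d20 d2P] : exists2 d : R, 0 < d & forall h, `|h| < d ->
  params cR t (v + h).
  have := open_params; rewrite openE => /(_ v Bv) /nbhs_ballP[d /= d0 dP].
  exists d => // h hd; apply: dP.
  by rewrite -ball_normE/= opprD addrA subrr add0r normrN.
exists K => //; exists (Num.min d1 d2); first by rewrite lt_min d10.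
move=> k h; rewrite !lt_min => /andP[k1 _] /andP[_ h2].
have Bh := d2P h h2; have hc := scale_par_le Bh; have [xe fx] := solP hc.
set u := branch v + k; set s := scale_par N t (v + h).
have ye : `|lift_coef kap t u - base| <= e.
  rewrite -(subrKA (lift_coef kap t (branch v))) (le_trans (ler_normD _ _))//.
  apply: (le_trans (lerD (ltW (d1P k k1)) (branch_half Bv))).
  by rewrite -splitr.
have Du : dom e (lift_coef kap t u, s) by apply: in_dom.
have uV : confluent (rpos u) \in unitmx.
  by have := dom_conf Du; rewrite pos_lift.
apply: (@le_trans _ _ `|lift_coef kap t u - sol s|).
  have -> : u - branch (v + h) = lsubmx (lift_coef kap t u - sol s).
    by rewrite linearB/= row_mxKl.
  exact: lsubmx_norm_le.
apply: (le_trans (fixpoint_near hc xe fx ye)); rewrite fixmap_lift//.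
set o := \row_l _; set df := defect _ _ _.
have dfo : `|df| <= c1 * (n%:R * K3) * `|o|.
  have oM : `|o *m invmx (confluent (rpos u))| <= n%:R * K3 * `|o|.
    apply: mulmx_entry_le => [|l j]; first exact: ltW.
    by have := conf_le Du l j; rewrite pos_lift.
  apply: mx_norm_le => [|i j]; first by rewrite !mulr_ge0// ltW.
  rewrite ord1.
  have := optim_defect dot f a0 z0 N0 (v + h) tne0 kne0 uV.
  move=> /rowP/(_ j); rewrite [RHS]mxE -/s -/df -/o => E1.
  have -> : df 0 j = weight N t j / (t ^+ n.-1 * t ^+ n.-1) *
     (o *m invmx (confluent (rpos u))) 0 j.
    rewrite E1; have := weightE N0 t j.
    have := tn0; set T := t ^+ n.-1; set q := t ^+ j / _; set w := weight _ _ _.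
    move=> T0 wq; transitivity (w * q / T * df 0 j).
      by rewrite wq divff ?gt_eqF// mul1r.
    by field; rewrite gt_eqF.
  rewrite normrM -mulrA; apply: ler_pM => //; last first.
    exact: le_trans (mx_norm_coord _ _ _) oM.
  rewrite ger0_norm// /c1 (bigD1 j)//= lerDl.
  by apply: sumr_ge0 => i' _; exact: w0.
apply: (@le_trans _ _ (2 * (kap^-1 * Kg * (c1 * (n%:R * K3) * `|o|)))).
  rewrite ler_pM2l//; apply: row_mx_norm_le.
  - by rewrite !mulr_ge0 ?invr_ge0// ltW.
  - by rewrite normr0 !mulr_ge0 ?invr_ge0// ltW.
  - by rewrite normrN; exact: kmul_le.
rewrite /K [leRHS]mulrDl mul1r.
have -> : 2 * (kap^-1 * Kg * (c1 * (n%:R * K3) * `|o|)) =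
  2 * (kap^-1 * Kg * (c1 * (n%:R * K3))) * `|o| by ring.
by rewrite lerDl.
Qed.

Lemma branch_class_C l : class_C_on n (params cR t) (fun v => branch v 0 l).
Proof.
have nE : n.-1.+1 = n by rewrite prednK// n_gt0.
suff : class_C_on n.-1.+1 (params cR t) (fun v => branch v 0 l) by rewrite nE.
apply: (@expanding_implicit_class_C _ _ _ (params cR t) branch
  (fun l => optim t l)).
- exact: branch_expanding.
- by move=> j v; exact: branch_optim.
- exact: open_params.
- by move=> j; rewrite nE; exact: optim_class_C.
Qed.

(** Moving the amplitudes along b - a at fixed positions changes neither the misfit nor the atoms,
    so all equations remain satisfied; the expanding estimate with h = 0 then forces this direction
    to vanish. *)
Lemma branch_free v (b : 'I_N -> R) : params cR t v ->
  \sum_i b i *: f (t * rpos (branch v) i) = fsum f t (branch v) ->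
  forall i, b i = ramp (branch v) i.
Proof.
move=> Bv bE; have [K K0 [d d0 dP]] := branch_expanding Bv.
pose k : 'rV[R]_n := row_mx (\row_i (b i - ramp (branch v) i)) 0.
suff /rowP k0 : k = 0.
  by move=> i; have := k0 (lshift N i); rewrite row_mxEl !mxE => /subr0_eq.
pose s := (`|k| + 1)^-1 * (d / 2).
have k1 : 0 < `|k| + 1 by rewrite ltr_wpDl.
have s0 : 0 < s by rewrite mulr_gt0 ?invr_gt0// divr_gt0.
have sk : `|s *: k| < d.
  rewrite normrZ gtr0_norm// /s mulrAC -ltr_pdivlMr ?divr_gt0//.
  rewrite (@le_lt_trans _ _ 1)//;
    first by rewrite mulrC ler_pdivrMr// mul1r lerDl.
  by rewrite ltr_pdivlMr ?divr_gt0// mul1r; lra.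
have := dP (s *: k) 0 sk; rewrite normr0 addr0 => /(_ d0).
have rE i : rpos (branch v + s *: k) i = rpos (branch v) i.
  by rewrite /rpos mxE [X in _ + X]mxE row_mxEr [X in _ * X]mxE mulr0 addr0.
have fE : fsum f t (branch v + s *: k) = fsum f t (branch v).
  rewrite /fsum (eq_bigr (fun i =>
    ramp (branch v) i *: f (t * rpos (branch v) i)
    + s *: (b i *: f (t * rpos (branch v) i) -
            ramp (branch v) i *: f (t * rpos (branch v) i)))).
    by rewrite big_split/= -scaler_sumr sumrB bE subrr scaler0 addr0.
  move=> i _; rewrite rE {1}/ramp mxE [X in _ + X]mxE row_mxEl [X in _ * X]mxE.
  by rewrite scalerDl -scalerA scalerBl.
rewrite (_ : \row_l _ = 0) ?normr0 ?mulr0.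
  rewrite addrAC subrr add0r normr_le0 scaler_eq0 gt_eqF//= => /eqP //.
apply/rowP => l; rewrite !mxE -[RHS](branch_optim l Bv) /optim /misfit /= fE.
congr (dot _ _ + _); rewrite /atom.
by case: fintype.split => i; rewrite rE.
Qed.

Lemma branch_certificate (P : H) (p : 'rV[R]_n) (Kd F C : R) v :
  P = \sum_k p 0 k *: f_ k ->
  (forall k : 'I_n, dot (f_ k) P = (k == 0%N :> nat)%:R) ->
  0 <= Kd -> (forall x : E, dom 1 x ->
    `|remsum f t (amp x) (pos x) - remsum f t a0 z0| <= Kd * `|x.1 - base|) ->
  F = \sum_(k < n) `|f_ k| ->
  params cR t v -> 0 <= C -> C <= 1 -> 0 < v.1 -> `|v.2| <= C * v.1 ->
  `|(- v.1^-1) *: misfit f a0 z0 t (branch v, v) - P| <=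
  (F * Kg * Kl + F * Kg * K2 * (2 * K4 + 1) + 2 * Kd * K4 + 1) * (t + C).
Proof.
move=> PE fP Kd0 drP FE Bv C0 C1 v0 vC.
have vc := scale_par_le Bv; have [xe fx] := solP vc.
have s0 : 0 < (scale_par N t v).1 by rewrite divr_gt0.
have sC : `|(scale_par N t v).2| <= C * (scale_par N t v).1.
  by rewrite normrZ normfV gtr0_norm// mulrC mulrA ler_pM2r ?invr_gt0.
have := fixpoint_certificate PE fP Kd0 drP FE vc xe fx C0 C1 s0 sC.
rewrite branch_lift// => h.
rewrite (misfitE f a0 z0 N0 _ v tne0 kne0).
set Q := resid _ _ _ in h *.
have -> : (- v.1^-1) *: (t ^+ n.-1 *: Q) - P =
  - ((scale_par N t v).1^-1 *: (Q + (scale_par N t v).1 *: P)).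
  rewrite [in RHS]scalerDr [in RHS]scalerA mulVf ?gt_eqF// scale1r opprD.
  by rewrite scalerA mulNr scaleNr invf_div [_ * v.1^-1]mulrC.
by rewrite normrN normrZ normfV gtr0_norm// mulrC ler_pdivrMr.
Qed.

Lemma spike_branch_branch (P : H) (p : 'rV[R]_n) (Kd : R) :
  P = \sum_k p 0 k *: f_ k ->
  (forall k : 'I_n, dot (f_ k) P = (k == 0%N :> nat)%:R) ->
  0 <= Kd -> (forall x : E, dom 1 x ->
    `|remsum f t (amp x) (pos x) - remsum f t a0 z0| <= Kd * `|x.1 - base|) ->
  spike_branch P cR (2 * K4) ((\sum_(k < n) `|f_ k|) * Kg * Kl +
    (\sum_(k < n) `|f_ k|) * Kg * K2 * (2 * K4 + 1) + 2 * Kd * K4 + 1) t branch.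
Proof.
move=> PE fP Kd0 drP; split.
- exact: branch_class_C.
- exact: branch_bound.
- exact: branch_amp.
- exact: branch_rpos_le.
- exact: branch_rpos_inj.
- exact: branch_optim.
- exact: branch_free.
- move=> v C Bv C0 C1 v0 vC.
  exact: (branch_certificate PE fP Kd0 drP (erefl _) Bv C0 C1 v0 vC).
Qed.

End Constants.

End Core.

Lemma spike_branch_exists (R : realType) (H : completeNormedModType R)
    (dot : {dot H for idfun}) (N : nat) (f : R -> H) (a0 z0 : 'I_N -> R)
    (P : H) (p : 'rV[R]_(N + N)) :
  (forall x : H, dot x x = `|x| ^+ 2) -> (0 < N)%N -> class_C (N + N).+1 f ->
  (forall i, 0 < a0 i) -> injective z0 -> gramn dot N f \in unitmx ->
  P = \sum_k p 0 k *: derive1n k f 0 ->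
  (forall k : 'I_(N + N), dot (derive1n k f 0) P = (k == 0%N :> nat)%:R) ->
  exists T cR M K : R, [/\ 0 < T, 0 < cR, 0 < M & 0 < K] /\
  forall t, 0 < t -> t < T -> exists g : R^o * H -> 'rV[R]_(N + N),
  spike_branch dot f a0 z0 P cR M K t g.
Proof.
move=> dot_norm N0 Cf a00 zi uG PE fP.
have [e e0 [e1 [c c0 good]]] := dom_good H a00 zi.
have [K1 K10 K1P] := ubl_map_amp_pos e1 c0 good.
pose kap := e / 2 / K1.
have kap0 : 0 < kap by rewrite !divr_gt0.
have kapK1 : kap * K1 <= e / 2 by rewrite divfK ?gt_eqF.
have [K2 K20 K2P] := ubl_pert dot_norm N0 Cf e1 c0 good kap.
have [Kg Kg0 KgP] := mulmx_norm_le (invmx (gramn dot N f)).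
have [Kl Kl0 KlP] := lead_norm_le dot_norm N f.
have [Kd Kd0 KdP] := ubl_remsum dot_norm a0 z0 N0 Cf.
pose K4 := kap^-1 * Kg * (Kl + K2).
have KK0 : 0 < kap^-1 * Kg by rewrite mulr_gt0// invr_gt0.
have K40 : 0 < K4 by rewrite mulr_gt0// addr_gt0.
have k2 : 0 < kap^-1 * Kg * K2 by rewrite mulr_gt0.
pose cR := Num.min 1 (e / 4 / K4).
have cR0 : 0 < cR by rewrite lt_min ltr01 !divr_gt0.
have cR1 : cR <= 1 by rewrite ge_min lexx.
have cRK4 : cR * K4 <= e / 4.
  by rewrite -ler_pdivlMr// ge_min lexx orbT.
have [K3 K30 K3P] : exists2 K3 : R, 0 < K3 & forall x :
  'rV[R]_(N + N + (N + N)) *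
    (R^o * H), dom a0 z0 e x -> forall l k, `|invmx (confluent (pos x)) l k| <=
      K3.
  have /choice[K KP] : forall lk : 'I_(N + N) * 'I_(N + N), exists K : R,
    0 < K /\
      forall x : 'rV[R]_(N + N + (N + N)) * (R^o * H), dom a0 z0 e x ->
      `|invmx (confluent (pos x)) lk.1 lk.2| <= K.
    move=> [l k]; have [K K0 KP] := ubl_inv_confluent e1 c0 good l k.
    exists K; split=> // x Dx.
    have Pt : times a0 z0 (rbase a0 z0)^-1.
      by rewrite /times/= invr_gt0 mulVf ?gt_eqF ?rbase_gt0.
    by have [] := KP _ Pt x Dx.
  exists (1 + \sum_lk K lk) => [|x Dx l k].
    by rewrite ltr_wpDr// sumr_ge0// => i _; have [/ltW] := KP i.
  have [_ h] := KP (l, k); apply: (le_trans (h x Dx)).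
  rewrite (bigD1 (l, k))//= addrCA lerDl addr_ge0// sumr_ge0// => i _.
  by have [/ltW] := KP i.
pose F := \sum_(k < N + N) `|derive1n k f 0|.
have F0 : 0 <= F by apply: sumr_ge0.
(* The first bound puts t in [times], the second makes the Gram half of [fixmap] contracting. *)
pose T := Num.min (rbase a0 z0)^-1 (e / 2 / (kap^-1 * Kg * K2)).
exists T, cR, (2 * K4), (F * Kg * Kl + F * Kg * K2 * (2 * K4 + 1) +
  2 * Kd * K4 + 1).
split.
  split => //.
  - by rewrite lt_min invr_gt0 rbase_gt0 divr_gt0 ?divr_gt0.
  - by rewrite mulr_gt0.
  - have h1 : 0 <= F * Kg * Kl by rewrite !mulr_ge0// ltW.
    have h2 : 0 <= F * Kg * K2 * (2 * K4 + 1).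
      apply: mulr_ge0; first by rewrite !mulr_ge0// ltW.
      by rewrite addr_ge0// ltW// mulr_gt0.
    have h3 : 0 <= 2 * Kd * K4 by apply/ltW/mulr_gt0/K40/mulr_gt0.
    by rewrite ltr_wpDl// addr_ge0// addr_ge0.
move=> t t0; rewrite lt_min => /andP[t1 t2].
have tP : times a0 z0 t.
  split => //; rewrite -ler_pdivlMr ?rbase_gt0// mul1r; exact: ltW.
have tK : t * (kap^-1 * Kg * K2) <= e / 2 by rewrite -ler_pdivlMr// ltW.
(* A fixed point is selected for each v separately; outside |v| <= cR the value 0 is arbitrary. *)
have /choice[sol solP] : forall v : R^o * H, exists x :
  'rV[R]_(N + N + (N + N)),
    `|v| <= cR -> `|x - base a0 z0| <= e /\ fixmap dot f a0 z0 kap t v x = x.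
  move=> v; case: (leP `|v| cR) => [vc|_]; last by exists 0.
  have [x xP] := fixpoint_exists e0 e1 kap0 kapK1 K1P K2P Kg0 Kl0 K20 KgP KlP
    cR0 cR1 cRK4 tP tK vc.
  by exists x.
have KdP' (x : 'rV[R]_(N + N + (N + N)) * (R^o * H)) : dom a0 z0 1 x ->
    `|remsum f t (amp x) (pos x) - remsum f t a0 z0| <= Kd * `|x.1 -
      base a0 z0|.
  move=> Dx; have D1 : dom a0 z0 1
    ((x.1, 0) : 'rV[R]_(N + N + (N + N)) * (R^o * H)).
    by case: Dx => h _; split => //=; rewrite normr0.
  have D0 : dom a0 z0 1 ((base a0 z0, 0) :
    'rV[R]_(N + N + (N + N)) * (R^o * H)).
    by apply: base_dom; rewrite ?normr0.
  have [_ /(_ _ D0)] := KdP t tP _ D1.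
  have [bA [bP _]] := @base_coord R H N a0 z0.
  rewrite bA bP subrr subr0 prod_normE/= subrr normr0 max_l//.
exists (branch t sol).
exact: (spike_branch_branch dot_norm N0 Cf uG e0 e1 c0 good kap0 kapK1 K1P K2P
  Kg0 Kl0 K20 KgP KlP cR0 cR1 cRK4 tP tK K30 K3P solP PE fP (ltW Kd0) KdP').
Qed.

(** * From the branch to the minimisers *)

Section Nondegenerate.
Context (R : realType) (H : completeNormedModType R) (dot : {dot H for idfun}).
Hypothesis dot_norm : forall x : H, dot x x = `|x| ^+ 2.
Context (X : domain) (phi : carrier R X -> H) (N : nat).

(** The two Gram matrices have the same entries but sizes [(2 * N).-1.+1] and [N + N], which are not
    convertible; generalising over the size avoids a cast. *)
Lemma hypI_gramn : (0 < N)%N -> hypI dot phi (2 * N).-1 ->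
  gramn dot N (phiR phi) \in unitmx.
Proof.
move=> N0 hI; suff h m : m = (2 * N).-1.+1 ->
    \matrix_(i < m, j < m) dot (phi_ phi i) (phi_ phi j) \in unitmx.
  by apply: h; rewrite mul2n -addnn prednK ?n_gt0.
by move=> ->; exact: (gram_unitmx dot_norm hI).
Qed.

Lemma pW_span : (0 < N)%N ->
  exists p : 'rV[R]_(N + N), pW dot phi N = \sum_k p 0 k *: phi_ phi k.
Proof.
move=> N0; suff h m : m = (2 * N).-1.+1 ->
    exists p : 'rV[R]_m, pW dot phi N = \sum_k p 0 k *: phi_ phi k.
  by apply: h; rewrite mul2n -addnn prednK ?n_gt0.
move=> ->; exists (invmx (gram dot phi (2 * N).-1) *m delta_mx 0 0)^T.
by apply: eq_bigr => k _; rewrite [in RHS]mxE.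
Qed.

End Nondegenerate.

Lemma class_C_on_submx (R : realType) (V : normedModType R) (N k : nat)
    (U : set V) (g : V -> 'rV[R]_(N + N)) : open U ->
  (forall l, class_C_on k U (fun v => g v 0 l)) ->
  class_C_on k U (fun v => (lsubmx (g v), rsubmx (g v))).
Proof.
move=> oU Cg; rewrite (_ : (fun _ => _) = fun v => \sum_l g v 0 l *:
    ((lsubmx (delta_mx 0 l : 'rV[R]_(N + N)),
      rsubmx (delta_mx 0 l : 'rV[R]_(N + N))) : ('rV[R]_N * 'rV[R]_N)%type)).
  apply: class_C_on_sum => // l; apply: class_C_on_scale => //.
  exact: class_C_on_cst.
apply/funext => v; have := row_sum_delta (g v); set u := g v => uE.
transitivity ((\sum_l u 0 l *: lsubmx (delta_mx 0 l : 'rV[R]_(N + N)),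
  \sum_l u 0 l *: rsubmx (delta_mx 0 l : 'rV[R]_(N + N)))).
  congr (_, _); rewrite [in LHS]uE linear_sum/=; apply: eq_bigr => l _;
    by rewrite linearZ.
elim: (index_enum _) => [|l s ih]; first by rewrite !big_nil.
by rewrite !big_cons -ih.
Qed.

Theorem theorem2 (R : realType) (H : completeNormedModType R)
    (dot : {dot H for idfun}) (dot_norm : forall x : H, dot x x = `|x| ^+ 2)
    (H_separable : exists2 D : set H, countable D & dense D)
    (X : domain) (phi : carrier R X -> H) (N : nat) (a0 z0 : 'rV[R]_N) :
  (0 < N)%N ->
  (forall i, 0 < a0 0 i) ->
  injective (fun i => z0 0 i) ->
  (X = Torus -> forall i, - 4^-1 < z0 0 i < 4^-1) ->
  KER dot phi (2 * N).+1 ->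
  etaW_nondegenerate dot phi N ->
  exists t1 tW C cR M : R,
    [/\ 0 < t1, 0 < tW, 0 < C, 0 < cR & 0 < M] /\
    forall t : R, 0 < t -> t < Num.min t1 tW ->
    let r := cR * t ^+ (2 * N).-1 in
    let B := [set u : R^o * H | `|u.1| < r /\ `|u.2| < r] in
    let y := Phi dot phi (spikes X a0 (t *: z0)) in
    exists g : R^o * H -> 'rV[R]_N * 'rV[R]_N,
      class_C_on (2 * N) B g /\
      forall (lam : R) (w : H), B (lam, w) -> 0 < lam -> `|lam^-1 *: w| <= C ->
      let az := g (lam, w) in
      [/\ exists m, blasso_solution dot phi lam (y + w) m /\
            forall m', blasso_solution dot phi lam (y + w) m' -> same_charge m' m,
          forall m, blasso_solution dot phi lam (y + w) m ->
            [/\ same_charge m (spikes X az.1 (t *: az.2)),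
                forall i, az.1 0 i != 0 &
                injective (fun i => cls X (t * az.2 0 i))] &
          Num.max `|az.1 - a0| `|az.2 - z0| <=
            M * (`|lam| / t ^+ (2 * N).-1 + `|w| / t ^+ (2 * N).-1)].
Proof.
move=> N0 a00 zi _ K nd; have [hI _ _ _] := nd.
have NN : (2 * N)%N = (N + N)%N by rewrite mul2n addnn.
have Cf : class_C (N + N).+1 (phiR phi) by have [h _] := K; rewrite NN in h.
have [p pE] := pW_span dot phi N0.
have fP (k : 'I_(N + N)) : dot (derive1n k (phiR phi) 0) (pW dot phi N) =
    (k == 0%N :> nat)%:R.
  by apply: (pW_dot dot_norm hI); rewrite NN -ltnS prednK ?n_gt0.
have [T [cR [M [K' [[T0 cR0 M0 K'0] TP]]]]] :=
  spike_branch_exists dot_norm N0 Cf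
  (a0 := fun i => a0 0 i) (z0 := fun i => z0 0 i) a00 zi
    (hypI_gramn dot_norm N0 hI)
  pE fP.
have [ep ep0 [d d0 stable]] := certificate_stable dot_norm N0 nd.
set rb := rbase (fun i => a0 0 i) (fun i => z0 0 i).
have rb0 : 0 < rb by exact: rbase_gt0.
(* The certificate is within K' (t + C) of p_W: C uses one half of the tolerance ep, the bound on t
   in the next choice the other half. *)
pose C := Num.min 1 (ep / 2 / K').
have C0 : 0 < C by rewrite lt_min ltr01 !divr_gt0.
have C1 : C <= 1 by rewrite ge_min lexx.
have CK : K' * C <= ep / 2 by rewrite mulrC -ler_pdivlMr// ge_min lexx orbT.
(* In [tW], the first bound keeps the t z_i within the radius d of [certificate_stable], the second
   below 1/2, so that distinct positions have distinct classes on the torus. *)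
exists T, (Num.min (d / rb) (Num.min (2^-1 / rb) (ep / 2 / K'))), C, cR, M.
split; first by split => //; rewrite !lt_min !divr_gt0.
move=> t t0; rewrite !lt_min => /and4P[tT td t2 tK]; rewrite NN.
have [g gP] := TP t t0 tT.
exists (fun v => (lsubmx (g v), rsubmx (g v))); split.
  by apply: class_C_on_submx (smooth_branch gP); exact: open_params.
move=> lam w Bv lam0 wC; set v : R^o * H := (lam, w) in Bv *.
have vC : `|v.2| <= C * v.1.
  by move: wC; rewrite normrZ normfV gtr0_norm// mulrC ler_pdivrMr.
set u := g v => /=.
have aE i : lsubmx u 0 i = ramp u i by rewrite mxE.
have zE i : (t *: rsubmx u) 0 i = t * rpos u i by rewrite !mxE.
have tz i : `|t * rpos u i| <= t * rb.
  by rewrite normrM gtr0_norm// ler_pM2l//; exact: (pos_le_branch gP i Bv).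
have tz2 i : `|t * rpos u i| < 2^-1.
  by apply: (le_lt_trans (tz i)); rewrite -ltr_pdivlMr.
have zinj : injective (fun i => cls X ((t *: rsubmx u) 0 i)).
  move=> i j; rewrite !zE => /(cls_inj (fun _ => lexx _) (tz2 i) (tz2 j)).
  move/(mulfI (lt0r_neq0 t0)); exact: (pos_inj_branch gP Bv).
have yE : Phi dot phi (spikes X a0 (t *: z0)) =
    fsum (phiR phi) t (base_amp_pos (fun i => a0 0 i) (fun i => z0 0 i)).
  rewrite (Phi_spikes dot_norm K) => [|i]; last exact: ltW.
  by rewrite /fsum rampE rposE; apply: eq_bigr => i _; rewrite mxE.
have uE : \sum_(i < N) lsubmx u 0 i *: phiR phi ((t *: rsubmx u) 0 i) =
    fsum (phiR phi) t u.
  by apply: eq_bigr => i _; rewrite aE zE.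
set y := Phi _ _ _ in yE *.
(* The vector p of [spikes_unique_solution] is the certificate estimated by [certificate_branch]. *)
have pE' : lam^-1 *: (y + w - \sum_(i < N) lsubmx u 0 i *:
    phiR phi ((t *: rsubmx u) 0 i)) = (- lam^-1) *: misfit (phiR phi)
    (fun i => a0 0 i) (fun i => z0 0 i) t (u, v).
  rewrite uE yE /misfit scaleNr -scalerN; congr (_ *: _) => /=.
  by rewrite !opprB addrCA addrA.
have opt l := optim_branch gP l Bv.
have p1 i : dot (phiR phi (t * rpos u i)) ((- lam^-1) *: misfit (phiR phi)
    (fun i => a0 0 i) (fun i => z0 0 i) t (u, v)) = 1.
  have := opt (lshift N i); rewrite /optim /atom split_lshiftE dotZr => /eqP.
  rewrite addr_eq0 => /eqP ->; rewrite mulrNN mulVf// gt_eqF//.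
have p0 i : dot ((phiR phi)^`()%classic (t * rpos u i)) ((- lam^-1) *:
    misfit (phiR phi) (fun i => a0 0 i) (fun i => z0 0 i) t (u, v)) = 0.
  have := opt (rshift N i); rewrite /optim /atom split_rshiftE addr0 dotZl.
  rewrite dotZr => /eqP; rewrite mulf_eq0 gt_eqF//= => /eqP ->.
  by rewrite mulr0.
have near : `|(- lam^-1) *: misfit (phiR phi) (fun i => a0 0 i)
    (fun i => z0 0 i) t (u, v) - pW dot phi N| <= ep.
  apply: (le_trans (certificate_branch gP Bv (ltW C0) C1 lam0 vC)).
  rewrite mulrDr (splitr ep) lerD// mulrC -ler_pdivlMr//; exact: ltW.
have inj' : injective (fun i => t * rpos u i).
  move=> i j /(mulfI (lt0r_neq0 t0)); exact: (pos_inj_branch gP Bv).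
have [sol uniq] : blasso_solution dot phi lam (y + w)
    (spikes X (lsubmx u) (t *: rsubmx u)) /\ forall m,
    blasso_solution dot phi lam (y + w) m ->
    same_charge m (spikes X (lsubmx u) (t *: rsubmx u)).
  apply: (spikes_unique_solution dot_norm K lam0) => //.
  - by move=> i; rewrite aE; exact: (amp_gt0_branch gP i Bv).
  - by move=> i; rewrite pE' zE.
  - move=> x xz; rewrite pE'; apply: (stable _ (fun i => t * rpos u i)) => // i.
      by apply: (le_trans (tz i)); rewrite -ler_pdivlMr// ltW.
    by rewrite -zE.
  - move=> b bE i; rewrite aE; apply: (free_branch gP Bv).
    by rewrite -[RHS]uE -bE; apply: eq_bigr => j _; rewrite zE.
split.
- by exists (spikes X (lsubmx u) (t *: rsubmx u)).
- move=> m /uniq mE; split=> // [i|i j].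
    by rewrite aE gt_eqF//; exact: (amp_gt0_branch gP i Bv).
  by rewrite !(mxE _ _ 0) => ij; apply: zinj; rewrite !zE.
have := bound_branch gP Bv; rewrite -/u; apply: le_trans; rewrite ge_max.
have -> : lsubmx u - a0 = lsubmx
  (u - base_amp_pos (fun i => a0 0 i) (fun i => z0 0 i)).
  by rewrite linearB/= row_mxKl; congr (_ - _); apply/rowP => i; rewrite mxE.
have -> : rsubmx u - z0 = rsubmx
  (u - base_amp_pos (fun i => a0 0 i) (fun i => z0 0 i)).
  by rewrite linearB/= row_mxKr; congr (_ - _); apply/rowP => i; rewrite mxE.
by rewrite lsubmx_norm_le rsubmx_norm_le.
Qed.
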